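(* Let $B\subset\mathbb{P}^2$ be a reducible plane sextic of torus type with a singular point of type $\mathbf{A}_{17}$. Then $B$ has one of the following four sets of singularities: $$(\mathbf{A}_{17})\oplus\mathbf{A}_2,\quad (\mathbf{A}_{17})\oplus2\mathbf{A}_1,\quad (\mathbf{A}_{17})\oplus\mathbf{A}_1,\quad (\mathbf{A}_{17}).$$ Each of these sets of singularities is realized by a single connected deformation family of reducible plane sextics of torus type.
   Context: All curves are complex algebraic. A plane sextic $B\subset\mathbb{P}^2$ is of torus type if its equation can be written in the form $p^3+q^2=0$, where $p$ and $q$ are homogeneous polynomials of degree $2$ and $3$, respectively; such a representation (up to the obvious equivalence) is called a torus structure of $B$. A singular point $P$ of $B$ is called inner (outer) with respect to a torus structure $(p,q)$ if $P$ does (respectively, does not) belong to the intersection of the conic $\{p=0\}$ and the cubic $\{q=0\}$. Each sextic considered here has a unique torus structure, so one speaks of inner and outer singular points of $B$. Sets of singularities are written as formal sums of types of simple singularities ($\mathbf{A}$–$\mathbf{D}$–$\mathbf{E}$ notation), in the form $(\Sigma_{\text{inner}})\oplus\Sigma_{\text{outer}}$: the inner singular points are inside the parentheses and the outer ones are outside. Deformation families are equisingular deformation families. *)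

(* Defs.v *)
From HB Require Import structures.
From mathcomp Require Import all_boot all_order all_algebra.
From mathcomp Require Import complex mpoly.
From mathcomp Require Import boolp classical_sets set_interval reals.
From mathcomp Require Import topology normedtype.
Set Implicit Arguments.
Unset Strict Implicit.
Unset Printing Implicit Defensive.
Import Order.TTheory GRing.Theory Num.Theory.
Import numFieldNormedType.Exports.
Local Open Scope classical_set_scope.
Local Open Scope ring_scope.
Local Open Scope complex_scope.

(** Formal power series in two variables: [a i j] is the coefficient of
    [x^i y^j]. *)
Definition series (K : comNzRingType) := nat -> nat -> K.

Section SeriesOperations.
Variable K : comNzRingType.
Implicit Types a b : series K.

Definition series_one : series K := fun i j => ((i == 0%N) && (j == 0%N))%:R.

Definition series_add a b : series K := fun i j => a i j + b i j.

Definition series_mul a b : series K := fun i j =>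
  \sum_(k < i.+1) \sum_(l < j.+1) a k l * b (i - k)%N (j - l)%N.

Definition series_exp a n : series K := iter n (series_mul a) series_one.

Definition series_of_poly (g : {mpoly K[2]}) : series K :=
  fun i j => g@_(U_(0%R) *+ i + U_(1%R) *+ j)%MM.

End SeriesOperations.

Definition convergent (R : realType) (a : series R[i]) : Prop :=
  exists M r : R, forall i j, `|a i j| <= (M * r ^+ (i + j))%:C.

Inductive ADE : Type := A of nat | D of nat | E6 | E7 | E8.

Definition ADE_valid (t : ADE) : bool :=
  match t with
  | A n => (0 < n)%N
  | D n => (3 < n)%N
  | E6 | E7 | E8 => true
  end.

Definition normal_form (K : comNzRingType) (t : ADE) (u v : series K) :
  series K :=
  let pow := @series_exp K in
  match t with
  | A n => series_add (pow u 2) (pow v n.+1)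
  | D n => series_add (series_mul (pow u 2) v) (pow v n.-1)
  | E6 => series_add (pow u 3) (pow v 4)
  | E7 => series_add (pow u 3) (series_mul u (pow v 3))
  | E8 => series_add (pow u 3) (pow v 5)
  end.

Section PlaneCurves.
Variable R : realType.
Local Notation C := R[i].

(** The curve [f = 0] is represented by the form [f], and a point of the
    projective plane by a nonzero vector of homogeneous coordinates. *)
Implicit Types (f p q : {mpoly C[3]}) (P Q : 'rV[C]_3).

Definition same_point P Q : Prop := exists2 c : C, c != 0 & P = c *: Q.

Definition on_curve f P : Prop := f.@[P 0] = 0.

Definition singular_point f P : Prop :=
  [/\ P != 0, on_curve f P & forall i : 'I_3, (f^`M(i)).@[P 0] = 0].

(** For an invertible [M] whose rows are [P], [U], [V], this is the equation
    [f (P + x U + y V)] of the curve in affine coordinates centered at [P]. *)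
Definition local_equation f (M : 'M[C]_3) : {mpoly C[2]} :=
  f \mPo [tuple (M 0 i)%:MP + M 1 i *: 'X_0 + M 2 i *: 'X_1 | i < 3].

(** [u] and [v] are local analytic coordinates at the origin of [C^2]. *)
Definition local_coordinates (u v : series C) : Prop :=
  [/\ convergent u /\ convergent v,
      u 0%N 0%N = 0 /\ v 0%N 0%N = 0 &
      u 1%N 0%N * v 0%N 1%N - u 0%N 1%N * v 1%N 0%N != 0].

(** In suitable local analytic coordinates at [P], the curve [f = 0] is the
    zero locus (as an analytic germ with its multiplicities, whence the
    unit [e]) of the normal form of [t]. *)
Definition has_singularity_type f P (t : ADE) : Prop :=
  [/\ ADE_valid t, singular_point f P &
      exists (M : 'M[C]_3) (u v e : series C),
        [/\ M \in unitmx /\ row 0 M = P,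
            local_coordinates u v,
            convergent e /\ e 0%N 0%N != 0 &
            series_mul e (series_of_poly (local_equation f M)) =2
              normal_form t u v]].

(** The singular points of [f] lying in [S] are finitely many, and their
    types, listed with repetitions, are [ts] (the order is irrelevant, as the
    points may be listed in any order). *)
Definition singularities_in f (S : 'rV[C]_3 -> Prop) (ts : seq ADE) : Prop :=
  exists pt : 'I_(size ts) -> 'rV[C]_3,
    [/\ forall i j, same_point (pt i) (pt j) -> i = j,
        forall P, (singular_point f P /\ S P) <->
                  exists i, same_point P (pt i) &
        forall i, has_singularity_type f (pt i) (tnth (in_tuple ts) i)].

Definition sextic f : Prop := f != 0 /\ f \is 6.-homog.

Definition reducible f : Prop :=
  exists (d e : nat) (g h : {mpoly C[3]}),
    [/\ (0 < d)%N /\ (0 < e)%N, g \is d.-homog, h \is e.-homog & f = g * h].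

Definition torus_structure f p q : Prop :=
  [/\ p \is 2.-homog, q \is 3.-homog &
      exists2 c : C, c != 0 & f = c *: (p ^+ 3 + q ^+ 2)].

Definition torus_type f : Prop := exists p q, torus_structure f p q.

Definition inner p q P : Prop := on_curve p P /\ on_curve q P.

(** [(inn) (+) out]: the inner and the outer singularities are taken with
    respect to the torus structure of [f]. No choice is made among the
    representations [(p, q)] of [f]: all of them are required to give the
    same answer. *)
Definition has_set_of_singularities f (inn out : seq ADE) : Prop :=
  torus_type f /\
  forall p q, torus_structure f p q ->
    singularities_in f (inner p q) inn /\
    singularities_in f (fun P => ~ inner p q P) out.

(** The equisingular stratum of reducible sextics of torus type with a given
    set of singularities. *)
Definition stratum (inn out : seq ADE) f : Prop :=
  [/\ sextic f, reducible f & has_set_of_singularities f inn out].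

(** A path of forms whose coefficients vary continuously: [R[i]] carries the
    topology of the real plane. *)
Definition deformation (F : {mpoly C[3]} -> Prop) f0 f1 : Prop :=
  exists gamma : R -> {mpoly C[3]},
    [/\ forall m : 'X_{1..3},
          {within `[0, 1], continuous (fun t => complex.Re (gamma t)@_m)} /\
          {within `[0, 1], continuous (fun t => complex.Im (gamma t)@_m)},
        gamma 0 = f0,
        gamma 1 = f1 &
        forall t, 0 <= t <= 1 -> F (gamma t)].

Definition single_deformation_family (F : {mpoly C[3]} -> Prop) : Prop :=
  (exists f, F f) /\
  forall f0 f1, F f0 -> F f1 -> deformation F f0 f1.

End PlaneCurves.

(* Main.v *)
(** On the arc [u = 0] of the normal form [u^2 + v^18] at an [A 17] point [P],
    [f = p^3 + q^2] has order 18 and its gradient has order 17.  If [P] is outer,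
    comparing the orders of [p], [q] and of their derivatives shows that the
    square of a curve through [P] divides [f], which is impossible.  If [P] is
    inner, either [p] is a double line and this line is the tangent of the
    cubic [q] at a flex [P], or [p] is a smooth conic modulo which [q] is the
    cube of the tangent at [P]; expanding a factorization of [f] along the conic
    excludes the latter.  Hence [p = - y^2] up to scaling and [f] is the
    product of the cubics [q - y^3] and [q + y^3], which have a common flex, so
    that [f] is projectively equivalent to [W a b1 * W a b2] with
    [W a b = y^2 z - x^3 - a x z^2 - b z^3].  The outer singular points are those
    of the two cubics: a cusp for [a = b = 0], or a node at [(r : 0 : 1)] when
    [a = - 3 r^2] and [b = 2 r^3] with [r <> 0].  Each stratum is therefore
    the image of the complement of a hypersurface in an affine space (of
    matrices and parameters), where two points are joined by a path in the
    complex line through them. *)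
Require Import Defs.
From HB Require Import structures.
From mathcomp Require Import all_boot all_order all_algebra.
From mathcomp Require Import complex mpoly.
From mathcomp Require Import boolp classical_sets set_interval reals.
From mathcomp Require Import topology normedtype.
From mathcomp Require derive.
From mathcomp Require Import ring lra zify.
Set Implicit Arguments.
Unset Strict Implicit.
Unset Printing Implicit Defensive.
Import Order.TTheory GRing.Theory Num.Theory.
Local Open Scope ring_scope.

(** The order 18 of f on the arc decides nothing by itself, since p^3 and q^2 may cancel there; it
    is the order of the gradient, 3 p^2 p_i + 2 q q_i, that controls p and q separately. It also
    excludes double components: along a double component that is smooth at the point, the gradient
    has order 9 instead of 17. The hypothesis speaks of power series, but only orders up to 19 are
    read off, so the series are truncated at order 20, the arc is taken polynomial, and every
    estimate becomes a divisibility by a power of ['X]. In the outer case the estimates lead to p =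
    2 s - l^2 and q = l^3 - 3 l s with l linear and s quadratic, whence p^3 + q^2 = s^2 (8 s - 3
    l^2). For the realization of nodes and cusps, the coordinates are multiplied by powers of the
    equation of the other cubic, a unit at the point, so that no root of this unit is extracted. The
    four sets are told apart by the number of outer points, except for A 1 and A 2, which are
    separated by the rank of the Hessian. *)

Section MPolyMorphisms.
Variables (n : nat) (K A : comNzRingType).

(** Induction along the ring operations suits statements on morphisms and derivations: they are
    checked on constants and variables and propagate through sums and products. *)
Lemma mpoly_ring_ind (P : {mpoly K[n]} -> Prop) :
  (forall c, P c%:MP) -> (forall i, P 'X_i) ->
  (forall F G, P F -> P G -> P (F + G)) ->
  (forall F G, P F -> P G -> P (F * G)) -> forall F, P F.
Proof.
move=> PC PX PD PM; apply: mpolyind; first by rewrite -mpolyC0.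
move=> c m F _ _ PF; apply: (PD) PF; rewrite -mul_mpolyC; apply: (PM) => //.
rewrite mpolyXE_id; elim/big_rec: _ => [|i G _ PG]; first by rewrite -mpolyC1.
by apply: (PM) PG; elim: (m i) => [|k IHk]; rewrite ?expr0 ?exprS -?mpolyC1; auto.
Qed.

Lemma mpoly_morph_eq (f g : {rmorphism {mpoly K[n]} -> A}) :
  (forall c, f c%:MP = g c%:MP) -> (forall i, f 'X_i = g 'X_i) -> f =1 g.
Proof.
move=> fgC fgX; apply: mpoly_ring_ind => //.
  by move=> F G eF eG; rewrite !rmorphD /= eF eG.
by move=> F G eF eG; rewrite !rmorphM /= eF eG.
Qed.

Variable f : {rmorphism K -> A}.

Lemma mmapXU (h : 'I_n -> A) i : mmap f h 'X_i = h i.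
Proof. by rewrite mmapX mmap1U. Qed.

Lemma eq_mmap (h h' : 'I_n -> A) F : h =1 h' -> mmap f h F = mmap f h' F.
Proof.
move=> e; apply: mpoly_morph_eq F => [c|i]; first by rewrite /= !mmapC.
by rewrite /= !mmapXU.
Qed.

Lemma mmap_comp k (lq : n.-tuple {mpoly K[k]}) (h : 'I_k -> A) F :
  mmap f h (F \mPo lq) = mmap f (fun i => mmap f h (tnth lq i)) F.
Proof.
elim/mpoly_ring_ind: F => [c|i|F G eF eG|F G eF eG].
- by rewrite comp_mpolyC !mmapC.
- by rewrite comp_mpolyXU mmapXU -tnth_nth.
- by rewrite comp_mpolyD !rmorphD /= eF eG.
- by rewrite rmorphM /= !rmorphM /= eF eG.
Qed.

End MPolyMorphisms.

Definition i0 : 'I_3 := @Ordinal 3 0 isT.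
Definition i1 : 'I_3 := @Ordinal 3 1 isT.
Definition i2 : 'I_3 := @Ordinal 3 2 isT.

Lemma ord3P (P : 'I_3 -> Prop) : P i0 -> P i1 -> P i2 -> forall i, P i.
Proof.
move=> P0 P1 P2 [[|[|[|//]]] lti].
- by rewrite (_ : Ordinal lti = i0) //; apply: val_inj.
- by rewrite (_ : Ordinal lti = i1) //; apply: val_inj.
- by rewrite (_ : Ordinal lti = i2) //; apply: val_inj.
Qed.

Lemma sum3 (V : nmodType) (F : 'I_3 -> V) :
  \sum_(i < 3) F i = F i0 + F i1 + F i2.
Proof.
rewrite !big_ord_recl big_ord0 addr0 addrA.
by congr (F _ + F _ + F _); apply: val_inj.
Qed.

Definition vec3 T (a b c : T) (i : 'I_3) : T :=
  match val i with 0 => a | 1 => b | _ => c end.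

(** * Ternary forms written out by their coefficients *)

Section Forms.
Variable K : comNzRingType.
Local Notation form := {mpoly K[3]}.

Definition mon3 a b c : 'X_{1..3} := (U_(i0) *+ a + U_(i1) *+ b + U_(i2) *+ c)%MM.

Lemma mon3E a b c : (mon3 a b c i0 = a) * (mon3 a b c i1 = b) * (mon3 a b c i2 = c).
Proof. by rewrite !mnmDE !mulmnE !mnm1E /= !(mul0n, mul1n, addn0, add0n). Qed.

Lemma mdeg3 (m : 'X_{1..3}) : mdeg m = (m i0 + m i1 + m i2)%N.
Proof. by rewrite mdegE (sum3 (V:= nat)). Qed.

Lemma mon3_eta (m : 'X_{1..3}) : m = mon3 (m i0) (m i1) (m i2).
Proof. by apply/mnmP; apply: ord3P; rewrite mon3E. Qed.

Lemma mpolyX_mon3 a b c : 'X_[mon3 a b c] = 'X_i0 ^+ a * 'X_i1 ^+ b * 'X_i2 ^+ c :> form.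
Proof. by rewrite !mpolyXD !mpolyXn. Qed.

Lemma formE d (F : form) : F \is d.-homog ->
  F = \sum_(i < d.+1) \sum_(j < (d - i).+1)
        (F@_(mon3 (d - i - j) i j))%:MP * 'X_i0 ^+ (d - i - j) * 'X_i1 ^+ i * 'X_i2 ^+ j.
Proof.
move=> homF; apply/mpolyP => m.
have termE (i j : nat) : ((F@_(mon3 (d - i - j) i j))%:MP * 'X_i0 ^+ (d - i - j) * 'X_i1 ^+ i * 'X_i2 ^+ j)@_m
    = F@_(mon3 (d - i - j) i j) * (mon3 (d - i - j) i j == m)%:R.
  by rewrite -2!mulrA [X in _ * X]mulrA -mpolyX_mon3 mcoeffCM mcoeffX.
rewrite raddf_sum /=.
under eq_bigr => i _ do (rewrite raddf_sum /=; under eq_bigr => j _ do rewrite termE).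
have [md|md] := eqVneq (mdeg m) d; last first.
  rewrite (dhomog_nemf_coeff homF md) !big1 // => i _; rewrite big1 // => j _.
  case: eqP => [e|_]; last by rewrite mulr0.
  by case/eqP: md; have := ltn_ord i; have := ltn_ord j; rewrite -e mdeg3 !mon3E; lia.
rewrite mdeg3 in md.
have lt1 : (m i1 < d.+1)%N by lia.
have lt2 : (m i2 < (d - m i1).+1)%N by lia.
have em : mon3 (d - m i1 - m i2) (m i1) (m i2) = m.
  by rewrite [RHS]mon3_eta; congr mon3; lia.
rewrite (bigD1 (Ordinal lt1)) //= (bigD1 (Ordinal lt2)) //=.
rewrite em eqxx mulr1 !big1 ?addr0 // => [i /eqP ne|j /eqP ne].
  rewrite big1 // => j _; case: eqP => [e|_]; last by rewrite mulr0.
  by case: ne; apply: val_inj; rewrite /= -e mon3E.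
case: eqP => [e|_]; last by rewrite mulr0.
by have := congr1 (fun m : 'X_{1..3} => m i2) e; rewrite mon3E => ej; case: ne; apply: val_inj.
Qed.

Lemma form_coef d (F : form) : F \is d.-homog -> exists c : nat -> nat -> K,
  F = \sum_(i < d.+1) \sum_(j < (d - i).+1)
        (c i j)%:MP * 'X_i0 ^+ (d - i - j) * 'X_i1 ^+ i * 'X_i2 ^+ j.
Proof. by move/formE => eF; exists (fun i j => F@_(mon3 (d - i - j) i j)). Qed.

Lemma form2P (F : form) : F \is 2.-homog -> exists a b c d e g : K,
  F = a%:MP * 'X_i0 ^+ 2 + b%:MP * ('X_i0 * 'X_i1) + c%:MP * ('X_i0 * 'X_i2)
      + d%:MP * 'X_i1 ^+ 2 + e%:MP * ('X_i1 * 'X_i2) + g%:MP * 'X_i2 ^+ 2.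
Proof.
move/form_coef=> [cf ->].
rewrite !(big_ord_recl, big_ord0) /= /bump /= !(expr0, expr1, mulr1, addr0).
exists (cf 0%N 0%N), (cf 1%N 0%N), (cf 0%N 1%N), (cf 2%N 0%N), (cf 1%N 1%N), (cf 0%N 2%N).
move: 'X_i0 'X_i1 'X_i2 => x y z; time ring.
Qed.

Lemma form3P (F : form) : F \is 3.-homog -> exists a b c d e g h k l m : K,
  F = a%:MP * 'X_i0 ^+ 3 + b%:MP * ('X_i0 ^+ 2 * 'X_i1) + c%:MP * ('X_i0 ^+ 2 * 'X_i2)
      + d%:MP * ('X_i0 * 'X_i1 ^+ 2) + e%:MP * ('X_i0 * 'X_i1 * 'X_i2) + g%:MP * ('X_i0 * 'X_i2 ^+ 2)
      + h%:MP * 'X_i1 ^+ 3 + k%:MP * ('X_i1 ^+ 2 * 'X_i2) + l%:MP * ('X_i1 * 'X_i2 ^+ 2)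
      + m%:MP * 'X_i2 ^+ 3.
Proof.
move/form_coef=> [cf ->].
rewrite !(big_ord_recl, big_ord0) /= /bump /= !(expr0, expr1, mulr1, addr0).
exists (cf 0%N 0%N), (cf 1%N 0%N), (cf 0%N 1%N), (cf 2%N 0%N), (cf 1%N 1%N), (cf 0%N 2%N), (cf 3%N 0%N), (cf 2%N 1%N), (cf 1%N 2%N), (cf 0%N 3%N).
move: 'X_i0 'X_i1 'X_i2 => x y z; time ring.
Qed.

End Forms.

(** * Linear changes of coordinates *)

Section Substitution.
Variable K : comNzRingType.
Implicit Types (N M : 'M[K]_3) (F G : {mpoly K[3]}).

(** The form [X |-> F (X N)], for row vectors [X]. *)
Definition subst N F : {mpoly K[3]} :=
  F \mPo [tuple \sum_(k < 3) (N k j)%:MP * 'X_k | j < 3].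

Lemma mmap_subst (A : comNzRingType) (f : {rmorphism K -> A}) h N F :
  mmap f h (subst N F) = mmap f (fun j => \sum_(k < 3) f (N k j) * h k) F.
Proof.
rewrite mmap_comp; apply: eq_mmap => j; rewrite tnth_mktuple rmorph_sum /=.
by apply: eq_bigr => k _; rewrite rmorphM /= mmapC mmapXU.
Qed.

Lemma meval_subst N F (P : 'rV[K]_3) : (subst N F).@[P 0] = F.@[(P *m N) 0].
Proof.
rewrite /meval mmap_subst; apply: eq_mmap => j /=; rewrite mxE.
by apply: eq_bigr => k _; rewrite mulrC.
Qed.

Lemma mpoly_mmap n (F : {mpoly K[n]}) : mmap (@mpolyC n K) (fun i => 'X_i) F = F.
Proof.
elim/mpoly_ring_ind: F => [c|i|F G eF eG|F G eF eG].
- by rewrite mmapC.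
- by rewrite mmapXU.
- by rewrite rmorphD /= eF eG.
- by rewrite rmorphM /= eF eG.
Qed.

Lemma mpoly_extE F G :
  mmap (@mpolyC 3 K) (fun i => 'X_i) F = mmap (@mpolyC 3 K) (fun i => 'X_i) G -> F = G.
Proof. by rewrite !mpoly_mmap. Qed.

Lemma substM N M F : subst N (subst M F) = subst (N *m M) F.
Proof.
apply: mpoly_extE; rewrite !mmap_subst; apply: eq_mmap => j.
under [RHS]eq_bigr do rewrite mxE rmorph_sum mulr_suml.
rewrite exchange_big; apply: eq_bigr => k _; rewrite mulr_sumr.
by apply: eq_bigr => l _; rewrite rmorphM /=; ring.
Qed.

Lemma subst1 F : subst 1%:M F = F.
Proof.
rewrite -[RHS]mpoly_mmap -[LHS]mpoly_mmap mmap_subst; apply: eq_mmap => j.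
rewrite (bigD1 j) //= mxE eqxx mul1r big1 ?addr0 // => k ne.
by rewrite mxE (negPf ne) /= mpolyC0 mul0r.
Qed.

HB.instance Definition _ N := GRing.RMorphism.copy (subst N)
  (comp_mpoly [tuple \sum_(k < 3) (N k j)%:MP * 'X_k | j < 3]).

Lemma subst_homog N F d : F \is d.-homog -> subst N F \is d.-homog.
Proof.
move=> homF; rewrite /subst comp_mpolyEX big_seq rpred_sum // => m mF.
apply: rpredZ; rewrite comp_mpolyX.
have -> : d = (\sum_(i < 3) m i)%N by rewrite -mdegE -(dhomog_mf homF mF).
have hN j : tnth [tuple \sum_(k < 3) (N k j)%:MP * 'X_k | j < 3] j \is 1.-homog.
  rewrite tnth_mktuple; apply: rpred_sum => k _; rewrite mul_mpolyC.
  by apply: rpredZ; rewrite dhomogX /= mdeg1.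
elim: (index_enum _) (tnth _) hN => [|i s IHs] t ht; first by rewrite !big_nil dhomog1.
rewrite !big_cons; apply: dhomogM => //; last exact: IHs.
by rewrite -[X in X.-homog]mul1n; apply: dhomogMn.
Qed.

Lemma mderivXU n (k i : 'I_n) : ('X_k : {mpoly K[n]})^`M(i) = (k == i)%:R%:MP.
Proof.
rewrite mderivX mnm1E; have [->|_] := eqVneq; last by rewrite scale0r.
by rewrite (_ : U_(i) - U_(i) = 0)%MM ?mpolyX0 ?scale1r //; apply/mnmP => j; rewrite mnmBE subnn mnm0E.
Qed.

Lemma mderiv_subst N F i :
  (subst N F)^`M(i) = \sum_(j < 3) (N i j)%:MP * subst N F^`M(j).
Proof.
elim/mpoly_ring_ind: F => [c|k|F G eF eG|F G eF eG].
- rewrite /subst comp_mpolyC mderivC big1 // => j _.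
  by rewrite mderivC comp_mpoly0 mulr0.
- rewrite /subst comp_mpolyXU -tnth_nth tnth_mktuple.
  rewrite raddf_sum /= (bigD1 i) //= [RHS](bigD1 k) //= !mderiv_mulC !mderivXU !eqxx.
  rewrite comp_mpolyC !big1 // => [j ne|j ne].
    by rewrite mderivXU eq_sym (negPf ne) comp_mpolyC mpolyC0 mulr0.
  by rewrite mderiv_mulC mderivXU (negPf ne) mpolyC0 mulr0.
- rewrite rmorphD /= !mderivD eF eG -big_split /=.
  by apply: eq_bigr => j _; rewrite mderivD rmorphD /= mulrDr.
- rewrite rmorphM /= mderivM eF eG mulr_suml mulr_sumr -big_split /=.
  by apply: eq_bigr => j _; rewrite mderivM rmorphD !rmorphM /=; ring.
Qed.

End Substitution.

Lemma substVK (K : comUnitRingType) (N : 'M[K]_3) (F : {mpoly K[3]}) :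
  N \in unitmx -> subst (invmx N) (subst N F) = F.
Proof. by move=> uN; rewrite substM mulVmx // subst1. Qed.

Lemma i0E : 0 = i0. Proof. exact: val_inj. Qed.
Lemma i1E : 1 = i1. Proof. exact: val_inj. Qed.
Lemma i2E : 2%:R = i2. Proof. exact: val_inj. Qed.

(** * Projective invariance of singularities, torus structures and strata *)

Section Transport.
Variable R : realType.
Local Notation C := R[i].
Implicit Types (f p q : {mpoly C[3]}) (P : 'rV[C]_3) (N M : 'M[C]_3).

Lemma local_equationE f M :
  local_equation f M = mmap (@mpolyC 2 C) (vec3 1 'X_0 'X_1) (subst M f).
Proof.
rewrite mmap_subst /local_equation; apply: eq_mmap => j.
rewrite tnth_mktuple sum3 /= /vec3 /= mulr1 !mul_mpolyC.
by rewrite ?i2E ?i1E ?i0E.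
Qed.

Lemma local_equation_subst f N M :
  local_equation (subst N f) M = local_equation f (M *m N).
Proof. by rewrite !local_equationE substM. Qed.

Lemma singular_point_subst f N P : N \in unitmx ->
  singular_point (subst N f) P <-> singular_point f (P *m N).
Proof.
move=> uN; rewrite /singular_point /on_curve meval_subst.
split=> -[nzP fP dfP]; split => //.
- by apply: contra_neq nzP => e; rewrite -(mulmxK uN P) e mul0mx.
(* By the chain rule the gradient of [subst N f] is the gradient of [f] multiplied by the transpose
   of [N], which is invertible. *)
- pose D := \row_j (f^`M(j)).@[(P *m N) 0].
  have : D *m N^T = 0.
    apply/rowP => i; rewrite !mxE -[RHS](dfP i) mderiv_subst rmorph_sum.
    by apply: eq_bigr => j _; rewrite rmorphM /= mevalC meval_subst !mxE mulrC.
  move/(congr1 (mulmx^~ (invmx N^T))); rewrite mulmxK ?unitmx_tr // mul0mx.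
  by move=> eD i; have := congr1 (fun u : 'rV_3 => u 0 i) eD; rewrite !mxE.
- by apply: contra_neq nzP => ->; rewrite mul0mx.
- move=> i; rewrite mderiv_subst rmorph_sum big1 // => j _.
  by rewrite rmorphM /= meval_subst dfP mulr0.
Qed.

Lemma has_singularity_type_subst f N P t : N \in unitmx ->
  has_singularity_type f (P *m N) t -> has_singularity_type (subst N f) P t.
Proof.
move=> uN [vt sP [M [u [v [e [[uM eM] luv ce eq]]]]]]; split => //.
  exact/singular_point_subst.
exists (M *m invmx N), u, v, e; split; [|exact: luv|exact: ce|].
  by rewrite unitmx_mul uM unitmx_inv row_mul eM mulmxK.
by rewrite local_equation_subst mulmxKV.
Qed.

Lemma torus_structure_subst f p q N :
  torus_structure f p q -> torus_structure (subst N f) (subst N p) (subst N q).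
Proof.
case=> hp hq [c nzc ->]; split; [exact: subst_homog | exact: subst_homog |].
by exists c; rewrite // -!mul_mpolyC !(rmorphM, rmorphD, rmorphXn) /= [subst N c%:MP]comp_mpolyC.
Qed.

Lemma on_curve_subst f N P : on_curve (subst N f) P <-> on_curve f (P *m N).
Proof. by rewrite /on_curve meval_subst. Qed.

Lemma inner_subst p q N P : inner (subst N p) (subst N q) P <-> inner p q (P *m N).
Proof. by split=> -[hp hq]; split; apply/on_curve_subst. Qed.

Lemma same_point_mul P Q N : same_point P Q -> same_point (P *m N) (Q *m N).
Proof. by case=> c nzc ->; exists c; rewrite // scalemxAl. Qed.

Lemma singularities_in_subst f N (S S' : 'rV[C]_3 -> Prop) ts : N \in unitmx ->
  (forall P, S' P <-> S (P *m N)) ->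
  singularities_in f S ts -> singularities_in (subst N f) S' ts.
Proof.
move=> uN eS [pt [inj_pt sing_pt ty_pt]]; exists (fun i => pt i *m invmx N).
have mulK := mulmxK uN; have mulKV := mulmxKV uN.
split => [i j /(same_point_mul N)|P|i].
- by rewrite !mulmxKV //; apply: inj_pt.
- rewrite singular_point_subst // eS sing_pt; split=> -[i ei]; exists i.
    by rewrite -(mulmxK uN P); apply: same_point_mul.
  by rewrite -(mulmxKV uN (pt i)); apply: same_point_mul.
- by apply: has_singularity_type_subst => //; rewrite mulmxKV.
Qed.

Lemma has_set_subst f N inn out : N \in unitmx ->
  has_set_of_singularities f inn out -> has_set_of_singularities (subst N f) inn out.
Proof.
move=> uN [[p [q tor]] sing]; split.
  by exists (subst N p), (subst N q); apply: torus_structure_subst.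
(* All torus structures of the transformed sextic have to be treated, so an arbitrary one is pulled
   back by the inverse matrix. *)
move=> p' q' /(torus_structure_subst (invmx N)); rewrite substVK // => /sing[sin sout].
have inE P : inner p' q' P <-> inner (subst (invmx N) p') (subst (invmx N) q') (P *m N).
  by split=> [|/inner_subst]; rewrite ?mulmxK // => hin; apply/inner_subst; rewrite mulmxK.
split; first exact: (singularities_in_subst uN inE sin).
apply: (singularities_in_subst uN _ sout) => P.
by split=> nin /inE.
Qed.

Lemma sextic_subst f N : N \in unitmx -> sextic f -> sextic (subst N f).
Proof.
move=> uN [nzf hf]; split; last exact: subst_homog.
by apply: contra_neq nzf => e; rewrite -(substVK f uN) e rmorph0.
Qed.

Lemma reducible_subst f N : reducible f -> reducible (subst N f).
Proof.
case=> d [e [g [h [de hg hh ->]]]]; exists d, e, (subst N g), (subst N h).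
by split; rewrite ?rmorphM //; apply: subst_homog.
Qed.

Lemma stratum_subst f N inn out : N \in unitmx ->
  stratum inn out f -> stratum inn out (subst N f).
Proof.
move=> uN [sf rf hf]; split; [exact: sextic_subst | exact: reducible_subst | exact: has_set_subst].
Qed.

End Transport.

(** Stated over any ring, so that one formula serves for the forms themselves, for their values at
    points and for their restrictions to polynomial arcs. *)
Definition cf1 (A : comNzRingType) (a b c w x y : A) : A := a * w + b * x + c * y.

Definition cf2 (A : comNzRingType) (a b c d e g w x y : A) : A :=
  a * w ^+ 2 + b * (w * x) + c * (w * y) + d * x ^+ 2 + e * (x * y) + g * y ^+ 2.

Definition cf3 (A : comNzRingType) (a b c d e g h k l m w x y : A) : A :=
  a * w ^+ 3 + b * (w ^+ 2 * x) + c * (w ^+ 2 * y) + d * (w * x ^+ 2)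
  + e * (w * x * y) + g * (w * y ^+ 2) + h * x ^+ 3 + k * (x ^+ 2 * y)
  + l * (x * y ^+ 2) + m * y ^+ 3.

Section ExplicitForms.
Variable K : comNzRingType.

Definition pol1 (a b c : K) : {mpoly K[3]} :=
  cf1 a%:MP b%:MP c%:MP 'X_i0 'X_i1 'X_i2.

Definition pol2 (a b c d e g : K) : {mpoly K[3]} :=
  cf2 a%:MP b%:MP c%:MP d%:MP e%:MP g%:MP 'X_i0 'X_i1 'X_i2.

Definition pol3 (a b c d e g h k l m : K) : {mpoly K[3]} :=
  cf3 a%:MP b%:MP c%:MP d%:MP e%:MP g%:MP h%:MP k%:MP l%:MP m%:MP 'X_i0 'X_i1 'X_i2.

Section Evaluation.
Variables (A : comNzRingType) (f : {rmorphism K -> A}).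

Lemma mmap_pol1 v a b c :
  mmap f v (pol1 a b c) = cf1 (f a) (f b) (f c) (v i0) (v i1) (v i2).
Proof. by rewrite /pol1 /cf1 !(rmorphD, rmorphM) /= !mmapC !mmapXU. Qed.

Lemma mmap_pol2 v a b c d e g : mmap f v (pol2 a b c d e g) =
  cf2 (f a) (f b) (f c) (f d) (f e) (f g) (v i0) (v i1) (v i2).
Proof. by rewrite /pol2 /cf2 !(rmorphD, rmorphM, rmorphXn) /= !mmapC !mmapXU. Qed.

Lemma mmap_pol3 v a b c d e g h k l m : mmap f v (pol3 a b c d e g h k l m) =
  cf3 (f a) (f b) (f c) (f d) (f e) (f g) (f h) (f k) (f l) (f m) (v i0) (v i1) (v i2).
Proof. by rewrite /pol3 /cf3 !(rmorphD, rmorphM, rmorphXn) /= !mmapC !mmapXU. Qed.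

End Evaluation.

Lemma homog2P (F : {mpoly K[3]}) : F \is 2.-homog ->
  exists a b c d e g, F = pol2 a b c d e g.
Proof. exact: form2P. Qed.

Lemma homog3P (F : {mpoly K[3]}) : F \is 3.-homog ->
  exists a b c d e g h k l m, F = pol3 a b c d e g h k l m.
Proof. exact: form3P. Qed.

Definition mderivE := (mderivD, mderiv_mulC, mderivM, mderivXU).

Lemma mderiv_pol3 a b c d e g h k l m :
  ((pol3 a b c d e g h k l m)^`M(i0) = pol2 (3%:R * a) (2%:R * b) (2%:R * c) d e g) *
  ((pol3 a b c d e g h k l m)^`M(i1) = pol2 b (2%:R * d) e (3%:R * h) (2%:R * k) l) *
  ((pol3 a b c d e g h k l m)^`M(i2) = pol2 c e (2%:R * g) k (2%:R * l) (3%:R * m)).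
Proof.
rewrite /pol3 /pol2 /cf3 /cf2 !exprS !expr0 !mulr1 !mderivE !mpolyCM !mpolyC_nat /=.
by move: 'X_i0 'X_i1 'X_i2 => x y z; split; first split; ring.
Qed.

Lemma mderiv_pol2 a b c d e g :
  ((pol2 a b c d e g)^`M(i0) = pol1 (2%:R * a) b c) *
  ((pol2 a b c d e g)^`M(i1) = pol1 b (2%:R * d) e) *
  ((pol2 a b c d e g)^`M(i2) = pol1 c e (2%:R * g)).
Proof.
rewrite /pol2 /pol1 /cf2 /cf1 !exprS !expr0 !mulr1 !mderivE !mpolyCM !mpolyC_nat /=.
by move: 'X_i0 'X_i1 'X_i2 => x y z; split; first split; ring.
Qed.

End ExplicitForms.

(** * Torus structures along the arc of an [A 17] point *)

Section PolyOrder.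
Variable K : fieldType.
Implicit Types (p q r u : {poly K}).

Lemma Xn_dvdP n p : reflect (exists q, p = 'X^n * q) ('X^n %| p).
Proof. by apply: (iffP (dvdpP _ _)) => -[q ->]; exists q; rewrite mulrC. Qed.

Lemma dvd_Xn m n p : (m <= n)%N -> 'X^n %| p -> 'X^m %| p.
Proof. by move=> le; apply: dvdp_trans; apply: dvdp_exp2l. Qed.

Lemma X_dvd0 p : ('X %| p) = (p.[0] == 0).
Proof. by rewrite -[X in X %| _]subr0 -[X in _ - X]polyC0 dvdp_XsubCl. Qed.

Lemma dvd_Xn_unit n u p : u.[0] != 0 -> ('X^n %| u * p) = ('X^n %| p).
Proof.
move=> nz; apply: Gauss_dvdpr; apply: coprimep_expl.
by rewrite coprimep_sym coprimepX.
Qed.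

Lemma dvd_Xn_shift m n p : (m <= n)%N -> ('X^n %| 'X^m * p) = ('X^(n - m) %| p).
Proof. by move=> le; rewrite -{1}(subnKC le) exprD dvdp_mul2l // expf_neq0 // polyX_eq0. Qed.

Lemma dvd_Xn_mul m n p : (n <= m)%N -> 'X^n %| 'X^m * p.
Proof. by move=> le; apply: dvdp_mulr; apply: dvdp_exp2l. Qed.

Lemma dvd_Xn_exact n m p : p.[0] != 0 -> ('X^n %| 'X^m * p) = (n <= m)%N.
Proof.
move=> nz; have [le|lt] := leqP n m; first exact: dvd_Xn_mul.
rewrite dvd_Xn_shift 1?ltnW //; apply/negbTE; apply: contra nz => d.
by rewrite -X_dvd0; apply: (@dvd_Xn 1 _ _ _ d); rewrite subn_gt0.
Qed.

Lemma Xn_factor p : p != 0 -> exists2 q, q.[0] != 0 & exists m, p = 'X^m * q.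
Proof.
move=> nz; have [m [q rq e]] := multiplicity_XsubC p 0.
by exists q; [apply: (implyP rq) | exists m; rewrite e subr0 mulrC].
Qed.

(** The tool for eliminating coefficients: once an expression is written with a unit [u] at its
    lowest possible order, a higher divisibility leaves no room for [c]. The coefficients of [p] and
    [q] are removed with it one order at a time. *)
Lemma low_coef n u (c : K) r : u.[0] != 0 ->
  ('X^(n.+1) %| 'X^n * (c%:P * u + 'X * r))%R -> c = 0.
Proof.
move=> nz; rewrite dvd_Xn_shift // subSnn expr1 X_dvd0 !hornerE.
by rewrite mulf_eq0 (negPf nz) orbF => /eqP.
Qed.

End PolyOrder.

Definition evp (K : comNzRingType) (F : {mpoly K[3]}) (W : 'I_3 -> {poly K}) :=
  mmap (@polyC K) W F.

(** The trace that an [A 17] point leaves on the arc [W] along which the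
    coordinate [u] of the normal form [u^2 + v^18] vanishes. *)
Record arc17 (K : fieldType) (F : {mpoly K[3]}) (W : 'I_3 -> {poly K}) : Prop := Arc17 {
  arc_order : 'X^18 %| evp F W;
  arc_exact : ~~ ('X^19 %| evp F W);
  arc_grad : forall i, 'X^17 %| evp F^`M(i) W;
  arc_double : exists v : 'I_3 -> K,
    ~~ ('X^3 %| evp F (fun i => (W i).[0]%:P + 'X * (v i)%:P)) }.

(** * Contact orders at an inner point *)

Section Inner.
Variable K : numClosedFieldType.
Implicit Types (p q : {mpoly K[3]}) (w y : {poly K}).

Lemma evpD (F G : {mpoly K[3]}) W : evp (F + G) W = evp F W + evp G W.
Proof. exact: mmapD. Qed.

Lemma evpM (F G : {mpoly K[3]}) W : evp (F * G) W = evp F W * evp G W.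
Proof. exact: rmorphM. Qed.

Lemma evpX (F : {mpoly K[3]}) n W : evp (F ^+ n) W = evp F W ^+ n.
Proof. exact: rmorphXn. Qed.

Lemma torus_grad p q i W :
  evp (p ^+ 3 + q ^+ 2)^`M(i) W =
  3%:R * evp p W ^+ 2 * evp p^`M(i) W + 2%:R * evp q W * evp q^`M(i) W.
Proof.
rewrite mderivD !exprS !expr0 !mulr1 !mderivM !(evpD, evpM).
by set a := evp p W; set b := evp q W; set c := evp _ W; set d := evp _ W; ring.
Qed.

(** Let m and j be the orders of p and q on the arc, and suppose j < 10. If j < 2m, the term 2 q q_i
    gives the partial derivative of f the order j < 17. If 2m <= j, then q^2 has larger order than
    p^3 and f has order 3m < 18. Hence j >= 10, q^2 has order at least 20, and the order 18 of f is
    that of p^3. *)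
Lemma inner_orders p q W i : arc17 (p ^+ 3 + q ^+ 2) W ->
  'X %| evp p W -> (evp q^`M(i) W).[0] != 0 ->
  [/\ 'X^6 %| evp p W, ~~ ('X^7 %| evp p W) & 'X^10 %| evp q W].
Proof.
case=> []; rewrite evpD !evpX => d18 n19 dgrad _ Xa nzD.
have {dgrad} := dgrad i; rewrite torus_grad.
move: (evp p W) (evp q W) (evp p^`M(i) W) (evp q^`M(i) W) d18 n19 Xa nzD.
move=> a b a1 b1 d18 n19 Xa nzb1 dD.
have db n : 'X^n %| b -> (2 * n >= 19)%N -> 'X^19 %| b ^+ 2.
  by case/Xn_dvdP=> b' -> le; rewrite exprMn -exprM; apply: dvd_Xn_mul; lia.
have cube n a' : a = 'X^n * a' -> a'.[0] != 0 -> 'X^19 %| b ^+ 2 -> n = 6%N.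
  move=> ea nza' b19; have ea3 : a ^+ 3 = 'X^(n * 3) * a' ^+ 3 by rewrite ea exprMn -exprM.
  have nz3 : (a' ^+ 3).[0] != 0 by rewrite horner_exp expf_neq0.
  have le : (18 <= n * 3)%N.
    rewrite -(dvd_Xn_exact _ _ nz3) -ea3 -[a ^+ 3](addrK (b ^+ 2)).
    by rewrite dvdp_sub //; apply: dvd_Xn b19.
  suff: (n * 3 < 19)%N by lia.
  rewrite ltnNge -(dvd_Xn_exact _ _ nz3) -ea3; apply: contra n19 => d.
  exact: dvdp_add.
have nz2b : (2%:R * b1).[0] != 0.
  by rewrite -polyC_natr hornerM hornerC mulf_neq0 // pnatr_eq0.
have [a0|/Xn_factor[a' nza' [m ea]]] := eqVneq a 0.
  move: dD; rewrite a0 expr0n /= mulr0 mul0r add0r mulrAC dvd_Xn_unit // => /db d.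
  by case/negP: n19; rewrite a0 expr0n /= add0r; apply: d.
have m1 : (0 < m)%N by rewrite -(dvd_Xn_exact _ _ nza') -ea expr1.
suff b10 : 'X^10 %| b.
  have em := cube _ _ ea nza' (db _ b10 isT).
  by rewrite ea !dvd_Xn_exact // em.
have [->|/Xn_factor[b' nzb' [j eb]]] := eqVneq b 0; first exact: dvdp0.
rewrite eb dvd_Xn_exact // leqNgt; apply/negP => j10.
have [lt|le] := ltnP j (2 * m).
  have : 'X^(j.+1) %| 2%:R * b * b1.
    rewrite -[_ * b1](addKr (3%:R * a ^+ 2 * a1)) addrC dvdp_sub //.
      by apply: dvd_Xn dD; lia.
    rewrite -mulrA; apply: dvdp_mull; apply: dvdp_mulr; rewrite ea exprMn -exprM; apply: dvd_Xn_mul; lia.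
  by rewrite mulrAC dvd_Xn_unit // eb dvd_Xn_exact // ltnn.
have : 'X^((m * 3).+1) %| b ^+ 2 by rewrite eb exprMn -exprM; apply: dvd_Xn_mul; lia.
move=> db2; have : 'X^((m * 3).+1) %| a ^+ 3.
  rewrite -[a ^+ 3](addrK (b ^+ 2)) dvdp_sub //; apply: dvd_Xn d18; lia.
by rewrite ea exprMn -exprM dvd_Xn_exact ?ltnn // horner_exp expf_neq0.
Qed.

End Inner.

Ltac horner0 := rewrite ?(hornerE, hornerD, hornerM, hornerC, hornerX, horner_exp, expr0n) /=
  ?(mul0r, mulr0, addr0, add0r, expr0n) /= ?(mul0r, mulr0, addr0, add0r).

Section InnerCase.
Variable K : numClosedFieldType.
Implicit Types (p q : {mpoly K[3]}) (w y : {poly K}).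

Lemma low_coef_of n (u v : {poly K}) (c : K) r : u.[0] != 0 ->
  v = 'X^n * (c%:P * u + 'X * r) -> 'X^(n.+1) %| v -> c = 0.
Proof. by move=> nz ->; apply: low_coef. Qed.

(** The arc leaves (1 : 0 : 0) tangentially to the line where the third coordinate vanishes. Once
    the cubic is known to be smooth there, [inner_orders] applies, and orders above 1 remove the
    terms linear in the second coordinate. *)
Lemma torus_inner_start (p0 p1 p2 p3 p4 p5 q0 q1 q2 q3 q4 q5 q6 q7 q8 q9 : K) w y :
  w.[0] != 0 ->
  let p := pol2 p0 p1 p2 p3 p4 p5 in
  let q := pol3 q0 q1 q2 q3 q4 q5 q6 q7 q8 q9 in
  let W := vec3 w 'X ('X^2 * y) in
  arc17 (p ^+ 3 + q ^+ 2) W -> (evp p W).[0] = 0 ->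
  [/\ p0 = 0, p1 = 0, q0 = 0, q1 = 0 & q2 != 0]
  /\ [/\ 'X^6 %| evp p W, ~~ ('X^7 %| evp p W) & 'X^10 %| evp q W].
Proof.
move=> nzw p q W arc pP.
have ep : evp p W = cf2 p0%:P p1%:P p2%:P p3%:P p4%:P p5%:P w 'X ('X^2 * y).
  exact: mmap_pol2.
have eq : evp q W = cf3 q0%:P q1%:P q2%:P q3%:P q4%:P q5%:P q6%:P q7%:P q8%:P q9%:P w 'X ('X^2 * y).
  exact: mmap_pol3.
have p00 : p0 = 0.
  move: pP; rewrite ep /cf2; horner0 => /eqP.
  by rewrite !mulf_eq0 (negPf nzw) !orbF => /eqP.
have q00 : q0 = 0.
  have := arc_order arc; rewrite evpD !evpX => /(@dvd_Xn _ 1 18 _ isT).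
  rewrite expr1 X_dvd0 hornerD !horner_exp pP expr0n /= add0r expf_eq0 /= eq /cf3.
  horner0.
  by rewrite !mulf_eq0 (negPf nzw) !orbF => /eqP.
have q12 : (q1 != 0) || (q2 != 0).
  rewrite -negb_and; apply/negP => /andP[/eqP q10 /eqP q20].
  (* If the cubic were singular at the point, p^3 and q^2 would have multiplicity at least 3 and 4
     there, whereas [arc_double] bounds the multiplicity of the sextic by 2. *)
  have [v /negP[]] := arc_double arc.
  set V := fun i => _.
  have evV : evp p V = cf2 p0%:P p1%:P p2%:P p3%:P p4%:P p5%:P (V i0) (V i1) (V i2).
    exact: mmap_pol2.
  have eqV : evp q V = cf3 q0%:P q1%:P q2%:P q3%:P q4%:P q5%:P q6%:P q7%:P q8%:P q9%:P (V i0) (V i1) (V i2).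
    exact: mmap_pol3.
  have V1 : V i1 = 'X * (v i1)%:P by rewrite /V /= hornerX polyC0 add0r.
  have V2 : V i2 = 'X * (v i2)%:P.
    by rewrite /V /= hornerM horner_exp hornerX expr0n /= mul0r polyC0 add0r.
  rewrite evpD !evpX evV eqV V1 V2 p00 q00 q10 q20 polyC0 /cf2 /cf3.
  set v0 := V i0; set v1 := (v i1)%:P; set v2 := (v i2)%:P; clearbody v0 v1 v2.
  apply/Xn_dvdP; eexists.
  transitivity ('X^3 * ((p1%:P * v0 * v1 + p2%:P * v0 * v2 + 'X * (p3%:P * v1 ^+ 2 + p4%:P * v1 * v2 + p5%:P * v2 ^+ 2)) ^+ 3
    + 'X * (q3%:P * v0 * v1 ^+ 2 + q4%:P * v0 * v1 * v2 + q5%:P * v0 * v2 ^+ 2 + 'X * (q6%:P * v1 ^+ 3 + q7%:P * v1 ^+ 2 * v2 + q8%:P * v1 * v2 ^+ 2 + q9%:P * v2 ^+ 3)) ^+ 2)); last by [].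
  by ring.
have [i nzi] : exists i, (evp q^`M(i) W).[0] != 0.
  have nzw2 : w.[0] ^+ 2 != 0 by rewrite expf_neq0.
  by case/orP: q12 => nz; [exists i1 | exists i2];
    rewrite mderiv_pol3 /evp mmap_pol2 /cf2 /=; horner0; rewrite !mulf_neq0.
have Xp : 'X %| evp p W by rewrite X_dvd0 pP.
have [d6 n7 d10] := inner_orders arc Xp nzi.
have p10 : p1 = 0.
  apply: (low_coef_of (n := 1) (u := w) (v := evp p W) nzw _ (@dvd_Xn _ 2 6 _ isT d6)).
  rewrite ep p00 polyC0 /cf2.
  transitivity ('X^1 * (p1%:P * w + 'X * (p2%:P * w * y + p3%:P + p4%:P * 'X * y + p5%:P * 'X^2 * y ^+ 2))); last by [].
  by ring.
have q10 : q1 = 0.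
  apply: (low_coef_of (n := 1) (u := w ^+ 2) (v := evp q W) _ _ (@dvd_Xn _ 2 10 _ isT d10)).
    by rewrite horner_exp expf_neq0.
  rewrite eq q00 polyC0 /cf3.
  transitivity ('X^1 * (q1%:P * w ^+ 2 + 'X * (q2%:P * w ^+ 2 * y + q3%:P * w + q4%:P * w * 'X * y + q5%:P * w * 'X^2 * y ^+ 2
    + q6%:P * 'X + q7%:P * 'X^2 * y + q8%:P * 'X^3 * y ^+ 2 + q9%:P * 'X^4 * y ^+ 3))); last by [].
  by ring.
by split=> //; split=> //; rewrite q10 eqxx in q12.
Qed.


(** If p3 is nonzero, its contribution of order 2 must be cancelled by that of p2. Otherwise p is
    the third coordinate times a linear form, and the order m of [y] decides: m = 0 would kill p2,
    p4 and p5 in turn, m >= 2 would kill q3 and q6, and m = 1 leaves in p only the term p5, of order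
    6. *)
Lemma torus_inner_flag (p0 p1 p2 p3 p4 p5 q0 q1 q2 q3 q4 q5 q6 q7 q8 q9 : K) w y :
  w.[0] != 0 ->
  let p := pol2 p0 p1 p2 p3 p4 p5 in
  let q := pol3 q0 q1 q2 q3 q4 q5 q6 q7 q8 q9 in
  let W := vec3 w 'X ('X^2 * y) in
  arc17 (p ^+ 3 + q ^+ 2) W -> (evp p W).[0] = 0 ->
  [/\ p0 = 0, p1 = 0, q0 = 0, q1 = 0 & q2 != 0] /\
  ((p2 != 0 /\ p3 != 0) \/
   [/\ [/\ p2 = 0, p3 = 0 & p4 = 0], p5 != 0, q3 = 0 & q6 != 0]).
Proof.
move=> nzw p q W arc pP.
have [[p00 p10 q00 q10 nzq2] [d6 n7 d10]] := torus_inner_start nzw arc pP.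
split=> //.
have ep : evp p W = 'X^2 * (p2%:P * w * y + p3%:P + p4%:P * 'X * y + p5%:P * 'X^2 * y ^+ 2).
  rewrite /evp mmap_pol2 /W /vec3 /= p00 p10 polyC0 /cf2; ring.
have eq : evp q W = 'X^2 * (q2%:P * w ^+ 2 * y + q3%:P * w + q4%:P * w * 'X * y + q5%:P * w * 'X^2 * y ^+ 2
    + q6%:P * 'X + q7%:P * 'X^2 * y + q8%:P * 'X^3 * y ^+ 2 + q9%:P * 'X^4 * y ^+ 3).
  rewrite /evp mmap_pol3 /W /vec3 /= q00 q10 polyC0 /cf3; ring.
have [p30|nzp3] := eqVneq p3 0; last first.
  left; split=> //; apply: contra_neq nzp3 => p20.
  apply: (low_coef_of (n := 2) (u := 1) (v := evp p W) _ _ (@dvd_Xn _ 3 6 _ isT d6)); first by rewrite hornerC oner_neq0.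
  rewrite ep p20 polyC0.
  transitivity ('X^2 * (p3%:P * 1 + 'X * (p4%:P * y + p5%:P * 'X * y ^+ 2))); last by [].
  by ring.
right.
have nzy : y != 0.
  by apply: contraNneq n7 => y0; rewrite ep y0 p30 polyC0 expr0n /= !(mulr0, addr0) dvdp0.
have [y' nzy' [m ey]] := Xn_factor nzy.
(* In this case q is the third coordinate times a unit, so that coordinate has order at least 10 on
   the arc; as it divides p, this contradicts the order 6 of p. *)
have exclude : q3 = 0 -> q6 = 0 -> False.
  move=> q30 q60; have : 'X^10 %| 'X^(2 + m) * (y' * (q2%:P * w ^+ 2 + 'X * (q4%:P * w + q5%:P * w * 'X * y
    + q7%:P * 'X + q8%:P * 'X^2 * y + q9%:P * 'X^3 * y ^+ 2))).
    suff -> : 'X^(2 + m) * (y' * (q2%:P * w ^+ 2 + 'X * (q4%:P * w + q5%:P * w * 'X * y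
    + q7%:P * 'X + q8%:P * 'X^2 * y + q9%:P * 'X^3 * y ^+ 2))) = evp q W by [].
    by rewrite eq q30 q60 polyC0 exprD ey; move: ('X^m) => Xm; ring.
  rewrite dvd_Xn_exact; last by horner0; rewrite !mulf_neq0.
  move=> m8; case/negP: n7; rewrite ep p30 polyC0.
  apply/Xn_dvdP; exists ('X^(m - 5) * y' * (p2%:P * w + p4%:P * 'X + p5%:P * 'X^2 * y)).
  rewrite ey (_ : m = 5 + (m - 5))%N; last by lia.
  by rewrite addnC addnK addnC exprD; move: ('X^(m - 5)) => Xm; ring.
have m1 : (0 < m)%N.
  rewrite lt0n; apply/negP => /eqP m0; move: nzy'; rewrite -(mul1r y') -(expr0 'X) -m0 -ey => nzy0.
  have eq20 : p2 = 0.
    apply: (low_coef_of (n := 2) (u := w * y) (v := evp p W) _ _ (@dvd_Xn _ 3 6 _ isT d6)); first by rewrite hornerM mulf_neq0.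
    rewrite ep p30 polyC0.
    transitivity ('X^2 * (p2%:P * (w * y) + 'X * (p4%:P * y + p5%:P * 'X * y ^+ 2))); last by [].
    by ring.
  have eq40 : p4 = 0.
    apply: (low_coef_of (n := 3) (u := y) (v := evp p W) _ _ (@dvd_Xn _ 4 6 _ isT d6)) => //.
    rewrite ep p30 eq20 polyC0.
    transitivity ('X^3 * (p4%:P * y + 'X * (p5%:P * y ^+ 2))); last by [].
    by ring.
  have eq50 : p5 = 0.
    apply: (low_coef_of (n := 4) (u := y ^+ 2) (v := evp p W) _ _ (@dvd_Xn _ 5 6 _ isT d6)).
      by rewrite horner_exp expf_neq0.
    rewrite ep p30 eq20 eq40 polyC0.
    transitivity ('X^4 * (p5%:P * y ^+ 2 + 'X * 0)); last by [].
    by ring.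
  by case/negP: n7; rewrite ep p30 eq20 eq40 eq50 polyC0 !(mul0r, addr0, mulr0) dvdp0.
have ey1 : y = 'X * ('X^(m.-1) * y') by rewrite mulrA -exprS prednK.
move: ('X^(m.-1) * y') ey1 => y1 ey1.
have q30 : q3 = 0.
  apply: (low_coef_of (n := 2) (u := w) (v := evp q W) _ _ (@dvd_Xn _ 3 10 _ isT d10)) => //.
  rewrite eq ey1.
  transitivity ('X^2 * (q3%:P * w + 'X * (q2%:P * w ^+ 2 * y1 + q4%:P * w * 'X * y1 + q5%:P * w * 'X^3 * y1 ^+ 2
    + q6%:P + q7%:P * 'X^2 * y1 + q8%:P * 'X^4 * y1 ^+ 2 + q9%:P * 'X^6 * y1 ^+ 3))); last by [].
  by ring.
have m2 : (1 < m)%N -> q6 = 0.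
  move=> m2.
  have ey2 : y = 'X^2 * ('X^(m - 2) * y') by rewrite mulrA -exprD subnKC.
  move: ('X^(m - 2) * y') ey2 => y2 ey2.
  apply: (low_coef_of (n := 3) (u := 1) (v := evp q W) _ _ (@dvd_Xn _ 4 10 _ isT d10)); first by rewrite hornerC oner_neq0.
  rewrite eq ey2 q30 polyC0.
  transitivity ('X^3 * (q6%:P * 1 + 'X * (q2%:P * w ^+ 2 * y2 + q4%:P * w * 'X * y2 + q5%:P * w * 'X^4 * y2 ^+ 2
    + q7%:P * 'X^2 * y2 + q8%:P * 'X^5 * y2 ^+ 2 + q9%:P * 'X^8 * y2 ^+ 3))); last by [].
  by ring.
have nzq6 : q6 != 0 by apply/eqP => /(exclude q30).
have m1' : m = 1%N.
  by case: (ltnP 1 m) => [/m2 e|]; [rewrite e eqxx in nzq6 | lia].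
have nzy1 : y1.[0] != 0.
  suff -> : y1 = y' by [].
  by apply: (@mulfI _ 'X); rewrite ?polyX_eq0 // -ey1 ey m1'.
have p20 : p2 = 0.
  apply: (low_coef_of (n := 3) (u := w * y1) (v := evp p W) _ _ (@dvd_Xn _ 4 6 _ isT d6)); first by rewrite hornerM mulf_neq0.
  rewrite ep p30 polyC0 ey1.
  transitivity ('X^3 * (p2%:P * (w * y1) + 'X * (p4%:P * y1 + p5%:P * 'X^2 * y1 ^+ 2))); last by [].
  by ring.
have p40 : p4 = 0.
  apply: (low_coef_of (n := 4) (u := y1) (v := evp p W) _ _ (@dvd_Xn _ 5 6 _ isT d6)) => //.
  rewrite ep p30 p20 polyC0 ey1.
  transitivity ('X^4 * (p4%:P * y1 + 'X * (p5%:P * 'X * y1 ^+ 2))); last by [].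
  by ring.
split=> //; apply: contraNneq n7 => p50.
by rewrite ep p30 p20 p40 p50 polyC0 !(mul0r, addr0, mulr0) dvdp0.
Qed.

(** The arc has contact exactly 6 with the conic, so the restriction of q to the conic can be read
    from the arc up to order 5. As q has order at least 10, that restriction reduces to its last
    term, given by q9. *)
Lemma torus_inner_conic (k q0 q1 q2 q3 q4 q5 q6 q7 q8 q9 : K) w y :
  w.[0] != 0 -> k != 0 ->
  let p := pol2 0 0 k (- k) 0 0 in
  let q := pol3 q0 q1 q2 q3 q4 q5 q6 q7 q8 q9 in
  let W := vec3 w 'X ('X^2 * y) in
  arc17 (p ^+ 3 + q ^+ 2) W ->
  [/\ q3 != 0, q9 != 0 &
      q = q9%:MP * 'X_i2 ^+ 3 - (pol2 0 0 1 (-1) 0 0) * pol1 q3 q6 q7].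
Proof.
move=> nzw nzk p q W arc.
have pP : (evp p W).[0] = 0.
  by rewrite /evp mmap_pol2 /W /vec3 /cf2 /=; horner0.
have [[_ _ q00 q10 nzq2] [d6 n7 d10]] := torus_inner_start nzw arc pP.
have ep : evp p W = k%:P * 'X^2 * (w * y - 1).
  by rewrite /evp mmap_pol2 /W /vec3 /= polyC0 polyCN /cf2; ring.
(* The deviation of the arc from the conic; it enters the expansion of q from order 6 on. *)
have [a ea] : exists a, w * y = 1 + 'X^4 * a.
  have : 'X^6 %| 'X^2 * (w * y - 1).
    by move: d6; rewrite ep -mulrA dvd_Xn_unit // hornerC.
  rewrite dvd_Xn_shift // => /Xn_dvdP[a ea]; exists a.
  by rewrite -ea; ring.
have wy1 : w.[0] * y.[0] = 1.
  by move/(congr1 (horner^~ 0)): ea; horner0.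
have nzy : y.[0] != 0.
  by apply: contra_eq_neq wy1 => ->; rewrite mulr0 eq_sym oner_neq0.
have eq : evp q W = 'X^2 * (w * (q2 + q3)%:P + 'X * (q4 + q6)%:P
    + 'X^2 * y * (q5 + q7)%:P + 'X^3 * y ^+ 2 * q8%:P + 'X^4 * y ^+ 3 * q9%:P
    + 'X^4 * a * (q2%:P * w + q4%:P * 'X + q5%:P * 'X^2 * y)).
  rewrite /evp mmap_pol3 /W /vec3 /= q00 q10 polyC0 /cf3 !polyCD.
  transitivity ('X^2 * (q2%:P * w * (w * y) + q3%:P * w + q4%:P * 'X * (w * y) + q5%:P * 'X^2 * y * (w * y)
    + q6%:P * 'X + q7%:P * 'X^2 * y + q8%:P * 'X^3 * y ^+ 2 + q9%:P * 'X^4 * y ^+ 3)); first by ring.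
  by rewrite ea; ring.
have q23 : q2 + q3 = 0.
  apply: (low_coef_of (n := 2) (u := w) (v := evp q W) _ _ (@dvd_Xn _ 3 10 _ isT d10)) => //.
  rewrite eq.
  transitivity ('X^2 * ((q2 + q3)%:P * w + 'X * ((q4 + q6)%:P + 'X * y * (q5 + q7)%:P + 'X^2 * y ^+ 2 * q8%:P + 'X^3 * y ^+ 3 * q9%:P
    + 'X^3 * a * (q2%:P * w + q4%:P * 'X + q5%:P * 'X^2 * y)))); last by [].
  by ring.
have q46 : q4 + q6 = 0.
  apply: (low_coef_of (n := 3) (u := 1) (v := evp q W) _ _ (@dvd_Xn _ 4 10 _ isT d10)); first by rewrite hornerC oner_neq0.
  rewrite eq q23 polyC0.
  transitivity ('X^3 * ((q4 + q6)%:P * 1 + 'X * (y * (q5 + q7)%:P + 'X * y ^+ 2 * q8%:P + 'X^2 * y ^+ 3 * q9%:P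
    + 'X^2 * a * (q2%:P * w + q4%:P * 'X + q5%:P * 'X^2 * y)))); last by [].
  by ring.
have q57 : q5 + q7 = 0.
  apply: (low_coef_of (n := 4) (u := y) (v := evp q W) _ _ (@dvd_Xn _ 5 10 _ isT d10)) => //.
  rewrite eq q23 q46 polyC0.
  transitivity ('X^4 * ((q5 + q7)%:P * y + 'X * (y ^+ 2 * q8%:P + 'X * y ^+ 3 * q9%:P
    + 'X * a * (q2%:P * w + q4%:P * 'X + q5%:P * 'X^2 * y)))); last by [].
  by ring.
have q80 : q8 = 0.
  apply: (low_coef_of (n := 5) (u := y ^+ 2) (v := evp q W) _ _ (@dvd_Xn _ 6 10 _ isT d10)).
    by rewrite horner_exp expf_neq0.
  rewrite eq q23 q46 q57 polyC0.
  transitivity ('X^5 * (q8%:P * y ^+ 2 + 'X * (y ^+ 3 * q9%:P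
    + a * (q2%:P * w + q4%:P * 'X + q5%:P * 'X^2 * y)))); last by [].
  by ring.
have q2E : q2 = - q3 by apply/eqP; rewrite -addr_eq0 q23.
have q4E : q4 = - q6 by apply/eqP; rewrite -addr_eq0 q46.
have q5E : q5 = - q7 by apply/eqP; rewrite -addr_eq0 q57.
have nzq3 : q3 != 0 by rewrite -oppr_eq0 -q2E.
split=> //; last first.
  rewrite /q q00 q10 q80 q2E q4E q5E /pol3 /pol2 /pol1 /cf3 /cf2 /cf1 !mpolyCN !mpolyC0 mpolyC1.
  by move: 'X_i0 'X_i1 'X_i2 => X Y Z; ring.
apply/eqP => q90; case/negP: n7.
(* With q9 = 0 the cubic is the conic times a linear form that does not vanish at the point, so the
   order of q on the arc would be that of p. *)
have : 'X^10 %| 'X^6 * (a * (- q3%:P * w + 'X * (- q6%:P - q7%:P * 'X * y))).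
  suff -> : 'X^6 * (a * (- q3%:P * w + 'X * (- q6%:P - q7%:P * 'X * y))) = evp q W by [].
  by rewrite eq q23 q46 q57 q80 q90 polyC0 q2E q4E q5E !polyCN; ring.
rewrite dvd_Xn_shift // mulrC dvd_Xn_unit; last first.
  by horner0; rewrite mulf_neq0 // oppr_eq0.
case/Xn_dvdP=> a' ea'; rewrite ep ea ea'.
by apply/Xn_dvdP; exists (k%:P * 'X^3 * a'); ring.
Qed.

End InnerCase.

(** * A sextic built on a smooth conic is irreducible *)

Section Conic.
Variable K : numClosedFieldType.

Lemma evpB (F G : {mpoly K[3]}) W : evp (F - G) W = evp F W - evp G W.
Proof. exact: mmapB. Qed.

Lemma size_conic_form d (g : {mpoly K[3]}) : g \is d.-homog ->
  (size (evp g (vec3 1 'X 'X^2)%R) <= (2 * d).+1)%N.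
Proof.
case/form_coef=> cf ->; rewrite /evp rmorph_sum.
have sum_le (I : finType) (F : I -> {poly K}) n :
    (forall i, (size (F i) <= n)%N) -> (size (\sum_i F i)%R <= n)%N.
  move=> le; apply: (big_ind (fun p : {poly K} => (size p <= n)%N)) => [|p q sp sq|i _].
  - by rewrite size_poly0.
  - by apply: leq_trans (size_polyD _ _) _; rewrite geq_max sp.
  - exact: le.
apply: (sum_le) => i; rewrite rmorph_sum; apply: (sum_le) => j.
rewrite !rmorphM !rmorphXn /= mmapC !mmapXU /vec3 /= expr1n mulr1 -mulrA -exprM -exprD.
rewrite mul_polyC; apply: leq_trans (size_scale_leq _ _) _; rewrite size_polyXn ltnS.
by have := ltn_ord i; have := ltn_ord j; lia.
Qed.

Lemma Xn_factors (a b : {poly K}) (c : K) n : c != 0 -> a * b = c%:P * 'X^n ->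
  exists a0 i b0 j, [/\ a0 != 0 /\ b0 != 0, a = a0%:P * 'X^i, b = b0%:P * 'X^j & (i + j = n)%N].
Proof.
move=> nzc eab.
have nzab : a * b != 0 by rewrite eab mulf_neq0 ?polyC_eq0 // expf_neq0 // polyX_eq0.
move: (nzab); rewrite mulf_eq0 negb_or => /andP[nza nzb].
have factor (u v : {poly K}) : u * v = c%:P * 'X^n -> u != 0 -> exists2 u0, u0 != 0 & exists i, u = u0%:P * 'X^i.
  move=> euv nzu; have : u %| ('X - 0%:P) ^+ n.
    by rewrite subr0 -(dvdpZr _ _ nzc) -mul_polyC -euv dvdp_mulr.
  case/dvdp_exp_XsubCP=> i _; rewrite subr0 => /eqpP[[x y] /= /andP[nzx nzy] exy].
  exists (x^-1 * y); first by rewrite mulf_neq0 // invr_eq0.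
  by exists i; rewrite mul_polyC -scalerA -exy scalerA mulVf // scale1r.
have [a0 nza0 [i ea]] := factor a b eab nza.
have [b0 nzb0 [j eb]] := factor b a (etrans (mulrC b a) eab) nzb.
exists a0, i, b0, j; split=> //.
move/(congr1 (fun p : {poly K} => size p)): eab; rewrite ea eb.
rewrite (_ : _ * _ = (a0 * b0) *: 'X^(i + j)); last by rewrite exprD -mul_polyC polyCM; ring.
by rewrite mul_polyC !size_scale ?mulf_neq0 // !size_polyXn => -[].
Qed.

(** Coordinates [(s, z)] on the affine chart [w = 1] in which the conic
    [w y - x^2] is the axis [z = 0]. *)
Definition conic_chart (F : {mpoly K[3]}) : {poly {poly K}} :=
  mmap (@polyC {poly K} \o @polyC K) (vec3 1 ('X)%:P (('X^2)%:P + 'X)) F.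

HB.instance Definition _ := GRing.RMorphism.copy conic_chart
  (mmap (@polyC {poly K} \o @polyC K) (vec3 1 ('X)%:P (('X^2)%:P + 'X))).

Lemma conic_chart0 F : (conic_chart F)`_0 = evp F (vec3 1 'X 'X^2).
Proof.
rewrite /conic_chart /evp; elim/mpoly_ring_ind: F => [c|i|F G eF eG|F G eF eG].
- by rewrite !mmapC /= coefC.
- rewrite !mmapXU; move: i; apply: ord3P; rewrite /vec3 /= ?coefC //.
  by rewrite coefD coefC coefX addr0.
- by rewrite !rmorphD /= coefD eF eG.
- by rewrite (rmorphM (mmap (_ \o _) _)) (rmorphM (mmap _ _)) /= coef0M eF eG.
Qed.

Lemma cubic_through_conic (q3 q6 q7 q9 : K) :
  pol3 0 0 (- q3) q3 (- q6) (- q7) q6 q7 0 q9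
  = q9%:MP * 'X_i2 ^+ 3 - pol2 0 0 1 (-1) 0 0 * pol1 q3 q6 q7.
Proof.
rewrite /pol3 /pol2 /pol1 /cf3 /cf2 /cf1 !mpolyCN !mpolyC0 mpolyC1.
by move: 'X_i0 'X_i1 'X_i2 => X Y Z; ring.
Qed.

Lemma chart_conic : conic_chart (pol2 0 0 1 (-1) 0 0) = 'X.
Proof.
rewrite /conic_chart mmap_pol2 /vec3 /cf2 /= !(polyCN, polyC0, polyC1) polyC_exp.
by move: ('X)%:P ('X : {poly {poly K}}) => S z; ring.
Qed.

Lemma chart_linear l0 l1 l2 : conic_chart (pol1 l0 l1 l2) =
  (l0%:P + l1%:P * 'X + l2%:P * 'X^2)%:P + l2%:P%:P * 'X.
Proof.
rewrite /conic_chart mmap_pol1 /vec3 /cf1 /= !(polyC_exp, polyCD, polyCM) mulr1.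
by move: ('X)%:P ('X : {poly {poly K}}) => S z; ring.
Qed.

Lemma chart_y3 (c : K) : exists r, conic_chart (c%:MP * 'X_i2 ^+ 3) =
  (c%:P * 'X^6)%:P + (3%:R * c%:P * 'X^4)%:P * 'X + (3%:R * c%:P * 'X^2)%:P * 'X^2 + 'X^3 * r.
Proof.
exists c%:P%:P; rewrite (rmorphM conic_chart) (rmorphXn conic_chart) /= /conic_chart mmapC mmapXU /vec3 /=.
rewrite !(polyC_exp, polyCM, polyC_natr).
move: ('X)%:P ('X : {poly {poly K}}) (c%:P%:P) => S z c'.
by ring.
Qed.

Lemma coef2_expansion (A : comNzRingType) (a0 a1 a2 : A) (r : {poly A}) :
  let p := a0%:P + a1%:P * 'X + a2%:P * 'X^2 + 'X^3 * r in
  [/\ p`_0 = a0, p`_1 = a1 & p`_2 = a2].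
Proof. by split; rewrite !coefE /= ?(mulr0, mulr1, addr0, add0r). Qed.

(** Modulo z^3 the sextic is c^2 s^12 + 2 c s^6 q1 z + (q1^2 + 2 c s^6 q2) z^2 in the chart, and q1
    takes the value - l0 at s = 0. The degree bounds leave only a0 s^(2d) and b0 s^(12 - 2d) for the
    restrictions of the factors to the conic. For d < 3 the coefficient of z then contains a single
    term of order 2d, namely G0 H1, while it should be divisible by s^6. *)
Lemma conic_factor_degree (k c l0 l1 l2 : K) d e (g h : {mpoly K[3]}) :
  l0 != 0 -> c != 0 -> g \is d.-homog -> h \is e.-homog -> (d + e = 6)%N -> (d < 3)%N ->
  (0 < d)%N ->
  g * h != (k%:MP * pol2 0 0 1 (-1) 0 0) ^+ 3
           + (c%:MP * 'X_i2 ^+ 3 - pol2 0 0 1 (-1) 0 0 * pol1 l0 l1 l2) ^+ 2.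
Proof.
move=> nzl0 nzc hg hh de d3 d0; apply/eqP => E.
have := chart_conic; have := chart_linear l0 l1 l2; have [r3] := chart_y3 c.
set L := l0%:P + l1%:P * 'X + l2%:P * 'X^2.
move: (pol2 _ _ _ _ _ _) (pol1 _ _ _) (_ * _ ^+ 3) E => pi l cy3 E ecy3 el epi.
set q1 : {poly K} := 3%:R * c%:P * 'X^4 - L.
set q2 : {poly K} := 3%:R * c%:P * 'X^2 - l2%:P.
have [r er] : exists r : {poly {poly K}}, conic_chart g * conic_chart h =
    (c%:P ^+ 2 * 'X^12)%:P + (2%:R * c%:P * 'X^6 * q1)%:P * 'X
    + (q1 ^+ 2 + 2%:R * c%:P * 'X^6 * q2)%:P * 'X^2 + 'X^3 * r.
  pose S : {poly {poly K}} := ('X)%:P; pose c' := c%:P%:P : {poly {poly K}}.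
  exists (k%:P%:P ^+ 3 + 2%:R * (c' * S ^+ 6) * r3
     + 2%:R * (3%:R * c' * S ^+ 4 - L%:P) * (3%:R * c' * S ^+ 2 - l2%:P%:P)
     + 'X * (3%:R * c' * S ^+ 2 - l2%:P%:P) ^+ 2 + 2%:R * (3%:R * c' * S ^+ 4 - L%:P) * 'X * r3
     + 2%:R * (3%:R * c' * S ^+ 2 - l2%:P%:P) * 'X ^+ 2 * r3 + 'X ^+ 3 * r3 ^+ 2).
  rewrite -(rmorphM conic_chart) E (rmorphD conic_chart) !(rmorphXn conic_chart).
  rewrite (rmorphB conic_chart) !(rmorphM conic_chart) /= epi ecy3 el.
  have -> : conic_chart k%:MP = k%:P%:P by rewrite /conic_chart mmapC.
  rewrite /q1 /q2 !(polyC_exp, polyCM, polyCD, polyCN, polyC_natr) -/c' -/S.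
  move: S ('X : {poly {poly K}}) (k%:P%:P) c' (L%:P) (l2%:P%:P) => S z k' c'' L' l2'.
  by ring.
have [] := coef2_expansion (c%:P ^+ 2 * 'X^12) (2%:R * c%:P * 'X^6 * q1) (q1 ^+ 2 + 2%:R * c%:P * 'X^6 * q2) r.
rewrite -er !coefM !big_ord_recl !big_ord0 /= !addr0 /bump /= => E0 E1 E2.
have sg := size_conic_form hg; have sh := size_conic_form hh.
rewrite -!conic_chart0 in sg sh.
move: (conic_chart g)`_0 (conic_chart g)`_1 (conic_chart g)`_2 sg E0 E1 E2 => G0 G1 G2 sg.
move: (conic_chart h)`_0 (conic_chart h)`_1 (conic_chart h)`_2 sh => H0 H1 H2 sh E0 E1 E2.
have nzc2 : c ^+ 2 != 0 by rewrite expf_neq0.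
have e0 : G0 * H0 = (c ^+ 2)%:P * 'X^12 by rewrite E0 polyC_exp.
have [a0 [i [b0 [j [[nza nzb] eG eH ij]]]]] := Xn_factors nzc2 e0.
have szm (x : K) n : x != 0 -> size (x%:P * 'X^n) = n.+1.
  by move=> nz; rewrite mul_polyC size_scale // size_polyXn.
rewrite eG szm // in sg; rewrite eH szm // in sh.
have ei : i = (2 * d)%N by lia.
have ej : j = (2 * d + (12 - 4 * d))%N by lia.
have nzq1 : q1.[0] != 0.
  by rewrite /q1 /L; horner0; rewrite ?(sub0r, add0r, oppr_eq0).
move: q1 q2 nzq1 E1 E2 {er} => q1 q2 nzq1 E1 E2.
have X0 n : (0 < n)%N -> ('X^n : {poly K}).[0] = 0.
  by move=> n0; rewrite hornerXn expr0n (gtn_eqF n0).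
(* At s = 0 both G0 and H0 vanish, so the coefficient of z^2 gives G1 H1 = q1^2 there. *)
have nzH1 : H1.[0] != 0.
  apply: contra_neq (mulf_neq0 nzq1 nzq1) => H10; rewrite expr2 in E2; move/(congr1 (horner^~ 0)): E2.
  rewrite eG eH ei ej !(hornerD, hornerM) H10 !X0 ?addn_gt0 ?muln_gt0 ?d0 //= ?hornerX.
  by rewrite !(mulr0, mul0r, addr0) => <-.
have : a0 = 0; last by move/eqP; rewrite (negPf nza).
apply: (low_coef_of (n := 2 * d) (v := G0 * H1 + G1 * H0) (r := 'X^(11 - 4 * d) * (b0%:P * G1)) nzH1).
  rewrite eG eH ei ej (_ : 12 - 4 * d = (11 - 4 * d).+1)%N; last by lia.
  by rewrite exprD exprS; move: ('X^(2 * d)) ('X^(11 - _)) => U V; ring.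
rewrite E1; apply/Xn_dvdP; exists ('X^(5 - 2 * d) * (2%:R * c%:P * q1)).
have -> : 'X^6 = 'X^((2 * d).+1) * 'X^(5 - 2 * d) :> {poly K}.
  by rewrite -exprD; congr (_ ^+ _); lia.
by move: ('X^((2 * d).+1)) ('X^(5 - _)) => U V; ring.
Qed.

(** The factors [g] and [h] are compared modulo the cube of the equation of
    the conic. *)
Lemma conic_reducible (k c l0 l1 l2 : K) d e (g h : {mpoly K[3]}) :
  k != 0 -> l0 != 0 -> c != 0 -> g \is d.-homog -> h \is e.-homog -> (d + e = 6)%N ->
  (0 < d)%N -> (0 < e)%N ->
  g * h != (k%:MP * pol2 0 0 1 (-1) 0 0) ^+ 3
           + (c%:MP * 'X_i2 ^+ 3 - pol2 0 0 1 (-1) 0 0 * pol1 l0 l1 l2) ^+ 2.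
Proof.
move=> nzk nzl0 nzc hg hh de d0 e0.
have [lt|le] := ltnP d 3; first exact: (conic_factor_degree _ _ _ nzl0 nzc hg hh).
have [lt|le'] := ltnP e 3.
  by rewrite mulrC; apply: (conic_factor_degree _ _ _ nzl0 nzc hh hg); lia.
have d3 : d = 3%N by lia.
have e3 : e = 3%N by lia.
rewrite {}d3 in hg; rewrite {}e3 in hh; apply/eqP => E.
(* Forms of degree 3 with the same restriction to the conic differ by the conic times a linear form;
   the seven entries are the coefficients of s^0 to s^6. *)
have cubic (f : {mpoly K[3]}) (a : K) : f \is 3.-homog -> a != 0 -> evp f (vec3 1 'X 'X^2) = a%:P * 'X^6 ->
    exists b0 b1 b2, f = a%:MP * 'X_i2 ^+ 3 - pol2 0 0 1 (-1) 0 0 * pol1 b0 b1 b2.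
  move/homog3P=> [q0 [q1 [q2 [q3 [q4 [q5 [q6 [q7 [q8 [q9 ->]]]]]]]]]] nza.
  rewrite /evp mmap_pol3 /vec3 /cf3 /= => ef.
  have {}ef : Poly [:: q0; q1; q2 + q3; q4 + q6; q5 + q7; q8; q9 - a] = 0.
    move/eqP: ef; rewrite -subr_eq0 => /eqP <-.
    by rewrite /= !cons_poly_def !polyCD !polyCN; move: 'X => X; ring.
  have co i : [:: q0; q1; q2 + q3; q4 + q6; q5 + q7; q8; q9 - a]`_i = 0.
    by rewrite -coef_Poly ef coef0.
  have /= q00 := co 0%N; have /= q10 := co 1%N.
  have /= /eqP := co 2; rewrite addr_eq0 => /eqP q23.
  have /= /eqP := co 3; rewrite addr_eq0 => /eqP q46.
  have /= /eqP := co 4; rewrite addr_eq0 => /eqP q57.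
  have /= q80 := co 5; have /= /eqP := co 6; rewrite subr_eq0 => /eqP q9a.
  exists q3, q6, q7; rewrite -cubic_through_conic.
  by rewrite q00 q10 q23 q46 q57 q80 q9a.
have e0' : evp g (vec3 1 'X 'X^2) * evp h (vec3 1 'X 'X^2) = (c ^+ 2)%:P * 'X^12.
  rewrite -evpM E evpD !evpX evpB (evpM c%:MP) (evpM k%:MP) (evpM (pol2 _ _ _ _ _ _)) evpX.
  rewrite /evp mmapXU mmap_pol2 !mmapC mmap_pol1 /vec3 /cf2 /cf1 /=.
  by rewrite !(polyC0, polyCN, polyC1, polyC_exp); ring.
have nzc2 : c ^+ 2 != 0 by rewrite expf_neq0.
have [a0 [i [b0 [j [[nza nzb] eG eH ij]]]]] := Xn_factors nzc2 e0'.
have sg := size_conic_form hg; have sh := size_conic_form hh.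
have szm (x : K) n : x != 0 -> size (x%:P * 'X^n) = n.+1.
  by move=> nz; rewrite mul_polyC size_scale // size_polyXn.
rewrite eG szm // in sg; rewrite eH szm // in sh.
have ei : i = 6 by lia.
have ej : j = 6 by lia.
have c12 : a0 * b0 = c ^+ 2.
  apply/eqP; rewrite -subr_eq0 -polyC_eq0; apply/eqP.
  apply: (@mulIf _ ('X^12)); first by rewrite expf_neq0 // polyX_eq0.
  by rewrite mul0r polyCB polyCM mulrBl -e0' eG eH ei ej; ring.
rewrite ei in eG; rewrite ej in eH.
have [A0 [A1 [A2 eg]]] := cubic g a0 hg nza eG.
have [B0 [B1 [B2 eh]]] := cubic h b0 hh nzb eH.
have nzpi : pol2 0 0 1 (-1) 0 0 != 0 :> {mpoly K[3]}.
  apply/eqP => /(congr1 (meval (vec3 1 0 1))); rewrite meval0 /meval mmap_pol2 /cf2 /vec3 /=.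
  by move/eqP; rewrite !(mul0r, mulr0, add0r, addr0, expr0n, mulr1, mul1r) /= oner_eq0.
pose m0 := 2%:R * c * l0 - a0 * B0 - b0 * A0.
pose m1 := 2%:R * c * l1 - a0 * B1 - b0 * A1.
pose m2 := 2%:R * c * l2 - a0 * B2 - b0 * A2.
(* The equation of the conic is cancelled once; the terms free of it agree because a0 b0 = c^2. *)
have E1 : 'X_i2 ^+ 3 * pol1 m0 m1 m2 = pol2 0 0 1 (-1) 0 0 *
   (k%:MP ^+ 3 * pol2 0 0 1 (-1) 0 0 + pol1 l0 l1 l2 ^+ 2 - pol1 A0 A1 A2 * pol1 B0 B1 B2).
  apply: (mulfI nzpi); apply/eqP; rewrite -subr_eq0; apply/eqP.
  have -> : pol1 m0 m1 m2 = 2%:R * c%:MP * pol1 l0 l1 l2 - a0%:MP * pol1 B0 B1 B2 - b0%:MP * pol1 A0 A1 A2.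
    rewrite /pol1 /cf1 /m0 /m1 /m2 !(mpolyCB, mpolyCM, mpolyC_nat).
    by move: 'X_i0 'X_i1 'X_i2 => X Y Z; ring.
  have := E; rewrite eg eh.
  have : a0%:MP * b0%:MP = c%:MP ^+ 2 :> {mpoly K[3]} by rewrite -mpolyCM c12 expr2 mpolyCM -expr2.
  move: (pol2 _ _ _ _ _ _) (pol1 A0 _ _) (pol1 B0 _ _) (pol1 l0 _ _) ('X_i2 ^+ 3) => pi A B l Y.
  move: (a0%:MP) (b0%:MP) (c%:MP) (k%:MP) => a b c' k' ab /eqP; rewrite -subr_eq0 => /eqP E3.
  move/eqP: ab; rewrite -subr_eq0 => /eqP ab.
  rewrite -[RHS]subr0 -[X in _ = _ - X](mulr0 (Y ^+ 2)) -[X in _ = _ - _ * X]ab -[X in _ = X - _]E3.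
  by ring.
(* Restricted to the conic, the right-hand side vanishes, so the linear form on the left vanishes on
   the conic and is zero. *)
have [em0 em1 em2] : [/\ m0 = 0, m1 = 0 & m2 = 0].
  have := congr1 (fun F => evp F (vec3 1 'X 'X^2)) E1; rewrite evpM [RHS]evpM evpX.
  rewrite {1 2 3}/evp mmapXU mmap_pol1 mmap_pol2 /cf1 /cf2 /vec3 /= => /eqP.
  rewrite [X in _ == X * _](_ : _ = 0); last by rewrite !(polyC0, polyCN, polyC1); ring.
  rewrite mul0r mulf_eq0 !expf_eq0 polyX_eq0 /= => /eqP em.
  have {}em : Poly [:: m0; m1; m2] = 0.
    by rewrite -em /= !cons_poly_def; move: 'X => X; ring.
  have co n : [:: m0; m1; m2]`_n = 0 by rewrite -coef_Poly em coef0.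
  by split; [exact: (co 0%N) | exact: (co 1%N) | exact: (co 2)].
have E2 : k%:MP ^+ 3 * pol2 0 0 1 (-1) 0 0 + pol1 l0 l1 l2 ^+ 2 = pol1 A0 A1 A2 * pol1 B0 B1 B2.
  apply/eqP; rewrite -subr_eq0; apply/eqP; apply: (mulfI nzpi); rewrite -E1 em0 em1 em2.
  by rewrite /pol1 /cf1 mpolyC0 !(mul0r, addr0, mulr0).
have ev v := congr1 (meval v) E2.
have {}ev w x y : k ^+ 3 * (w * y - x ^+ 2) + cf1 l0 l1 l2 w x y ^+ 2 = cf1 A0 A1 A2 w x y * cf1 B0 B1 B2 w x y.
  have := ev (vec3 w x y); rewrite mevalD (mevalM _ (k%:MP ^+ 3)) [in RHS]mevalM !(rmorphXn (meval _)) /= mevalC /meval mmap_pol2 !mmap_pol1 /vec3 /= => <-.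
  by rewrite /cf2; ring.
(* With 2 c l = a0 B + b0 A and c^2 = a0 b0, the identity (a0 B - b0 A)^2 = (a0 B + b0 A)^2 - 4 a0
   b0 A B exhibits a nonzero multiple of the conic as the square of a linear form. Three points
   suffice to refute this. *)
have sq w x y : cf1 (a0 * B0 - b0 * A0) (a0 * B1 - b0 * A1) (a0 * B2 - b0 * A2) w x y ^+ 2
     = - (4%:R * c ^+ 2 * k ^+ 3 * (w * y - x ^+ 2)).
  transitivity ((2%:R * c * cf1 l0 l1 l2 w x y - cf1 m0 m1 m2 w x y) ^+ 2 - 4%:R * (a0 * b0) * (cf1 A0 A1 A2 w x y * cf1 B0 B1 B2 w x y)).
    by rewrite /m0 /m1 /m2 /cf1; ring.
  by rewrite em0 em1 em2 c12 -ev /cf1; ring.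
have n0 := sq 1 0 0; have n2 := sq 0 0 1; have n02 := sq 1 0 1.
rewrite /cf1 !(mulr0, mulr1, mul0r, addr0, add0r, expr0n, subr0, oppr0) /= in n0 n2 n02.
rewrite ?(mulr0, oppr0) in n0 n2.
move/eqP: n0; rewrite expf_eq0 /= => /eqP n0.
move/eqP: n2; rewrite expf_eq0 /= => /eqP n2.
move/eqP: n02; rewrite n0 n2 addr0 expr0n /= eq_sym oppr_eq0; apply/negP.
by rewrite !mulf_neq0 ?expf_neq0 ?pnatr_eq0.
Qed.

End Conic.

(** * Exclusion of an outer point *)

Section Outer.
Variable K : numClosedFieldType.
Implicit Types (p q f s : {mpoly K[3]}) (W : 'I_3 -> {poly K}) (w y : {poly K}).

Lemma evp_at0 f W : (evp f W).[0] = f.@[fun i => (W i).[0]].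
Proof.
rewrite /evp /meval; elim/mpoly_ring_ind: f => [c|i|F G eF eG|F G eF eG].
- by rewrite !mmapC hornerC.
- by rewrite !mmapXU.
- by rewrite !mmapD hornerD eF eG.
- by rewrite (rmorphM (mmap _ _)) [in RHS](rmorphM (mmap _ _)) /= hornerM eF eG.
Qed.

Lemma arc17_subst f W W' (N : 'M[K]_3) : N \in unitmx ->
  (forall j, W j = \sum_(k < 3) (N k j)%:P * W' k) -> arc17 f W -> arc17 (subst N f) W'.
Proof.
move=> uN eW [d18 n19 dgrad [v dv]].
have ev F (V V' : 'I_3 -> {poly K}) : (forall j, V j = \sum_(k < 3) (N k j)%:P * V' k) ->
    evp (subst N F) V' = evp F V.
  by move=> eV; rewrite /evp mmap_subst; apply: eq_mmap => j; rewrite eV.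
split; rewrite ?(ev _ _ _ eW) //.
- move=> i; rewrite mderiv_subst /evp rmorph_sum /=.
  apply: (big_ind (fun u => 'X^17 %| u)) => [|u u' du du'|j _]; first exact: dvdp0.
    exact: dvdp_add.
  rewrite (rmorphM (mmap _ _)) /=; apply: dvdp_mull.
  by rewrite -/(evp (subst N f^`M(j)) W') (ev _ _ _ eW).
pose v' : 'rV_3 := (\row_j v j) *m invmx N.
exists (v' 0); rewrite (ev _ (fun i => (W i).[0]%:P + 'X * (v i)%:P)) // => j.
have -> : v j = \sum_(k < 3) N k j * v' 0 k.
  transitivity ((v' *m N) 0 j); first by rewrite mulmxKV // mxE.
  by rewrite mxE; apply: eq_bigr => k _; rewrite mulrC.
rewrite eW !rmorph_sum /= horner_sum rmorph_sum mulr_sumr -big_split /=.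
by apply: eq_bigr => k _; rewrite hornerM hornerC !polyCM; ring.
Qed.

(** As the point has multiplicity at most two, g does not vanish there, so s has order 9 on the arc.
    The partial derivative 2 s s_i g + s^2 g_i then has order 9, below the required 17. *)
Lemma arc17_reduced f s g W i : arc17 f W -> f = s ^+ 2 * g ->
  (evp s W).[0] = 0 -> (evp s^`M(i) W).[0] != 0 -> False.
Proof.
case=> d18 n19 dgrad [v dv] ef sP nzs.
have gP : (evp g W).[0] != 0.
  apply: contra dv => /eqP gP; set V := fun j => _.
  have eV : (fun j => (W j).[0]) =1 (fun j => (V j).[0]).
    by move=> j; rewrite /V /=; rewrite !hornerE ?mul0r ?addr0.
  rewrite evp_at0 in sP; rewrite evp_at0 in gP.
  have : 'X %| evp s V by rewrite X_dvd0 evp_at0 -(meval_eq _ eV) sP.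
  have : 'X %| evp g V by rewrite X_dvd0 evp_at0 -(meval_eq _ eV) gP.
  move=> /dvdpP[b eb] /dvdpP[a ea]; rewrite ef evpM evpX ea eb.
  by apply/Xn_dvdP; exists (a ^+ 2 * b); ring.
have := dgrad i; move: d18 n19; rewrite ef expr2 !mderivM !(evpD, evpM).
move: (evp s W) (evp g W) (evp s^`M(i) W) (evp g^`M(i) W) sP nzs gP => a b a1 b1 aP nza1 nzb.
move=> d18 n19 d17.
have nza : a != 0 by apply: contraNneq n19 => ->; rewrite !mul0r dvdp0.
have [a' nza' [m ea]] := Xn_factor nza.
have m9 : m = 9%N.
  have eab : a * a * b = 'X^(m + m) * (a' * a' * b) by rewrite ea exprD; ring.
  have nz : (a' * a' * b).[0] != 0 by rewrite !hornerM !mulf_neq0.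
  by move: d18 n19; rewrite eab !dvd_Xn_exact //; lia.
have : 'X^10 %| 'X^9 * (2%:R * a' * b * a1).
  have -> : 'X^9 * (2%:R * a' * b * a1) = ((a1 * a + a * a1) * b + a * a * b1) - 'X^10 * ('X^8 * a' ^+ 2 * b1).
    by rewrite ea m9; ring.
  rewrite dvdp_sub //; first exact: (@dvd_Xn _ 10 17 _ isT d17).
  exact: dvd_Xn_mul.
rewrite dvd_Xn_exact // -polyC_natr !hornerM hornerC !mulf_neq0 //.
by rewrite pnatr_eq0.
Qed.

(** The extra factor ['X] reflects that a total order 2n - 1 of [u] and [v] already forces one of
    them to have order n. *)
Lemma dvd_Xn_prod n (u v : {poly K}) :
  'X^(n + n) %| 'X * u * v -> ('X^n %| u) || ('X^n %| v).
Proof.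
have [->|nzu] := eqVneq u 0; first by rewrite dvdp0.
have [->|nzv] := eqVneq v 0; first by rewrite dvdp0 orbT.
have [u' nzu' [i ->]] := Xn_factor nzu; have [v' nzv' [j ->]] := Xn_factor nzv.
have -> : 'X * ('X^i * u') * ('X^j * v') = 'X^((i + j).+1) * (u' * v').
  by rewrite exprS exprD; ring.
by rewrite !dvd_Xn_exact ?hornerM ?mulf_neq0 //; lia.
Qed.

(** Put l = w + 2 r y and s = 2 r w y + a x^2 + b x y + (2 r^2 + c) y^2; then p = 2 s - l^2. The
    conditions on T make the contact of the arc with s at least 6, and the derivative of q along the
    third coordinate then forces q = l^3 - 3 l s. Hence p^3 + q^2 = s^2 (l^2 + 4 p), against
    [arc17_reduced]. For a = 0 the form s is divisible by the third coordinate, which takes its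
    place. *)
Lemma torus_outer_core (a b c r al be ga : K) w y T :
  w.[0] != 0 -> r != 0 ->
  let p := pol2 (-1) 0 0 (2%:R * a) (2%:R * b) (2%:R * c) in
  let q := pol3 1 0 0 (- (3%:R * a)) (- (3%:R * b)) (- (6%:R * r ^+ 2) - 3%:R * c) 0 al be ga in
  let W := vec3 w 'X ('X^2 * y) in
  arc17 (p ^+ 3 + q ^+ 2) W ->
  'X^17 %| 2%:R * w * T + T ^+ 2 + 2%:R * ('X^2 * (a%:P + b%:P * 'X * y + c%:P * 'X^2 * y ^+ 2)) ->
  'X^17 %| 3%:R * (w + T) * evp p^`M(i2) W + 2%:R * evp q^`M(i2) W ->
  'X^6 %| T - 2%:R * r%:P * 'X^2 * y -> False.
Proof.
move=> nzw nzr p q W arc dA dB dT.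
have [T1 eT] := Xn_dvdP _ _ dT.
have {}eT : T = 2%:R * r%:P * 'X^2 * y + 'X^6 * T1 by rewrite -eT; ring.
have n2 : (2%:R : K) != 0 by rewrite pnatr_eq0.
have {}dA : 'X^6 %| 'X^2 * (2%:R * r%:P ^+ 2 * 'X^2 * y ^+ 2 + 2%:R * r%:P * w * y + (a%:P + b%:P * 'X * y + c%:P * 'X^2 * y ^+ 2)).
  rewrite -(@dvd_Xn_unit _ 6 (2%:R)); last by rewrite -polyC_natr hornerC.
  rewrite [X in _ %| X](_ : _ = 2%:R * w * T + T ^+ 2 + 2%:R * ('X^2 * (a%:P + b%:P * 'X * y + c%:P * 'X^2 * y ^+ 2))
     - 'X^6 * (2%:R * w * T1 + 4%:R * r%:P * 'X^2 * y * T1 + 'X^6 * T1 ^+ 2)); last by rewrite eT; ring.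
  by rewrite dvdp_sub ?dvd_Xn_mul //; apply: dvd_Xn dA.
have {}dB : 'X^6 %| 'X^2 * (6%:R * r%:P * y * (b%:P * 'X + 2%:R * c%:P * 'X^2 * y) - 12%:R * r%:P ^+ 2 * w * y
     + al%:P + 2%:R * be%:P * 'X * y + 3%:R * ga%:P * 'X^2 * y ^+ 2).
  rewrite -(@dvd_Xn_unit _ 6 (2%:R)); last by rewrite -polyC_natr hornerC.
  rewrite [X in _ %| X](_ : _ = 3%:R * (w + T) * evp p^`M(i2) W + 2%:R * evp q^`M(i2) W
     - 'X^6 * (6%:R * T1 * ('X * b%:P + 2%:R * c%:P * 'X^2 * y))).
    by rewrite dvdp_sub ?dvd_Xn_mul //; apply: dvd_Xn dB.
  rewrite mderiv_pol2 mderiv_pol3 /evp mmap_pol1 mmap_pol2 /W /vec3 /cf1 /cf2 /= eT.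
  rewrite !(polyC0, polyC1, polyCM, polyCB, polyCN, polyC_natr, polyC_exp); ring.
have [a0|nza] := eqVneq a 0.
  have dy : 'X^4 %| y.
    rewrite a0 polyC0 in dA.
    rewrite -(@dvd_Xn_unit _ 4 (2%:R * r%:P * w + 'X * (b%:P + 'X * (2%:R * r%:P ^+ 2 * y + c%:P * y)))); last first.
      by rewrite -polyC_natr; horner0; rewrite !mulf_neq0.
    rewrite -(@dvd_Xn_shift _ 2 6) //.
    rewrite [X in _ %| X](_ : _ = 'X^2 * (2 * r%:P ^+ 2 * 'X^2 * y ^+ 2 + 2 * r%:P * w * y + (0 + b%:P * 'X * y + c%:P * 'X^2 * y ^+ 2))) //.
    by ring.
  have [y1 ey] := Xn_dvdP _ _ dy.
  have al0 : al = 0.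
    apply: (low_coef_of (n := 2) (u := 1) (v := _) _ _ (@dvd_Xn _ 3 6 _ isT dB)).
      by rewrite hornerC oner_neq0.
    rewrite ey; transitivity ('X^2 * (al%:P * 1 + 'X * (6%:R * r%:P * 'X^3 * y1 * (b%:P * 'X + 2%:R * c%:P * 'X^6 * y1)
       - 12%:R * r%:P ^+ 2 * w * 'X^3 * y1 + 2%:R * be%:P * 'X^4 * y1 + 3%:R * ga%:P * 'X^9 * y1 ^+ 2))); last by [].
    by ring.
  apply: (@arc17_reduced _ 'X_i2 (- (3%:R * 'X_i0 ^+ 2 * pol1 0 b c ^+ 2) + 8%:R * 'X_i2 * pol1 0 b c ^+ 3
     + 2%:R * 'X_i0 ^+ 3 * pol1 (- (6%:R * r ^+ 2)) be ga - 6%:R * 'X_i0 * 'X_i2 * pol1 0 b c * pol1 (- (6%:R * r ^+ 2)) be ga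
     + 'X_i2 ^+ 2 * pol1 (- (6%:R * r ^+ 2)) be ga ^+ 2) _ i2 arc).
  - rewrite /p /q a0 al0 /pol3 /pol2 /pol1 /cf3 /cf2 /cf1 !(mpolyCN, mpolyCB, mpolyCM, mpolyC_nat, mpolyC0, mpolyC1).
    by move: 'X_i0 'X_i1 'X_i2 => X Y Z; ring.
  - by rewrite /evp mmapXU /W /vec3 /=; horner0.
  - by rewrite mderivXU eqxx /evp mmapC hornerC oner_neq0.
have nzy : y.[0] != 0.
  apply: contraNneq nza => y0; apply/eqP.
  have [y1 ey] : exists y1, y = 'X * y1.
    by have /dvdpP[y1 ->] : 'X %| y; [rewrite X_dvd0 y0 | exists y1; rewrite mulrC].
  apply: (low_coef_of (n := 2) (u := 1) (v := _) _ _ (@dvd_Xn _ 3 6 _ isT dA)).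
    by rewrite hornerC oner_neq0.
  rewrite ey; transitivity ('X^2 * (a%:P * 1 + 'X * (2%:R * r%:P ^+ 2 * 'X^3 * y1 ^+ 2 + 2%:R * r%:P * w * y1 + b%:P * 'X * y1 + c%:P * 'X^3 * y1 ^+ 2))); last by [].
  by ring.
(* The combination with factor 6 r eliminates [w]; the three remaining coefficients stand at orders
   2, 3 and 4 because [y] is a unit. *)
have dAB : 'X^6 %| 'X^2 * ((al + 6%:R * r * a)%:P + 'X * y * (2%:R * (be + 6%:R * r * b))%:P
     + 'X^2 * y ^+ 2 * (3%:R * (ga + 6%:R * r * c + 4%:R * r ^+ 3))%:P).
  have := dvdp_add dB (dvdp_mull (6%:R * r%:P) dA).
  congr (_ %| _); rewrite !(polyCD, polyCM, polyC_natr, polyC_exp); ring.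
have eal : al + 6%:R * r * a = 0.
  apply: (low_coef_of (n := 2) (u := 1) (v := _) _ _ (@dvd_Xn _ 3 6 _ isT dAB)).
    by rewrite hornerC oner_neq0.
  transitivity ('X^2 * ((al + 6%:R * r * a)%:P * 1 + 'X * (y * (2%:R * (be + 6%:R * r * b))%:P
     + 'X * y ^+ 2 * (3%:R * (ga + 6%:R * r * c + 4%:R * r ^+ 3))%:P))); last by [].
  by ring.
rewrite eal polyC0 in dAB.
have : 2%:R * (be + 6%:R * r * b) = 0.
  apply: (low_coef_of (n := 3) (u := y) (v := _) _ _ (@dvd_Xn _ 4 6 _ isT dAB)) => //.
  transitivity ('X^3 * ((2%:R * (be + 6%:R * r * b))%:P * y + 'X * (y ^+ 2 * (3%:R * (ga + 6%:R * r * c + 4%:R * r ^+ 3))%:P))); last by [].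
  by ring.
move=> ebe2; rewrite ebe2 polyC0 in dAB.
move/eqP: ebe2; rewrite mulf_eq0 (negPf n2) /= => /eqP ebe.
have : 3%:R * (ga + 6%:R * r * c + 4%:R * r ^+ 3) = 0.
  apply: (low_coef_of (n := 4) (u := y ^+ 2) (v := _) _ _ (@dvd_Xn _ 5 6 _ isT dAB)).
    by rewrite horner_exp expf_neq0.
  transitivity ('X^4 * ((3%:R * (ga + 6%:R * r * c + 4%:R * r ^+ 3))%:P * y ^+ 2 + 'X * 0)); last by [].
  by ring.
move/eqP; rewrite mulf_eq0 pnatr_eq0 /= => /eqP ega.
have {eal}eal : al = - (6%:R * r * a) by rewrite -[LHS]subr0 -eal; ring.
have {ebe}ebe : be = - (6%:R * r * b) by rewrite -[LHS]subr0 -ebe; ring.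
have {ega}ega : ga = - (6%:R * r * c) - 4%:R * r ^+ 3 by rewrite -[LHS]subr0 -ega; ring.
pose s := pol2 0 0 (2%:R * r) a b (2%:R * r ^+ 2 + c).
apply: (@arc17_reduced _ s (pol1 1 0 (2%:R * r) ^+ 2 + 4%:R * p) _ i2 arc).
- rewrite /s /p /q eal ebe ega /pol3 /pol2 /pol1 /cf3 /cf2 /cf1.
  rewrite !(mpolyCN, mpolyCB, mpolyCD, mpolyCM, mpolyC_nat, mpolyC0, mpolyC1).
  by move: 'X_i0 'X_i1 'X_i2 => X Y Z; ring.
- by rewrite /evp mmap_pol2 /W /vec3 /cf2 /=; horner0.
- by rewrite mderiv_pol2 /evp mmap_pol1 /W /vec3 /cf1 /=; horner0; rewrite ?mulf_neq0.
Qed.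

(** The orders of contact force the square of a conic, or of a line, through
    the point to divide [p^3 + q^2]. *)
Lemma torus_outer_reduced (a b c q0 q1 q2 q3 q4 q5 q6 al be ga : K) w y :
  w.[0] != 0 ->
  let p := pol2 (-1) 0 0 (2%:R * a) (2%:R * b) (2%:R * c) in
  let q := pol3 q0 q1 q2 q3 q4 q5 q6 al be ga in
  let W := vec3 w 'X ('X^2 * y) in
  arc17 (p ^+ 3 + q ^+ 2) W -> q0 = 1 -> False.
Proof.
move=> nzw p q W arc eq0.
have n2 : (2%:R : K) != 0 by rewrite pnatr_eq0.
pose Pi := a%:P + b%:P * 'X * y + c%:P * 'X^2 * y ^+ 2.
have ep : evp p W = - w ^+ 2 + 2%:R * ('X^2 * Pi).
  rewrite /evp mmap_pol2 /W /vec3 /cf2 /= !(polyC0, polyC1, polyCM, polyCN, polyC_natr) /Pi; ring.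
have eq : evp q W = w ^+ 3 + q1%:P * w ^+ 2 * 'X + q2%:P * w ^+ 2 * 'X^2 * y
    + w * 'X^2 * (q3%:P + q4%:P * 'X * y + q5%:P * 'X^2 * y ^+ 2)
    + 'X^3 * (q6%:P + al%:P * 'X * y + be%:P * 'X^2 * y ^+ 2 + ga%:P * 'X^3 * y ^+ 3).
  rewrite /evp mmap_pol3 /W /vec3 /cf3 /= eq0 polyC1; ring.
have pP : (evp p W).[0] = - w.[0] ^+ 2 by rewrite ep /Pi; horner0; rewrite ?mulr0 ?addr0.
have qP : (evp q W).[0] = w.[0] ^+ 3 by rewrite eq; horner0; rewrite ?mulr0 ?addr0.
have nza : (evp p W).[0] != 0 by rewrite pP oppr_eq0 expf_neq0.
have nzb : (evp q W).[0] != 0 by rewrite qP expf_neq0.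
have d18 : 'X^18 %| evp p W ^+ 3 + evp q W ^+ 2 by have := arc_order arc; rewrite evpD !evpX.
(* On the arc p is invertible modulo X^18. With t = - q / p the relation p^3 + q^2 = 0 becomes the
   parametrization p = - t^2, q = t^3 of the cuspidal cubic. *)
have /Bezout_eq1_coprimepP[[a' z] /= ea'] : coprimep (evp p W) 'X^18.
  by rewrite coprimep_sym coprimep_expl // coprimep_sym coprimepX.
pose t := - (evp q W * a').
have dt : 'X^18 %| t ^+ 2 + evp p W.
  have -> : t ^+ 2 + evp p W = a' ^+ 2 * (evp p W ^+ 3 + evp q W ^+ 2)
     + 'X^18 * (evp p W * z * (1 + a' * evp p W)).
    have e1 : z * 'X^18 = 1 - a' * evp p W by rewrite -ea'; ring.
    rewrite (_ : 'X^18 * _ = evp p W * (z * 'X^18) * (1 + a' * evp p W)); last by ring.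
    by rewrite e1 /t; ring.
  by rewrite dvdp_add ?dvd_Xn_mul // dvdp_mull.
have dqt : 'X^18 %| evp q W + evp p W * t.
  have -> : evp q W + evp p W * t = 'X^18 * (evp q W * z).
    by rewrite /t -[X in X + _]mulr1 -ea'; ring.
  exact: dvd_Xn_mul.
have nzt : t.[0] != 0.
  have : (t ^+ 2 + evp p W).[0] = 0 by apply/eqP; rewrite -X_dvd0; apply: (@dvd_Xn _ 1 18 _ isT dt).
  rewrite hornerD horner_exp => e; apply: contra_neq nza => t0.
  by rewrite t0 expr0n /= add0r in e.
(* In terms of t, the derivative 3 p^2 p_i + 2 q q_i is t^3 (3 t p_i + 2 q_i), and t is a unit. *)
have dgr i : 'X^17 %| 3%:R * t * evp p^`M(i) W + 2%:R * evp q^`M(i) W.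
  rewrite -(@dvd_Xn_unit _ 17 (t ^+ 3)); last by rewrite horner_exp expf_neq0.
  have [z1 e1] := Xn_dvdP _ _ dt; have [z2 e2] := Xn_dvdP _ _ dqt.
  have := arc_grad arc i; rewrite torus_grad.
  have -> : evp q W = 'X^18 * z2 - evp p W * t by rewrite -e2; ring.
  have -> : evp p W = 'X^18 * z1 - t ^+ 2 by rewrite -e1; ring.
  move: (evp p^`M(i) W) (evp q^`M(i) W) => p1 q1' d.
  rewrite [X in _ %| X](_ : _ = 3%:R * ('X^18 * z1 - t ^+ 2) ^+ 2 * p1 + 2%:R * ('X^18 * z2 - ('X^18 * z1 - t ^+ 2) * t) * q1'
    - 'X^17 * ('X * (3%:R * ('X^18 * z1 ^+ 2 - 2%:R * z1 * t ^+ 2) * p1 + 2%:R * (z2 - z1 * t) * q1'))); last by ring.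
  by rewrite dvdp_sub // dvd_Xn_mul.
(* At the point p = - w^2 and q = w^3, so t and w agree there; T measures the difference along the
   arc. *)
pose T := t - w.
have dT2 : 'X^17 %| 2%:R * w * T + T ^+ 2 + 2%:R * ('X^2 * Pi).
  have -> : 2%:R * w * T + T ^+ 2 + 2%:R * ('X^2 * Pi) = t ^+ 2 + evp p W by rewrite ep /T; ring.
  by apply: dvd_Xn dt.
have T0 : T.[0] = 0.
  have : (evp q W + evp p W * t).[0] = 0 by apply/eqP; rewrite -X_dvd0; apply: (@dvd_Xn _ 1 18 _ isT dqt).
  rewrite hornerD hornerM pP qP /T => e; rewrite hornerD [(- w).[0]]hornerN.
  apply: (@mulfI _ (- w.[0] ^+ 2)); first by rewrite oppr_eq0 expf_neq0.
  by rewrite mulr0 -[RHS]e; ring.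
have [T' eT] : exists T', T = 'X^2 * T'.
  suff /Xn_dvdP : 'X^2 %| T by [].
  rewrite -(@dvd_Xn_unit _ 2 (2%:R * w + T)); last first.
    by rewrite hornerD T0 addr0 hornerM -polyC_natr hornerC mulf_neq0.
  rewrite [X in _ %| X](_ : _ = 2%:R * w * T + T ^+ 2 + 2%:R * ('X^2 * Pi) - 'X^2 * (2%:R * Pi)); last by ring.
  by rewrite dvdp_sub ?dvd_Xn_mul //; apply: (@dvd_Xn _ 2 17 _ isT dT2).
have tE : t = w + 'X^2 * T' by rewrite -eT /T; ring.
have evx : 3%:R * t * evp p^`M(i1) W + 2%:R * evp q^`M(i1) W =
    3%:R * (w + 'X^2 * T') * (4%:R * a%:P * 'X + 2%:R * b%:P * 'X^2 * y)
    + 2%:R * (q1%:P * w ^+ 2 + 2%:R * q3%:P * w * 'X + q4%:P * w * 'X^2 * y + 3%:R * q6%:P * 'X^2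
              + 2%:R * al%:P * 'X^3 * y + be%:P * 'X^4 * y ^+ 2).
  rewrite tE mderiv_pol2 mderiv_pol3 /evp mmap_pol1 mmap_pol2 /W /vec3 /cf1 /cf2 /=.
  by rewrite !(polyC0, polyCM, polyC_natr); ring.
have evy : 3%:R * t * evp p^`M(i2) W + 2%:R * evp q^`M(i2) W =
    3%:R * (w + 'X^2 * T') * (2%:R * b%:P * 'X + 4%:R * c%:P * 'X^2 * y)
    + 2%:R * (q2%:P * w ^+ 2 + q4%:P * w * 'X + 2%:R * q5%:P * w * 'X^2 * y + al%:P * 'X^2
              + 2%:R * be%:P * 'X^3 * y + 3%:R * ga%:P * 'X^4 * y ^+ 2).
  rewrite tE mderiv_pol2 mderiv_pol3 /evp mmap_pol1 mmap_pol2 /W /vec3 /cf1 /cf2 /=.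
  by rewrite !(polyC0, polyCM, polyC_natr); ring.
have dx := dgr i1; have dy := dgr i2; rewrite evx in dx; rewrite evy in dy.
have nz2w n : (2%:R * w ^+ n).[0] != 0.
  by rewrite hornerM -polyC_natr hornerC horner_exp mulf_neq0 // expf_neq0.
have q10 : q1 = 0.
  apply: (low_coef_of (n := 0) (u := 2%:R * w ^+ 2) (v := _) (nz2w _) _ (@dvd_Xn _ 1 17 _ isT dx)).
  transitivity ('X^0 * (q1%:P * (2%:R * w ^+ 2) + 'X * (3%:R * (w + 'X^2 * T') * (4%:R * a%:P + 2%:R * b%:P * 'X * y)
    + 2%:R * (2%:R * q3%:P * w + q4%:P * w * 'X * y + 3%:R * q6%:P * 'X
              + 2%:R * al%:P * 'X^2 * y + be%:P * 'X^3 * y ^+ 2)))); last by [].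
  by ring.
have q20 : q2 = 0.
  apply: (low_coef_of (n := 0) (u := 2%:R * w ^+ 2) (v := _) (nz2w _) _ (@dvd_Xn _ 1 17 _ isT dy)).
  transitivity ('X^0 * (q2%:P * (2%:R * w ^+ 2) + 'X * (3%:R * (w + 'X^2 * T') * (2%:R * b%:P + 4%:R * c%:P * 'X * y)
    + 2%:R * (q4%:P * w + 2%:R * q5%:P * w * 'X * y + al%:P * 'X
              + 2%:R * be%:P * 'X^2 * y + 3%:R * ga%:P * 'X^3 * y ^+ 2)))); last by [].
  by ring.
have e3 : q3 + 3%:R * a = 0.
  apply: (low_coef_of (n := 1) (u := 2%:R * (2%:R * w ^+ 1)) (v := _) _ _ (@dvd_Xn _ 2 17 _ isT dx)).
    by rewrite hornerM mulf_neq0 ?nz2w // -polyC_natr hornerC.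
  rewrite q10 polyC0 polyCD polyCM polyC_natr.
  transitivity ('X^1 * ((q3%:P + 3%:R * a%:P) * (2%:R * (2%:R * w ^+ 1)) + 'X * (3%:R * w * (2%:R * b%:P * y)
    + 3%:R * 'X * T' * (4%:R * a%:P + 2%:R * b%:P * 'X * y)
    + 2%:R * (q4%:P * w * y + 3%:R * q6%:P + 2%:R * al%:P * 'X * y + be%:P * 'X^2 * y ^+ 2)))); last by [].
  by ring.
have e4 : q4 + 3%:R * b = 0.
  apply: (low_coef_of (n := 1) (u := 2%:R * w ^+ 1) (v := _) (nz2w _) _ (@dvd_Xn _ 2 17 _ isT dy)).
  rewrite q20 polyC0 polyCD polyCM polyC_natr.
  transitivity ('X^1 * ((q4%:P + 3%:R * b%:P) * (2%:R * w ^+ 1) + 'X * (3%:R * w * (4%:R * c%:P * y)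
    + 3%:R * 'X * T' * (2%:R * b%:P + 4%:R * c%:P * 'X * y)
    + 2%:R * (2%:R * q5%:P * w * y + al%:P + 2%:R * be%:P * 'X * y + 3%:R * ga%:P * 'X^2 * y ^+ 2)))); last by [].
  by ring.
have {e3}q3E : q3 = - (3%:R * a) by rewrite -[LHS]subr0 -e3; ring.
have {e4}q4E : q4 = - (3%:R * b) by rewrite -[LHS]subr0 -e4; ring.
have q60 : q6 = 0.
  apply: (low_coef_of (n := 2) (u := 3%:R%:P * (2%:R * w ^+ 0)) (v := _) _ _ (@dvd_Xn _ 3 17 _ isT dx)).
    by rewrite hornerM mulf_neq0 ?nz2w // hornerC pnatr_eq0.
  rewrite q10 q3E q4E polyC0 !polyCN !polyCM !polyC_natr.
  transitivity ('X^2 * (q6%:P * (3%:R * (2%:R * w ^+ 0)) + 'X * (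
    3%:R * T' * (4%:R * a%:P + 2%:R * b%:P * 'X * y)
    + 2%:R * (2%:R * al%:P * y + be%:P * 'X * y ^+ 2)))); last by [].
  by ring.
(* Otherwise the quadratic terms of p^3 and q^2 at the point cancel completely and the multiplicity
   is at least three. *)
have nz5 : q5 + 3%:R * c != 0.
  apply/eqP => e5.
  have q5E : q5 = - (3%:R * c) by rewrite -[LHS]subr0 -e5; ring.
  have [v /negP[]] := arc_double arc; set V := fun i => _.
  have V1 : V i1 = 'X * (v i1)%:P by rewrite /V /= hornerX polyC0 add0r.
  have V2 : V i2 = 'X * (v i2)%:P.
    by rewrite /V /= hornerM horner_exp hornerX expr0n /= mul0r polyC0 add0r.
  rewrite evpD !evpX /p /q q5E q60 q3E q4E q10 q20 eq0 /evp mmap_pol2 mmap_pol3 V1 V2 /cf2 /cf3 /=.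
  rewrite !(polyC0, polyC1, polyCN, polyCM, polyC_natr).
  move: (V i0) (v i1)%:P (v i2)%:P (a%:P) (b%:P) (c%:P) (al%:P) (be%:P) (ga%:P) => v0 v1 v2 a1 b1 c1 al1 be1 ga1.
  pose P1 := a1 * v1 ^+ 2 + b1 * (v1 * v2) + c1 * v2 ^+ 2.
  pose C1 := al1 * (v1 ^+ 2 * v2) + be1 * (v1 * v2 ^+ 2) + ga1 * v2 ^+ 3.
  apply/Xn_dvdP; exists (2%:R * v0 ^+ 3 * C1 - 12%:R * v0 ^+ 2 * 'X * P1 ^+ 2 + 8%:R * 'X^3 * P1 ^+ 3
     + 9%:R * v0 ^+ 2 * 'X * P1 ^+ 2 - 6%:R * v0 * 'X^2 * P1 * C1 + 'X^3 * C1 ^+ 2).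
  by rewrite /P1 /C1; ring.
(* With this r the quadratic part of the sextic at the point is - 12 r^2 w^4 y^2. *)
pose r := sqrtC (- (q5 + 3%:R * c) / 6%:R).
have r2 : 6%:R * r ^+ 2 = - (q5 + 3%:R * c).
  by rewrite sqrtCK mulrC divfK // pnatr_eq0.
have nzr : r != 0 by rewrite sqrtC_eq0 mulf_neq0 ?oppr_eq0 // invr_eq0 pnatr_eq0.
have q5E : q5 = - (6%:R * r ^+ 2) - 3%:R * c by rewrite r2; ring.
(* With Y the third coordinate of the arc, the condition for the partial derivative in w, added to
   three times [dT2], is 3 (T^2 - 4 r^2 Y^2). Its two factors differ by the sign of r, which is
   free. *)
have dTy : 'X^12 %| 'X * (T - 2%:R * r%:P * 'X^2 * y) * (T - 2%:R * (- r)%:P * 'X^2 * y).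
  rewrite -(@dvd_Xn_unit _ 12 (3%:R%:P)); last by rewrite hornerC pnatr_eq0.
  have d0 := dgr i0.
  rewrite mderiv_pol2 mderiv_pol3 /evp mmap_pol1 mmap_pol2 /W /vec3 /cf1 /cf2 /= in d0.
  rewrite eq0 q10 q20 q3E q4E q5E !(polyC0, polyC1, polyCD, polyCM, polyCN, polyC_natr, polyC_exp) in d0.
  have := dvdp_mull 'X (dvdp_add d0 (dvdp_mull 3%:R dT2)).
  move/(@dvd_Xn _ 12 17 _ isT); congr (_ %| _).
  by rewrite /T /Pi !polyCN !polyC_natr; ring.
have dyT : 'X^17 %| 3%:R * (w + T) * evp p^`M(i2) W + 2%:R * evp q^`M(i2) W.
  by rewrite (_ : w + T = t); [exact: dgr | rewrite /T; ring].
rewrite /p /q eq0 q10 q20 q3E q4E q60 in arc dyT.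
case/orP: (@dvd_Xn_prod 6 _ _ dTy) => dT.
  rewrite q5E in arc dyT.
  exact: (torus_outer_core nzw nzr arc dT2 dyT dT).
rewrite q5E -[r ^+ 2]sqrrN in arc dyT.
have nzNr : - r != 0 by rewrite oppr_eq0.
exact: (torus_outer_core nzw nzNr arc dT2 dyT dT).
Qed.

End Outer.

(** * Shape of the conic and the cubic at the point *)

Section Classification.
Variable K : numClosedFieldType.

Lemma substE (N : 'M[K]_3) F : subst N F =
  mmap (@mpolyC 3 K) (fun j => (N i0 j)%:MP * 'X_i0 + (N i1 j)%:MP * 'X_i1 + (N i2 j)%:MP * 'X_i2) F.
Proof. by apply: eq_mmap => j; rewrite tnth_mktuple sum3. Qed.

(** The change of coordinates [w = a w' + b x' + c y', x = x', y = d y']. *)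
Definition shear (a b c d : K) : 'M[K]_3 :=
  \matrix_(k, j) vec3 (vec3 a b c k) (vec3 0 1 0 k) (vec3 0 0 d k) j.

Lemma shear_unit a b c d : a != 0 -> d != 0 -> shear a b c d \in unitmx.
Proof.
move=> nza nzd.
have := det_trig (A := shear a b c d).
rewrite unitmxE unitfE => -> //; last first.
  apply/is_trig_mxP; apply: ord3P; apply: ord3P => //= _; by rewrite mxE.
rewrite big_ord_recl big_ord_recl big_ord_recl big_ord0 !mxE mulr1.
by rewrite /vec3 /= !mulf_neq0 ?oner_neq0.
Qed.

Lemma shearE a b c d : forall j, (shear a b c d i0 j = vec3 a 0 0 j) *
  (shear a b c d i1 j = vec3 b 1 0 j) * (shear a b c d i2 j = vec3 c 0 d j).
Proof. by apply: ord3P; rewrite !mxE. Qed.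

Lemma subst_shear a b c d F : subst (shear a b c d) F =
  mmap (@mpolyC 3 K) (vec3 (a%:MP * 'X_i0 + b%:MP * 'X_i1 + c%:MP * 'X_i2) 'X_i1 (d%:MP * 'X_i2)) F.
Proof.
rewrite substE; apply: eq_mmap => j; rewrite !shearE; move: j.
by apply: ord3P; rewrite /vec3 /= ?(mpolyC0, mpolyC1, mul0r, mul1r, addr0, add0r).
Qed.

Lemma arc17_shear a b c d F w x y w' y' : a != 0 -> d != 0 ->
  w = a%:P * w' + b%:P * x + c%:P * y' -> y = d%:P * y' ->
  arc17 F (vec3 w x y) -> arc17 (subst (shear a b c d) F) (vec3 w' x y').
Proof.
move=> nza nzd ew ey; apply: arc17_subst; first exact: shear_unit.
move=> j; rewrite sum3 !shearE; move: j.
by apply: ord3P; rewrite /vec3 /= ?(polyC0, polyC1, mul0r, mul1r, addr0, add0r).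
Qed.

Lemma pol2Z k : pol2 0 0 k (- k) 0 0 = k%:MP * pol2 0 0 1 (-1) 0 0 :> {mpoly K[3]}.
Proof.
rewrite /pol2 /cf2 !(mpolyC0, mpolyCN, mpolyC1).
by move: 'X_i0 'X_i1 'X_i2 => X Y Z; ring.
Qed.

Lemma pol3N a b c d e g h k l m :
  - pol3 a b c d e g h k l m = pol3 (- a) (- b) (- c) (- d) (- e) (- g) (- h) (- k) (- l) (- m) :> {mpoly K[3]}.
Proof.
rewrite /pol3 /cf3 !mpolyCN.
by move: 'X_i0 'X_i1 'X_i2 => X Y Z; ring.
Qed.

(** If p does not vanish at the point, completing the square in the first coordinate and rescaling
    it gives p the form required by [torus_outer_reduced]. The leading coefficient of q is then 1 or
    -1 because the point lies on the sextic, and the sign of q is immaterial. *)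
Lemma torus_not_outer (p q : {mpoly K[3]}) w y : p \is 2.-homog -> q \is 3.-homog ->
  w.[0] != 0 -> arc17 (p ^+ 3 + q ^+ 2) (vec3 w 'X ('X^2 * y)) ->
  (evp p (vec3 w 'X ('X^2 * y))).[0] = 0.
Proof.
move=> hp hq nzw arc; apply/eqP; apply/negP => /negP nzp.
have [p0 [p1 [p2 [p3 [p4 [p5 ep]]]]]] := homog2P hp.
have nzp0 : p0 != 0.
  apply: contraNneq nzp => p00; rewrite ep p00 /evp mmap_pol2 /vec3 /cf2 /=.
  by rewrite polyC0; horner0; rewrite ?(mulr0, mul0r, addr0).
have n2 : (2%:R : K) != 0 by rewrite pnatr_eq0.
pose r := sqrtC (- p0); have r2 : r ^+ 2 = - p0 by rewrite sqrtCK.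
have nzr : r != 0 by rewrite sqrtC_eq0 oppr_eq0.
pose u := p1 / (2%:R * p0); pose v := p2 / (2%:R * p0).
have n2p : 2%:R * p0 != 0 by rewrite mulf_neq0.
have ep1 : p1 = 2%:R * p0 * u by rewrite mulrC divfK.
have ep2 : p2 = 2%:R * p0 * v by rewrite mulrC divfK.
pose a := (p3 - p0 * u ^+ 2) / 2%:R; pose b := (p4 - 2%:R * p0 * u * v) / 2%:R.
pose c := (p5 - p0 * v ^+ 2) / 2%:R.
have ea : 2%:R * a = p3 - p0 * u ^+ 2 by rewrite mulrC divfK.
have eb : 2%:R * b = p4 - 2%:R * p0 * u * v by rewrite mulrC divfK.
have ec : 2%:R * c = p5 - p0 * v ^+ 2 by rewrite mulrC divfK.
pose N := shear r^-1 (- u) (- v) 1.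
pose w' := r%:P * (w + u%:P * 'X + v%:P * ('X^2 * y)).
have nzw' : w'.[0] != 0 by rewrite /w'; horner0; rewrite ?(mulr0, mul0r, addr0) mulf_neq0.
have {}arc : arc17 (subst N (p ^+ 3 + q ^+ 2)) (vec3 w' 'X ('X^2 * y)).
  apply: (arc17_shear _ _ _ _ arc); rewrite ?invr_eq0 ?oner_neq0 ?polyC1 ?mul1r //.
  have e1 : r^-1%:P * r%:P = 1 :> {poly K} by rewrite -polyCM mulVf.
  transitivity (r^-1%:P * r%:P * (w + u%:P * 'X + v%:P * ('X^2 * y)) - u%:P * 'X - v%:P * ('X^2 * y)).
    by rewrite e1; ring.
  by rewrite /w' !polyCN; ring.
have epN : subst N p = pol2 (-1) 0 0 (2%:R * a) (2%:R * b) (2%:R * c).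
  rewrite ep subst_shear mmap_pol2 /vec3 /= /pol2 /cf2 ea eb ec ep1 ep2.
  have e : r^-1%:MP ^+ 2 * p0%:MP = -1 :> {mpoly K[3]}.
    by rewrite expr2 -!mpolyCM -expr2 exprVn r2 invrN mulNr mulVf // mpolyCN mpolyC1.
  rewrite !(mpolyC0, mpolyCN, mpolyC1, mpolyCB, mpolyCM) -e !mpolyC_nat.
  by move: 'X_i0 'X_i1 'X_i2 (r^-1%:MP) (p0%:MP) => X Y Z ir a0; ring.
have [q0 [q1 [q2 [q3 [q4 [q5 [q6 [q7 [q8 [q9 eqN]]]]]]]]]] := homog3P (subst_homog N hq).
rewrite rmorphD (rmorphXn (subst N)) (rmorphXn (subst N)) /= epN eqN in arc.
have q01 : q0 ^+ 2 = 1.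
  have y0 : ('X^2 * y).[0] = 0 by rewrite hornerM hornerXn expr0n mul0r.
  have := arc_order arc; rewrite evpD !evpX => /(@dvd_Xn _ 1 18 _ isT).
  rewrite X_dvd0 => /eqP; rewrite hornerD !horner_exp !evp_at0 /meval mmap_pol2 mmap_pol3 /vec3 /= y0 hornerX => e.
  apply: (@mulIf _ (w'.[0] ^+ 6)); first by rewrite expf_neq0.
  by apply/eqP; rewrite -subr_eq0 -[X in _ == X]e; apply/eqP; rewrite /cf2 /cf3; ring.
move/eqP: q01; rewrite sqrf_eq1 => /orP[]/eqP eq0.
  exact: (torus_outer_reduced nzw' arc eq0).
rewrite -sqrrN pol3N in arc.
by apply: (torus_outer_reduced nzw' arc); rewrite eq0 opprK.
Qed.

Lemma torus_classify (p q g h : {mpoly K[3]}) d e (k : K) y :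
  p \is 2.-homog -> q \is 3.-homog -> g \is d.-homog -> h \is e.-homog ->
  (d + e = 6)%N -> (0 < d)%N -> (0 < e)%N -> k != 0 -> g * h = k%:MP * (p ^+ 3 + q ^+ 2) ->
  arc17 (p ^+ 3 + q ^+ 2) (vec3 1 'X ('X^2 * y)) ->
  exists p5 q2 q4 q5 q6 q7 q8 q9 : K,
    [/\ p5 != 0 /\ q2 != 0, q6 != 0, p = pol2 0 0 0 0 0 p5 &
        q = pol3 0 0 q2 0 q4 q5 q6 q7 q8 q9].
Proof.
move=> hp hq hg hh de d0 e0 nzk gh arc.
have nz1 : (1 : {poly K}).[0] != 0 by rewrite hornerC oner_neq0.
have pP := torus_not_outer hp hq nz1 arc.
have [p0 [p1 [p2 [p3 [p4 [p5 ep]]]]]] := homog2P hp.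
have [q0 [q1 [q2 [q3 [q4 [q5 [q6 [q7 [q8 [q9 eq]]]]]]]]]] := homog3P hq.
rewrite ep in pP; have arc' := arc; rewrite {1}ep eq in arc'.
have [[p00 p10 q00 q10 nzq2] [[nzp2 nzp3]|[[p20 p30 p40] nzp5 q30 nzq6]]] := torus_inner_flag nz1 arc' pP; last first.
  exists p5, q2, q4, q5, q6, q7, q8, q9; split.
  - by split; [exact: nzp5 | exact: nzq2].
  - exact: nzq6.
  - by rewrite ep p00; rewrite p10 p20 p30 p40.
  - by rewrite q00 q10 q30 in eq; exact: eq.
exfalso.
(* The new first coordinate is p2 w + p4 x + p5 y, and the third is divided by - p3, so that p
   becomes - p3 (w y - x^2). *)
pose N := shear p2^-1 (- (p4 / p2)) (p3 * p5 / p2) (- p3).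
pose w' := p2%:P + p4%:P * 'X + p5%:P * ('X^2 * y).
have nzw' : w'.[0] != 0 by rewrite /w'; horner0; rewrite ?(mulr0, mul0r, addr0).
have {}arc : arc17 (subst N (p ^+ 3 + q ^+ 2)) (vec3 w' 'X ('X^2 * (- p3^-1%:P * y))).
  apply: (arc17_shear _ _ _ _ arc); rewrite ?invr_eq0 ?oppr_eq0 //.
    have e3 : p3%:P * p3^-1%:P = 1 :> {poly K} by rewrite -polyCM mulfV.
    have e2 : p2%:P * p2^-1%:P = 1 :> {poly K} by rewrite -polyCM mulfV.
    rewrite /w' !(polyCN, polyCM) -[LHS]e2.
    transitivity (p2%:P * p2^-1%:P + p2^-1%:P * (p5%:P * ('X^2 * y)) * (1 - p3%:P * p3^-1%:P)); last by ring.
    by rewrite e3; ring.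
  have e3 : p3%:P * p3^-1%:P = 1 :> {poly K} by rewrite -polyCM mulfV.
  transitivity (p3%:P * p3^-1%:P * ('X^2 * y)); first by rewrite e3 mul1r.
  by rewrite polyCN; ring.
have epN : subst N p = pol2 0 0 (- p3) (- - p3) 0 0.
  rewrite ep subst_shear mmap_pol2 /vec3 /= /pol2 /cf2 p00 p10.
  have ei2 : p2^-1%:MP * p2%:MP = 1 :> {mpoly K[3]} by rewrite -mpolyCM mulVf // mpolyC1.
  rewrite !(mpolyC0, mpolyCN, mpolyCM).
  move: 'X_i0 'X_i1 'X_i2 (p2^-1%:MP) (p2%:MP) ei2 (p3%:MP) (p4%:MP) (p5%:MP) => X Y Z j2 a2 ej2 a3 a4 a5.
  transitivity (- a3 * (X * Z) * (j2 * a2) + a3 * Y ^+ 2 + (1 - j2 * a2) * (a3 ^+ 2 * a5 * Z ^+ 2 - a4 * a3 * Y * Z)); first by ring.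
  by rewrite ej2; ring.
have [r0 [r1 [r2 [r3 [r4 [r5 [r6 [r7 [r8 [r9 eqN]]]]]]]]]] := homog3P (subst_homog N hq).
rewrite rmorphD (rmorphXn (subst N)) (rmorphXn (subst N)) /= epN eqN in arc.
have nzNp3 : - p3 != 0 by rewrite oppr_eq0.
have [nzr3 nzr9 er] := torus_inner_conic nzw' nzNp3 arc.
have hg' : (k^-1)%:MP * subst N g \is d.-homog by rewrite mul_mpolyC rpredZ // subst_homog.
have hh' := subst_homog N hh.
have /negP[] := conic_reducible r6 r7 nzNp3 nzr3 nzr9 hg' hh' de d0 e0.
rewrite -er -pol2Z -epN -eqN -mulrA -(rmorphM (subst N)) gh (rmorphM (subst N)) mulrA /=.
rewrite [subst N k%:MP]comp_mpolyC -mpolyCM mulVf // mpolyC1 mul1r.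
by rewrite rmorphD !(rmorphXn (subst N)).
Qed.

End Classification.

(** * The arc of an [A 17] point *)

Section SeriesPolynomials.
Variable K : comNzRingType.
Implicit Types (a b : series K) (F G : {mpoly K[2]}).

Local Notation o0 := (0%R : 'I_2).
Local Notation o1 := (1%R : 'I_2).

Definition mon2 i j : 'X_{1..2} := (U_(o0) *+ i + U_(o1) *+ j)%MM.

Lemma mon2E i j : (mon2 i j o0 = i) * (mon2 i j o1 = j).
Proof. by rewrite !mnmDE !mulmnE !mnm1E /= !(mul0n, mul1n, addn0, add0n). Qed.

Lemma ord2P (P : 'I_2 -> Prop) : P o0 -> P o1 -> forall i, P i.
Proof.
move=> P0 P1 [[|[|//]] lti].
- by rewrite (_ : Ordinal lti = o0) //; apply: val_inj.
- by rewrite (_ : Ordinal lti = o1) //; apply: val_inj.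
Qed.

Lemma mon2_eta (m : 'X_{1..2}) : m = mon2 (m o0) (m o1).
Proof. by apply/mnmP; apply: ord2P; rewrite mon2E. Qed.

(** Iterated univariate polynomials, because the coefficients of their products are double
    convolutions, as in [series_mul]. *)
Definition bipoly F : {poly {poly K}} :=
  mmap (@polyC {poly K} \o @polyC K) (fun i => if i == o0 then 'X else ('X)%:P) F.

HB.instance Definition _ := GRing.RMorphism.copy bipoly
  (mmap (@polyC {poly K} \o @polyC K) (fun i => if i == o0 then 'X else ('X)%:P)).

Lemma coef_bipoly F i j : (bipoly F)`_i`_j = series_of_poly F i j.
Proof.
elim/mpolyind: F => [|c m F _ _ IH]; first by rewrite rmorph0 !coef0 /series_of_poly mcoeff0.
rewrite rmorphD /= !coefD IH /series_of_poly mcoeffD mcoeffZ mcoeffX -/(mon2 i j).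
congr (_ + _); rewrite /bipoly mmapZ mmapX /mmap1 big_ord_recl big_ord_recl big_ord0 mulr1 /=.
have -> : lift ord0 ord0 = o1 by apply: val_inj.
rewrite -polyC_exp -[ord0]/o0 coefCM coefMC coefXn.
have -> : (m == mon2 i j) = (i == m o0) && (j == m o1).
  apply/eqP/andP => [->|[/eqP -> /eqP ->]]; last exact: mon2_eta.
  by rewrite !mon2E !eqxx.
by rewrite coefCM; case: eqP => _; rewrite ?mul1r ?mul0r ?coefXn ?coef0 ?andbF.
Qed.

Lemma series_of_polyM F G : series_of_poly (F * G) =2 series_mul (series_of_poly F) (series_of_poly G).
Proof.
move=> i j; rewrite -coef_bipoly rmorphM /= coefM coef_sum.
apply: eq_bigr => k _; rewrite coefM; apply: eq_bigr => l _.
by rewrite !coef_bipoly.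
Qed.

Lemma series_of_polyD F G : series_of_poly (F + G) =2 series_add (series_of_poly F) (series_of_poly G).
Proof. by move=> i j; rewrite /series_of_poly mcoeffD. Qed.

Lemma series_of_poly1 : series_of_poly (1 : {mpoly K[2]}) =2 series_one K.
Proof.
move=> i j; rewrite -coef_bipoly rmorph1 /series_one coefC.
by case: i => [|i] /=; rewrite ?coef0 // coefC; case: j.
Qed.

Definition agree N a b := forall i j, (i < N)%N -> (j < N)%N -> a i j = b i j.

(** A coefficient of a product involves only indices that are at most as large in each variable, so
    a square of indices is stable. *)
Lemma agree_mul N a a' b b' : agree N a a' -> agree N b b' ->
  agree N (series_mul a b) (series_mul a' b').
Proof.
move=> ha hb i j lti ltj; apply: eq_bigr => k _; apply: eq_bigr => l _.
by have := ltn_ord k; have := ltn_ord l => l1 k1; rewrite ha ?hb //; lia.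
Qed.

Lemma agree_exp N a b n : agree N a b -> agree N (series_exp a n) (series_exp b n).
Proof. by move=> hab; elim: n => [|n IHn] //; apply: agree_mul. Qed.

Lemma agree_trans N a b c : agree N a b -> agree N b c -> agree N a c.
Proof. by move=> h1 h2 i j ? ?; rewrite h1 ?h2. Qed.

Lemma series_of_polyX F n N : agree N (series_of_poly (F ^+ n)) (series_exp (series_of_poly F) n).
Proof.
elim: n => [|n IHn] i j lti ltj; first by rewrite expr0 series_of_poly1.
by rewrite exprS series_of_polyM; apply: (agree_mul (N := N)).
Qed.

Definition trunc N a : {mpoly K[2]} :=
  \sum_(i < N) \sum_(j < N) (a i j)%:MP * 'X_[mon2 i j].

Lemma truncE N a : agree N (series_of_poly (trunc N a)) a.
Proof.
move=> i j lti ltj; rewrite /series_of_poly -/(mon2 i j) /trunc !raddf_sum /=.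
rewrite (bigD1 (Ordinal lti)) //= raddf_sum /= (bigD1 (Ordinal ltj)) //=.
rewrite mcoeffCM mcoeffX eqxx mulr1 !big1 ?addr0 // => [k /eqP ne|l /eqP ne].
  rewrite raddf_sum big1 // => l _ /=; rewrite mcoeffCM mcoeffX.
  case: eqP => [e|_]; last by rewrite mulr0.
  by case: ne; apply: val_inj; have := congr1 (fun m : 'X_{1..2} => m o0) e; rewrite !mon2E.
rewrite mcoeffCM mcoeffX; case: eqP => [e|_]; last by rewrite mulr0.
by case: ne; apply: val_inj; have := congr1 (fun m : 'X_{1..2} => m o1) e; rewrite !mon2E.
Qed.

End SeriesPolynomials.

(** * Construction of the arc by Newton's method *)

Section LocalArc.
Variable K : numClosedFieldType.
Implicit Types (F G U V E g : {mpoly K[2]}) (x y : {poly K}) (a b u v e : series K).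

Local Notation o0 := (0%R : 'I_2).
Local Notation o1 := (1%R : 'I_2).

Lemma horner0DX (a b : {poly K}) : (a + 'X * b).[0] = a.[0].
Proof. by rewrite !hornerE. Qed.

Definition vec2 T (s t : T) (i : 'I_2) : T := if i == o0 then s else t.

Definition ev2 x y F : {poly K} := mmap (@polyC K) (vec2 x y) F.

HB.instance Definition _ x y := GRing.RMorphism.copy (ev2 x y) (mmap (@polyC K) (vec2 x y)).

Lemma ev2_taylor x y s t h F : exists r,
  ev2 (x + h * s) (y + h * t) F
  = ev2 x y F + h * (s * ev2 x y F^`M(o0) + t * ev2 x y F^`M(o1)) + h ^+ 2 * r.
Proof.
elim/mpoly_ring_ind: F => [c|i|F G [r eF] [r' eG]|F G [r eF] [r' eG]].
- by exists 0; rewrite !mderivC !rmorph0 /ev2 !mmapC; ring.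
- exists 0; rewrite !mderivXU /ev2 !mmapXU !mmapC; move: i.
  by apply: ord2P; rewrite /vec2 /= ?polyC0 ?polyC1; ring.
- by exists (r + r'); rewrite !mderivD !rmorphD /= eF eG; ring.
- rewrite !mderivM !(rmorphD (ev2 _ _)) !(rmorphM (ev2 _ _)) /= eF eG.
  move: (ev2 x y F) (ev2 x y G) (ev2 x y F^`M(o0)) (ev2 x y G^`M(o0)) (ev2 x y F^`M(o1)) (ev2 x y G^`M(o1)).
  move=> f g f0 g0 f1 g1.
  exists (f * r' + g * r + (s * f0 + t * f1 + h * r) * (s * g0 + t * g1 + h * r')).
  by ring.
Qed.

Lemma ev2_at0 x y F : x.[0] = 0 -> y.[0] = 0 -> (ev2 x y F).[0] = series_of_poly F 0 0.
Proof.
move=> x0 y0; elim/mpoly_ring_ind: F => [c|i|F G eF eG|F G eF eG].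
- by rewrite /ev2 mmapC hornerC /series_of_poly mcoeffC addm0 eqxx mulr1.
- rewrite /ev2 mmapXU /series_of_poly mcoeffX addm0 mnm1_eq0; move: i.
  by apply: ord2P; rewrite /vec2 /= ?x0 ?y0.
- by rewrite rmorphD /= hornerD eF eG series_of_polyD.
- by rewrite (rmorphM (ev2 _ _)) /= hornerM eF eG series_of_polyM /series_mul !big_ord_recl !big_ord0 !addr0.
Qed.

Lemma series_of_mderiv0 F i j : series_of_poly F^`M(o0) i j = series_of_poly F i.+1 j *+ i.+1.
Proof.
rewrite /series_of_poly mcoeff_mderiv -/(mon2 i j) mon2E; congr (F@_ _ *+ _).
apply/mnmP => k; rewrite mnmDE -/(mon2 i.+1 j) mnm1E; move: k.
by apply: ord2P; rewrite !mon2E /= ?addn1 ?addn0.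
Qed.

Lemma series_of_mderiv1 F i j : series_of_poly F^`M(o1) i j = series_of_poly F i j.+1 *+ j.+1.
Proof.
rewrite /series_of_poly mcoeff_mderiv -/(mon2 i j) mon2E; congr (F@_ _ *+ _).
apply/mnmP => k; rewrite mnmDE -/(mon2 i j.+1) mnm1E; move: k.
by apply: ord2P; rewrite !mon2E /= ?addn1 ?addn0.
Qed.

(** Every monomial of [F] has an exponent at least [N], and both arguments are divisible by ['X]. *)
Lemma ev2_remainder N x y F : 'X %| x -> 'X %| y ->
  agree N (series_of_poly F) (fun _ _ => 0) -> 'X^N %| ev2 x y F.
Proof.
move=> dx dy aF; rewrite /ev2 /mmap big_seq.
apply: (big_ind (fun p : {poly K} => 'X^N %| p)) => [|p q|m mF]; first exact: dvdp0.
  exact: dvdp_add.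
apply: dvdp_mull; rewrite /mmap1 big_ord_recl big_ord_recl big_ord0 mulr1.
have -> : lift ord0 ord0 = o1 by apply: val_inj.
have [lt0|ge0] := ltnP (m o0) N; last first.
  apply: dvdp_mulr; apply: (@dvdp_trans _ (x ^+ N)); first exact: dvdp_exp2r.
  exact: dvdp_exp2l.
have [lt1|ge1] := ltnP (m o1) N; last first.
  apply: dvdp_mull; apply: (@dvdp_trans _ (y ^+ N)); first exact: dvdp_exp2r.
  exact: dvdp_exp2l.
have := aF _ _ lt0 lt1; rewrite /series_of_poly -/(mon2 _ _) -mon2_eta => e.
by rewrite mcoeff_msupp e eqxx in mF.
Qed.

Lemma local_truncation N n g u v e :
  series_mul e (series_of_poly g) =2 series_add (series_exp u 2) (series_exp v n) ->
  agree N (series_of_poly (trunc N e * g - trunc N u ^+ 2 - trunc N v ^+ n)) (fun _ _ => 0).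
Proof.
move=> eg i j lti ltj; rewrite /series_of_poly !mcoeffB.
rewrite -!/(series_of_poly _ _ _) series_of_polyM.
have -> : series_mul (series_of_poly (trunc N e)) (series_of_poly g) i j = series_mul e (series_of_poly g) i j.
  by apply: (agree_mul (N := N)) => //; apply: truncE.
have pw w k : series_of_poly (trunc N w ^+ k) i j = series_exp w k i j.
  have := agree_trans (@series_of_polyX _ (trunc N w) k N) (agree_exp k (@truncE _ N w)).
  exact.
by rewrite eg !pw /series_add; ring.
Qed.

(** The vector d is tangent to U = 0 and the derivative of U along n is 1. An error z X^(n+2) is
    therefore removed at its lowest order by subtracting z(0) X^n from [y]. Only the component along
    n moves, so the tangent of the arc is kept. *)
Lemma newton_arc U (d1 d2 n1 n2 : K) :
  series_of_poly U 0 0 = 0 ->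
  series_of_poly U 1 0 * d1 + series_of_poly U 0 1 * d2 = 0 ->
  series_of_poly U 1 0 * n1 + series_of_poly U 0 1 * n2 = 1 ->
  forall n, exists y, 'X^(n.+2) %| ev2 (d1%:P * 'X + n1%:P * ('X^2 * y)) (d2%:P * 'X + n2%:P * ('X^2 * y)) U.
Proof.
move=> U0 Ud Un; elim=> [|n [y dy]].
  exists 0; rewrite !mulr0 !addr0.
  have [r] := ev2_taylor 0 0 d1%:P d2%:P 'X U; rewrite !add0r -!(mulrC 'X) => ->.
  have ev0 G : ev2 0 0 G = (series_of_poly G 0 0)%:P.
    elim/mpoly_ring_ind: G => [c|i|F G eF eG|F G eF eG].
    - by rewrite /ev2 mmapC /series_of_poly mcoeffC addm0 eqxx mulr1.
    - rewrite /ev2 mmapXU /series_of_poly mcoeffX addm0 mnm1_eq0; move: i.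
      by apply: ord2P; rewrite /vec2 /= polyC0.
    - by rewrite rmorphD /= eF eG series_of_polyD polyCD.
    - by rewrite (rmorphM (ev2 _ _)) /= eF eG series_of_polyM /series_mul !big_ord_recl !big_ord0 !addr0 polyCM.
  rewrite !ev0 U0 series_of_mderiv0 series_of_mderiv1 !mulr1n polyC0 add0r -!polyCM -polyCD.
  by rewrite mulrC in Ud; rewrite [d2 * _]mulrC Ud polyC0 mulr0 add0r dvd_Xn_mul.
have [z ez] := Xn_dvdP _ _ dy.
exists (y - (z.[0])%:P * 'X^n).
have [r] := ev2_taylor (d1%:P * 'X + n1%:P * ('X^2 * y)) (d2%:P * 'X + n2%:P * ('X^2 * y))
   (- n1%:P) (- n2%:P) ('X^(n.+2) * (z.[0])%:P) U.
set x1 := d1%:P * 'X + _; set y1 := d2%:P * 'X + _.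
have -> : x1 + 'X^(n.+2) * (z.[0])%:P * (- n1%:P) = d1%:P * 'X + n1%:P * ('X^2 * (y - (z.[0])%:P * 'X^n)).
  by rewrite /x1 !exprS; ring.
have -> : y1 + 'X^(n.+2) * (z.[0])%:P * (- n2%:P) = d2%:P * 'X + n2%:P * ('X^2 * (y - (z.[0])%:P * 'X^n)).
  by rewrite /y1 !exprS; ring.
have x10 : x1.[0] = 0 by rewrite /x1 !(hornerD, hornerM, hornerX) !(mulr0, mul0r, addr0).
have y10 : y1.[0] = 0 by rewrite /y1 !(hornerD, hornerM, hornerX) !(mulr0, mul0r, addr0).
rewrite ez => ->.
set D := - n1%:P * _ + _.
have D0 : D.[0] = - 1.
  rewrite /D hornerD !hornerM !hornerN !hornerC !ev2_at0 // series_of_mderiv0 series_of_mderiv1 !mulr1n.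
  by rewrite -Un; ring.
move: D D0 => D D0.
rewrite [X in _ %| X](_ : _ = 'X^(n.+2) * (z + (z.[0])%:P * D + 'X^(n.+2) * ((z.[0])%:P ^+ 2 * r))); last by ring.
rewrite dvd_Xn_shift // (_ : n.+3 - n.+2 = 1)%N ?expr1 ?X_dvd0; last by lia.
by rewrite !(hornerD, hornerM, hornerX) hornerC D0 !mul0r addr0 mulrN1 subrr.
Qed.

(** On an arc with U = 0 modulo X^18 the Jacobian condition makes V of order exactly 1, so U^2 +
    V^18 has order 18 and its derivatives have order at least 17. On the straight line in the
    direction n, U has order 1 and g has order 2. *)
Lemma local_arc g u v e : u 0%N 0%N = 0 -> v 0%N 0%N = 0 -> e 0%N 0%N != 0 ->
  u 1%N 0%N * v 0%N 1%N - u 0%N 1%N * v 1%N 0%N != 0 ->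
  series_mul e (series_of_poly g) =2 series_add (series_exp u 2) (series_exp v 18) ->
  exists d1 d2 n1 n2 : K, d1 * n2 - d2 * n1 != 0 /\
  exists y, let x1 := d1%:P * 'X + n1%:P * ('X^2 * y) in let y1 := d2%:P * 'X + n2%:P * ('X^2 * y) in
  [/\ 'X^18 %| ev2 x1 y1 g, ~~ ('X^19 %| ev2 x1 y1 g),
      forall i, 'X^17 %| ev2 x1 y1 g^`M(i) &
      ~~ ('X^3 %| ev2 ('X * n1%:P) ('X * n2%:P) g)].
Proof.
move=> u0 v0 nze jac eg.
(* Truncation at 20 leaves a remainder of order at least 20 on the arc, with partial derivatives of
   order at least 19: both exceed all the orders to be read off. *)
pose N := 20%N; pose U := trunc N u; pose V := trunc N v; pose E := trunc N e.
have tr a i j : (i < N)%N -> (j < N)%N -> series_of_poly (trunc N a) i j = a i j by exact: truncE.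
have [d1 [d2 [n1 [n2 [det ud un vd]]]]] : exists d1 d2 n1 n2 : K,
    [/\ d1 * n2 - d2 * n1 != 0, u 1%N 0%N * d1 + u 0%N 1%N * d2 = 0,
        u 1%N 0%N * n1 + u 0%N 1%N * n2 = 1 & v 1%N 0%N * d1 + v 0%N 1%N * d2 != 0].
  exists (- u 0%N 1%N), (u 1%N 0%N).
  have vd : v 1%N 0%N * - u 0%N 1%N + v 0%N 1%N * u 1%N 0%N != 0.
    by rewrite mulrN addrC mulrC [v 1%N 0%N * _]mulrC.
  have [u10|nz] := eqVneq (u 1%N 0%N) 0.
    have nz01 : u 0%N 1%N != 0.
      by apply: contraNneq jac => ->; rewrite u10 !mul0r subr0.
    exists 0, (u 0%N 1%N)^-1; split=> //; rewrite ?u10.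
    - by rewrite mulNr mulfV // mul0r subr0 oppr_eq0 oner_neq0.
    - by rewrite mul0r mulr0 addr0.
    - by rewrite mulr0 add0r mulfV.
  exists (u 1%N 0%N)^-1, 0; split=> //.
  - by rewrite mulr0 mulfV // sub0r oppr_eq0 oner_neq0.
  - by ring.
  - by rewrite mulr0 addr0 mulfV.
have [y dU] : exists y, 'X^18 %| ev2 (d1%:P * 'X + n1%:P * ('X^2 * y)) (d2%:P * 'X + n2%:P * ('X^2 * y)) U.
  have U0 : series_of_poly U 0 0 = 0 by rewrite tr.
  have Ud : series_of_poly U 1 0 * d1 + series_of_poly U 0 1 * d2 = 0 by rewrite !tr.
  have Un : series_of_poly U 1 0 * n1 + series_of_poly U 0 1 * n2 = 1 by rewrite !tr.
  exact: (newton_arc U0 Ud Un 16).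
exists d1, d2, n1, n2; split=> //; exists y => x1 y1.
set rem := E * g - U ^+ 2 - V ^+ 18.
have arem : agree N (series_of_poly rem) (fun _ _ => 0) by exact: local_truncation.
have Eg : E * g = U ^+ 2 + V ^+ 18 + rem by rewrite /rem; ring.
move: rem arem Eg => rem arem Eg.
have x10 : x1.[0] = 0 by rewrite /x1 !(hornerD, hornerM, hornerX) !(mulr0, mul0r, addr0).
have y10 : y1.[0] = 0 by rewrite /y1 !(hornerD, hornerM, hornerX) !(mulr0, mul0r, addr0).
have dx1 : 'X %| x1 by rewrite X_dvd0 x10.
have dy1 : 'X %| y1 by rewrite X_dvd0 y10.
have linear F s t z : series_of_poly F 0 0 = 0 -> exists2 c : {poly K},
    c.[0] = series_of_poly F 1 0 * s + series_of_poly F 0 1 * t &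
    ev2 (s%:P * 'X + 'X^2 * z.1) (t%:P * 'X + 'X^2 * z.2) F = 'X * c.
  move=> F0; have [r] := ev2_taylor 0 0 (s%:P + 'X * z.1) (t%:P + 'X * z.2) 'X F.
  rewrite !add0r => e0; exists (((s%:P + 'X * z.1) * ev2 0 0 F^`M(o0) + (t%:P + 'X * z.2) * ev2 0 0 F^`M(o1)) + 'X * r).
    rewrite !(hornerD, hornerM, hornerC, hornerX) !ev2_at0 ?horner0 // series_of_mderiv0 series_of_mderiv1.
    by rewrite !mulr1n; ring.
  rewrite (_ : s%:P * 'X + 'X^2 * z.1 = 'X * (s%:P + 'X * z.1)); last by ring.
  rewrite (_ : t%:P * 'X + 'X^2 * z.2 = 'X * (t%:P + 'X * z.2)); last by ring.
  rewrite e0; have /dvdpP[q eq] : 'X %| ev2 0 0 F by rewrite X_dvd0 ev2_at0 ?horner0 // F0.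
  have : ev2 0 0 F = (ev2 0 0 F).[0]%:P.
    rewrite /ev2; elim/mpoly_ring_ind: (F) => [c|i|F' G eF eG|F' G eF eG].
    - by rewrite mmapC hornerC.
    - by rewrite mmapXU; move: i; apply: ord2P; rewrite /vec2 /= horner0 polyC0.
    - by rewrite mmapD hornerD polyCD -eF -eG.
    - by rewrite (rmorphM (mmap _ _)) /= hornerM polyCM -eF -eG.
  by rewrite ev2_at0 ?horner0 // F0 polyC0 => ->; ring.
have [c c0 eV] := linear V d1 d2 (n1%:P * y, n2%:P * y) (etrans (tr _ 0%N 0%N isT isT) v0).
rewrite !tr // in c0.
have nzc : c.[0] != 0 by rewrite c0.
have {}eV : ev2 x1 y1 V = 'X * c.
  by rewrite -eV /x1 /y1 /=; congr (ev2 _ _ V); ring.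
have nzE : (ev2 x1 y1 E).[0] != 0 by rewrite ev2_at0 // tr.
have evE := congr1 (ev2 x1 y1) Eg.
rewrite !(rmorphD (ev2 _ _)) (rmorphM (ev2 _ _)) !(rmorphXn (ev2 _ _)) /= eV in evE.
have [z ez] := Xn_dvdP _ _ dU; rewrite -/x1 -/y1 in ez.
have [rr er] : exists rr, ev2 x1 y1 rem = 'X^20 * rr by apply/Xn_dvdP; exact: ev2_remainder.
have evE' : ev2 x1 y1 E * ev2 x1 y1 g = 'X^18 * (c ^+ 18 + 'X * ('X^17 * z ^+ 2 + 'X * rr)).
  by rewrite evE ez er exprMn; ring.
have unit0 : (c ^+ 18 + 'X * ('X^17 * z ^+ 2 + 'X * rr)).[0] != 0.
  by rewrite horner0DX horner_exp expf_neq0.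
split.
- by rewrite -(dvd_Xn_unit _ _ nzE) evE' dvd_Xn_exact.
- by rewrite -(dvd_Xn_unit _ _ nzE) evE' dvd_Xn_exact.
- move=> i; rewrite -(dvd_Xn_unit _ _ nzE).
  have := congr1 (fun G => ev2 x1 y1 G^`M(i)) Eg.
  have dexp (H : {mpoly K[2]}) n : exists T, (H ^+ n.+1)^`M(i) = H ^+ n * T.
    elim: n => [|n [T eT]]; first by exists H^`M(i); rewrite expr0 mul1r expr1.
    rewrite exprS mderivM eT; exists (H^`M(i) + T); by rewrite (exprS H n); ring.
  have [TU eTU] := dexp U 1%N; have [TV eTV] := dexp V 17%N.
  rewrite mderivM !mderivD eTU eTV !(rmorphD (ev2 _ _)) !(rmorphM (ev2 _ _)) !(rmorphXn (ev2 _ _)) /= eV ez.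
  have [rd erd] : exists rd, ev2 x1 y1 rem^`M(i) = 'X^19 * rd.
    apply/Xn_dvdP; apply: ev2_remainder => // j k ltj ltk; move: i {dexp TU eTU TV eTV}.
    have [j1 k1] : (j.+1 < N)%N /\ (k.+1 < N)%N by rewrite /N; lia.
    apply: ord2P; first by rewrite series_of_mderiv0 (arem _ _ j1 (ltnW k1)) mul0rn.
    by rewrite series_of_mderiv1 (arem _ _ (ltnW j1) k1) mul0rn.
  have [G0 eG0] : exists G0 : {poly K}, ev2 x1 y1 g = 'X^18 * G0.
    by apply/Xn_dvdP; rewrite -(dvd_Xn_unit _ _ nzE) evE' dvd_Xn_exact.
  rewrite erd eG0 => ed.
  rewrite [X in _ %| X](_ : _ = 'X^17 * ('X * z * ev2 x1 y1 TU + c ^+ 17 * ev2 x1 y1 TV + 'X^2 * rd - 'X * ev2 x1 y1 E^`M(i) * G0)).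
    exact: dvd_Xn_mul.
  rewrite -[LHS](addKr (ev2 x1 y1 E^`M(i) * ('X^18 * G0))) ed exprMn; ring.
have [b b0 eU] := linear U n1 n2 (0, 0) (etrans (tr _ 0%N 0%N isT isT) u0).
have [b' _ eV'] := linear V n1 n2 (0, 0) (etrans (tr _ 0%N 0%N isT isT) v0).
rewrite /= !mulr0 !addr0 ![_%:P * 'X]mulrC in eU eV'.
rewrite !tr // un in b0.
have nzE' : (ev2 ('X * n1%:P) ('X * n2%:P) E).[0] != 0.
  by rewrite ev2_at0 ?tr // hornerM hornerX mul0r.
rewrite -(dvd_Xn_unit _ _ nzE') -(rmorphM (ev2 _ _)) Eg !(rmorphD (ev2 _ _)) !(rmorphXn (ev2 _ _)) /= eU eV'.
have [rr' ->] : exists rr', ev2 ('X * n1%:P) ('X * n2%:P) rem = 'X^20 * rr'.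
  by apply/Xn_dvdP; apply: ev2_remainder => //; apply: dvdp_mulr.
rewrite [X in ~~ (_ %| X)](_ : _ = 'X^2 * (b ^+ 2 + 'X * ('X^15 * b' ^+ 18 + 'X^17 * rr'))); last first.
  by rewrite !exprMn; ring.
by rewrite dvd_Xn_exact // horner0DX horner_exp b0 expr1n oner_neq0.
Qed.

End LocalArc.

Section ArcOfA17.

Lemma euler_identity n (K : comNzRingType) d (F : {mpoly K[n]}) : F \is d.-homog ->
  \sum_(i < n) 'X_i * F^`M(i) = d%:R * F.
Proof.
move=> hF; rewrite [in RHS](mpolyE F) [in LHS](mpolyE F) mulr_sumr.
under eq_bigr => i _ do rewrite raddf_sum mulr_sumr.
rewrite exchange_big /= big_seq [RHS]big_seq; apply: eq_bigr => m mF.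
rewrite -(dhomog_mf hF mF) /= mdegE natr_sum mulr_suml; apply: eq_bigr => i _.
rewrite mderivZ mderivX scalerA -!mul_mpolyC.
have [m0|mi] := posnP (m i); first by rewrite m0 mulr0 mpolyC0 !mul0r mulr0.
have em : 'X_[m] = 'X_i * 'X_[m - U_(i)] :> {mpoly K[n]}.
  rewrite -mpolyXD addmC submK //.
  by apply/mnm_lepP => j; rewrite mnm1E; case: eqP => [<-|].
rewrite mpolyCM mpolyC_nat em.
by move: 'X_i 'X_[m - U_(i)] (m i)%:R (F@_m)%:MP => a b c e; ring.
Qed.

Variable K : numClosedFieldType.
Implicit Types (F : {mpoly K[3]}) (x y : {poly K}).

Definition dehomog F : {mpoly K[2]} := mmap (@mpolyC 2 K) (vec3 1 'X_0 'X_1) F.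

Lemma ev2_dehomog x y F : ev2 x y (dehomog F) = evp F (vec3 1 x y).
Proof.
rewrite /ev2 /dehomog /evp; elim/mpoly_ring_ind: F => [c|i|F G eF eG|F G eF eG].
- by rewrite !mmapC.
- by rewrite !mmapXU; move: i; apply: ord3P; rewrite /vec3 /= ?mmapXU ?rmorph1.
- by rewrite !mmapD eF eG.
- by rewrite !(rmorphM (mmap _ _)) /= eF eG.
Qed.

Lemma mderiv_dehomog0 F : (dehomog F)^`M(0) = dehomog F^`M(i1).
Proof.
rewrite /dehomog; elim/mpoly_ring_ind: F => [c|i|F G eF eG|F G eF eG].
- by rewrite mderivC mmap0 mmapC mderivC.
- rewrite mderivXU !mmapXU mmapC; move: i.
  by apply: ord3P; rewrite /vec3 /= ?mderivXU ?mderivC ?mpolyC0 // -mpolyC1 mderivC.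
- by rewrite !mderivD !mmapD mderivD eF eG.
- by rewrite mderivM !(rmorphM (mmap _ _)) /= mderivM mmapD !(rmorphM (mmap _ _)) /= eF eG.
Qed.

Lemma mderiv_dehomog1 F : (dehomog F)^`M(1) = dehomog F^`M(i2).
Proof.
rewrite /dehomog; elim/mpoly_ring_ind: F => [c|i|F G eF eG|F G eF eG].
- by rewrite mderivC mmap0 mmapC mderivC.
- rewrite mderivXU !mmapXU mmapC; move: i.
  by apply: ord3P; rewrite /vec3 /= ?mderivXU ?mderivC ?mpolyC0 // -mpolyC1 mderivC.
- by rewrite !mderivD !mmapD mderivD eF eG.
- by rewrite mderivM !(rmorphM (mmap _ _)) /= mderivM mmapD !(rmorphM (mmap _ _)) /= eF eG.
Qed.

Definition block12 (a b c d : K) : 'M[K]_3 :=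
  \matrix_(k, j) vec3 (vec3 1 0 0 j) (vec3 0 a b j) (vec3 0 c d j) k.

Lemma block12_unit a b c d : a * d - b * c != 0 -> block12 a b c d \in unitmx.
Proof.
move=> nz; set D := a * d - b * c in nz.
have [] := mulmx1_unit (A := block12 a b c d) (B := block12 (d / D) (- b / D) (- c / D) (a / D)) _; last by [].
apply/matrixP => i j; rewrite !mxE sum3 !mxE; move: i j.
by apply: ord3P; apply: ord3P; rewrite /vec3 /= ?(mul0r, mulr0, add0r, addr0, mulr1) // /D; field.
Qed.

Lemma arc17_of_local d F u v e : F \is d.-homog ->
  u 0%N 0%N = 0 -> v 0%N 0%N = 0 -> e 0%N 0%N != 0 ->
  u 1%N 0%N * v 0%N 1%N - u 0%N 1%N * v 1%N 0%N != 0 ->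
  series_mul e (series_of_poly (dehomog F)) =2 series_add (series_exp u 2) (series_exp v 18) ->
  exists a b c d y, block12 a b c d \in unitmx /\
    arc17 (subst (block12 a b c d) F) (vec3 1 'X ('X^2 * y)).
Proof.
move=> hF u0 v0 nze jac eqn.
have [d1 [d2 [n1 [n2 [det [y /= [d18 n19 d17 n3]]]]]]] := local_arc u0 v0 nze jac eqn.
exists d1, d2, n1, n2, y; have uB := block12_unit det; split=> //.
move: d18 n19 d17 n3; set x1 := _ + _; set y1 := _ + _ => d18 n19 d17 n3.
apply: (@arc17_subst _ _ (vec3 1 x1 y1)) => //.
  move=> j; rewrite sum3 !mxE; move: j.
  by apply: ord3P; rewrite /vec3 /= ?(polyC0, polyC1, mul0r, mul1r, mulr1, addr0, add0r).
have g1 : 'X^17 %| evp F^`M(i1) (vec3 1 x1 y1) by rewrite -ev2_dehomog -mderiv_dehomog0.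
have g2 : 'X^17 %| evp F^`M(i2) (vec3 1 x1 y1) by rewrite -ev2_dehomog -mderiv_dehomog1.
have x10 : x1.[0] = 0 by rewrite /x1 !(hornerD, hornerM, hornerX) !(mulr0, mul0r, addr0).
have y10 : y1.[0] = 0 by rewrite /y1 !(hornerD, hornerM, hornerX) !(mulr0, mul0r, addr0).
split; rewrite -?ev2_dehomog //.
  (* The local equation controls the derivatives in the two affine coordinates; the remaining one
     follows from Euler's identity, as the first coordinate is 1 on the arc. *)
  apply: ord3P => //.
  have := congr1 (fun G => evp G (vec3 1 x1 y1)) (euler_identity hF).
  rewrite sum3 !evpD !(evpM 'X_ _) evpM {1 3 5}/evp !mmapXU /vec3 /= mul1r => e0.
  rewrite (_ : evp _ _ = evp d%:R (vec3 1 x1 y1) * evp F (vec3 1 x1 y1)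
     - x1 * evp F^`M(i1) (vec3 1 x1 y1) - y1 * evp F^`M(i2) (vec3 1 x1 y1)); last first.
    by rewrite -e0; ring.
  rewrite !dvdp_sub //; apply: dvdp_mull => //.
  by rewrite -ev2_dehomog; apply: dvd_Xn d18.
exists (vec3 0 n1 n2).
rewrite [X in ~~ (_ %| X)](_ : _ = evp F (vec3 1 ('X * n1%:P) ('X * n2%:P))).
  by rewrite -ev2_dehomog.
apply: eq_mmap; apply: ord3P; rewrite /vec3 /= ?x10 ?y10 ?hornerC ?polyC0 ?polyC1 ?mulr0 ?addr0 ?add0r //.
Qed.

End ArcOfA17.

Section A17.
Variable R : realType.
Local Notation C := R[i].

Lemma local_equation_dehomog (f : {mpoly C[3]}) M : local_equation f M = dehomog (subst M f).
Proof. exact: local_equationE. Qed.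

Lemma A17_arc d (f : {mpoly C[3]}) P : f \is d.-homog -> has_singularity_type f P (A 17) ->
  exists M y, [/\ M \in unitmx, row 0 M = P & arc17 (subst M f) (vec3 1 'X ('X^2 * y))].
Proof.
move=> hf [_ _ [M [u [v [e [[uM eM] [_ [u0 v0] jac] [_ nze] eqn]]]]]].
have {}eqn : series_mul e (series_of_poly (dehomog (subst M f))) =2
    series_add (series_exp u 2) (series_exp v 18).
  by move=> i j; rewrite -local_equation_dehomog eqn.
have [a [b [c [d' [y [uB arc]]]]]] := arc17_of_local (subst_homog M hf) u0 v0 nze jac eqn.
exists (block12 a b c d' *m M), y; split.
- by rewrite unitmx_mul uB.
- suff e0 : row 0 (block12 a b c d') = delta_mx 0 0 by rewrite row_mul e0 -rowE.
  by apply/rowP => j; rewrite !mxE /=; move: j; apply: ord3P; rewrite /vec3 /=.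
- by rewrite -substM.
Qed.

End A17.

(** * Weierstrass normal form *)

Section Weierstrass.
Variable K : numClosedFieldType.

Definition mat3 (r0 r1 r2 : 'I_3 -> K) : 'M[K]_3 :=
  \matrix_(k, j) vec3 (r0 j) (r1 j) (r2 j) k.

Lemma subst_mat3 r0 r1 r2 F : subst (mat3 r0 r1 r2) F =
  mmap (@mpolyC 3 K) (fun j => (r0 j)%:MP * 'X_i0 + (r1 j)%:MP * 'X_i1 + (r2 j)%:MP * 'X_i2) F.
Proof. by rewrite substE; apply: eq_mmap => j; rewrite !mxE. Qed.

(** The cubic [y^2 z = x^3 + a x z^2 + b z^3]. *)
Definition weier (a b : K) : {mpoly K[3]} := pol3 (-1) 0 0 0 0 (- a) 0 1 0 (- b).

(** The square is completed in the first coordinate (by u and v) and the cube in the second (by m).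
    The third coordinate is only multiplied by t, so adding a multiple of its cube just shifts b:
    the same matrix serves for all h, and hence for both cubics of a torus sextic. *)
Lemma flex_to_weier (c2 c4 c5 c6 c7 c8 c9 t : K) : c2 != 0 -> c6 != 0 -> t != 0 ->
  exists N a b, N \in unitmx /\
    forall h, subst N (weier a (b - h)) =
      (t ^+ 3)%:MP * (pol3 0 0 c2 0 c4 c5 c6 c7 c8 c9 + h%:MP * 'X_i2 ^+ 3).
Proof.
move=> nz2 nz6 nzt.
pose s := sqrtC c2; have s2 : c2 = s ^+ 2 by rewrite sqrtCK.
have nzs : s != 0 by rewrite sqrtC_eq0.
pose r := 3.-root (- c6); have r3 : c6 = - r ^+ 3 by rewrite rootCK // opprK.
have nzr : r != 0 by rewrite rootC_eq0 // oppr_eq0.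
have n2 : (2%:R : K) != 0 by rewrite pnatr_eq0.
have n3 : (3%:R : K) != 0 by rewrite pnatr_eq0.
pose u := c4 / (2%:R * c2); pose v := c5 / (2%:R * c2).
have nz22 : 2%:R * c2 != 0 by rewrite mulf_neq0.
have e4 : c4 = 2%:R * s ^+ 2 * u by rewrite -s2 mulrC divfK.
have e5 : c5 = 2%:R * s ^+ 2 * v by rewrite -s2 mulrC divfK.
pose m := (c7 - s ^+ 2 * u ^+ 2) / (- (3%:R * r ^+ 3)).
have nz3r : - (3%:R * r ^+ 3) != 0 by rewrite oppr_eq0 mulf_neq0 // expf_neq0.
have e7 : c7 = s ^+ 2 * u ^+ 2 - 3%:R * r ^+ 3 * m.
  have : m * (- (3%:R * r ^+ 3)) = c7 - s ^+ 2 * u ^+ 2 by rewrite divfK.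
  by move=> e; rewrite -[LHS](subrK (s ^+ 2 * u ^+ 2)) -e; ring.
pose a := - (c8 - 2%:R * s ^+ 2 * u * v + 3%:R * r ^+ 3 * m ^+ 2) / r.
have e8 : c8 = 2%:R * s ^+ 2 * u * v - 3%:R * r ^+ 3 * m ^+ 2 - a * r.
  by rewrite /a divfK //; ring.
pose b := s ^+ 2 * v ^+ 2 - r ^+ 3 * m ^+ 3 - a * r * m - c9.
have e9 : c9 = s ^+ 2 * v ^+ 2 - r ^+ 3 * m ^+ 3 - a * r * m - b by rewrite /b; ring.
clearbody b a m v u r s.
exists (mat3 (vec3 0 (t * s) 0) (vec3 (t * r) (t * s * u) 0) (vec3 (t * r * m) (t * s * v) t)), a, b.
split.
  have [] := mulmx1_unit (A := mat3 (vec3 0 (t * s) 0) (vec3 (t * r) (t * s * u) 0) (vec3 (t * r * m) (t * s * v) t))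
    (B := mat3 (vec3 (- u / r / t) (1 / r / t) 0) (vec3 (1 / s / t) 0 0) (vec3 ((u * m - v) / t) (- m / t) (1 / t))) _; last by [].
  apply/matrixP => i j; rewrite !mxE sum3 !mxE; move: i j.
  by apply: ord3P; apply: ord3P; rewrite /vec3 /=; field; rewrite ?nzs ?nzr ?nzt.
move=> h; rewrite subst_mat3 /weier mmap_pol3 /vec3 /pol3 /cf3 /=.
rewrite s2 r3 e4 e5 e7 e8 e9 !exprS !expr0 !mulr1.
rewrite !(mpolyCN, mpolyCB, mpolyCD, mpolyCM, mpolyC_nat, mpolyC0, mpolyC1).
move: 'X_i0 'X_i1 'X_i2 => X Y Z.
move: (t%:MP) (s%:MP) (r%:MP) (u%:MP) (v%:MP) (m%:MP) (a%:MP) (b%:MP) (h%:MP) => t' s' r' u' v' m' a' b' h'.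
by ring.
Qed.

(** Here p^3 is p5^3 times a sixth power, so with n^2 = - p5^3 the sum p^3 + q^2 is a difference of
    squares whose factors are q plus and minus n times the cube of the third coordinate. Each factor
    contributes t^3, whence a sixth root of c. *)
Lemma flex_torus_weier (p5 q2 q4 q5 q6 q7 q8 q9 c : K) : p5 != 0 -> q2 != 0 -> q6 != 0 -> c != 0 ->
  exists N a b1 b2, [/\ N \in unitmx, b1 != b2 & subst N (weier a b1 * weier a b2)
     = c%:MP * (pol2 0 0 0 0 0 p5 ^+ 3 + pol3 0 0 q2 0 q4 q5 q6 q7 q8 q9 ^+ 2)].
Proof.
move=> nz5 nz2 nz6 nzc.
pose t := 6.-root c; have t6 : t ^+ 6 = c by rewrite rootCK.
have nzt : t != 0 by rewrite rootC_eq0.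
have [N [a [b [uN eN]]]] := flex_to_weier q4 q5 q7 q8 q9 nz2 nz6 nzt.
pose n := sqrtC (- p5 ^+ 3); have n2 : n ^+ 2 = - p5 ^+ 3 by rewrite sqrtCK.
have nzn : n != 0 by rewrite sqrtC_eq0 oppr_eq0 expf_neq0.
exists N, a, (b - n), (b - - n); split=> //.
  rewrite -subr_eq0 [X in X != 0](_ : _ = - (2%:R * n)); last by ring.
  by rewrite oppr_eq0 mulf_neq0 // pnatr_eq0.
rewrite (rmorphM (subst N)) /= !eN -t6.
move: (pol3 _ _ _ _ _ _ _ _ _ _) => Q.
have : n%:MP ^+ 2 = - p5%:MP ^+ 3 :> {mpoly K[3]}.
  by rewrite -!(rmorphXn (@mpolyC 3 K)) /= n2 mpolyCN.
rewrite /pol2 /cf2 !mpolyC0 mpolyCN !(rmorphXn (@mpolyC 3 K)) /=.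
clearbody n t.
move: 'X_i0 'X_i1 'X_i2 (t%:MP) (n%:MP) (p5%:MP) => Z0 Z1 Z2 t' n' p' /eqP.
rewrite -subr_eq0 => /eqP en.
apply/eqP; rewrite -subr_eq0; apply/eqP.
by rewrite -[RHS](mulr0 (- t' ^+ 6 * Z2 ^+ 6)) -[X in _ = _ * X]en; ring.
Qed.

Lemma arc17Z (k : K) F W : k != 0 -> arc17 (k%:MP * F) W -> arc17 F W.
Proof.
move=> nzk; have ev G V : evp (k%:MP * G) V = k *: evp G V.
  by rewrite evpM /evp mmapC mul_polyC.
have dv n u : ('X^n %| k *: u) = ('X^n %| u) by apply: dvdpZr.
case; rewrite !ev !dv => d18 n19 dg [v]; rewrite ev dv => dd.
split=> //; last by exists v.
by move=> i; have := dg i; rewrite mderiv_mulC ev dv.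
Qed.

End Weierstrass.

(** * Torus structure and normal form of a sextic with an A 17 point *)

Section TorusA17.
Variable R : realType.
Local Notation C := R[i].
Implicit Types (f p q : {mpoly C[3]}) (P X : 'rV[C]_3).

Lemma subst_torus (M : 'M[C]_3) (c : C) p q :
  subst M (c *: (p ^+ 3 + q ^+ 2)) = c%:MP * (subst M p ^+ 3 + subst M q ^+ 2).
Proof.
rewrite -mul_mpolyC (rmorphM (subst M)) (rmorphD (subst M)) !(rmorphXn (subst M)) /=.
by rewrite [subst M c%:MP]comp_mpolyC.
Qed.

Lemma torus_A17 f p q P : sextic f -> reducible f -> torus_structure f p q ->
  has_singularity_type f P (A 17) ->
  exists M, [/\ M \in unitmx, row 0 M = P & exists p5 q2 q4 q5 q6 q7 q8 q9 : C,
    [/\ p5 != 0 /\ q2 != 0, q6 != 0, subst M p = pol2 0 0 0 0 0 p5 &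
        subst M q = pol3 0 0 q2 0 q4 q5 q6 q7 q8 q9]].
Proof.
move=> [nzf hf] [d [e [g [h [[d0 e0] hg hh fgh]]]]] [hp hq [c nzc ef]] sP.
have [M [y [uM eM arc]]] := A17_arc hf sP.
exists M; split=> //.
have efM : subst M f = c%:MP * (subst M p ^+ 3 + subst M q ^+ 2).
  by rewrite ef subst_torus.
rewrite efM in arc; have {}arc := arc17Z nzc arc.
have de : (d + e = 6)%N.
  by apply: (dhomog_uniq nzf) hf; rewrite fgh; apply: dhomogM.
apply: (torus_classify (subst_homog M hp) (subst_homog M hq) (subst_homog M hg) (subst_homog M hh) de d0 e0 nzc _ arc).
by rewrite -efM fgh (rmorphM (subst M)).
Qed.

(** In the coordinates of [torus_A17], p vanishes only on the tangent line, where q reduces to q6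
    times the cube of the second coordinate; so the conic and the cubic meet at P only. *)
Lemma inner_A17 f p q P : sextic f -> reducible f -> torus_structure f p q ->
  has_singularity_type f P (A 17) ->
  forall X, X != 0 -> (inner p q X <-> same_point X P).
Proof.
move=> sf rf tf sP.
have [M [uM eM [p5 [q2 [q4 [q5 [q6 [q7 [q8 [q9 [[nz5 nz2] nz6 ep eq]]]]]]]]]]] := torus_A17 sf rf tf sP.
have innerE Y : inner p q (Y *m M) <-> Y 0 i1 = 0 /\ Y 0 i2 = 0.
  rewrite -inner_subst ep eq /inner /on_curve /meval mmap_pol2 mmap_pol3 /cf2 /cf3 /=.
  split=> [[]|[-> ->]]; last first.
    by split; ring.
  rewrite !mul0r !add0r => /eqP; rewrite mulf_eq0 (negPf nz5) expf_eq0 /= => /eqP ->.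
  rewrite !(mulr0, expr0n, add0r, addr0) /= => /eqP.
  by rewrite ?(mulr0, addr0) mulf_eq0 (negPf nz6) expf_eq0 /= => /eqP ->.
have rowP0 (a : C) : a *: P = (a *: delta_mx 0 i0) *m M.
  by rewrite -scalemxAl -eM -i0E rowE.
move=> X nzX; rewrite -(mulmxKV uM X) innerE; split=> [[y1 y2]|[a nza eX]].
  exists ((X *m invmx M) 0 i0); last first.
    rewrite rowP0; congr (_ *m M); move: (X *m invmx M) y1 y2 => Y y1 y2.
    apply/rowP => j; rewrite !mxE eqxx /=; move: j.
    by apply: ord3P; rewrite /= ?mulr1 ?mulr0.
  apply: contra_neq nzX => y0; rewrite -(mulmxKV uM X).
  suff -> : X *m invmx M = 0 by rewrite mul0mx.
  apply/rowP => j; rewrite [RHS]mxE; move: j; exact: ord3P.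
have -> : X *m invmx M = a *: delta_mx 0 i0.
  by rewrite -[LHS](mulmxK uM) eX rowP0 mulmxK.
by rewrite !mxE /= !mulr0.
Qed.

Lemma weier_normal_form f P : sextic f -> reducible f -> torus_type f ->
  has_singularity_type f P (A 17) ->
  exists N a b1 b2, [/\ N \in unitmx, b1 != b2 & f = subst N (weier a b1 * weier a b2)].
Proof.
move=> sf rf [p [q tf]] sP.
have [M [uM eM [p5 [q2 [q4 [q5 [q6 [q7 [q8 [q9 [[nz5 nz2] nz6 ep eq]]]]]]]]]]] := torus_A17 sf rf tf sP.
have [_ _ [c nzc ef]] := tf.
have [N [a [b1 [b2 [uN nb eN]]]]] := flex_torus_weier q4 q5 q7 q8 q9 nz5 nz2 nz6 nzc.
exists (invmx M *m N), a, b1, b2; split=> //.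
  by rewrite unitmx_mul uN unitmx_inv uM.
suff e : subst M f = subst N (weier a b1 * weier a b2) by rewrite -substM -e substVK.
by rewrite ef subst_torus ep eq; exact: esym eN.
Qed.

End TorusA17.

(** * Singularities of the normal form *)

Section Convergence.
Local Open Scope complex_scope.
Variable R : realType.
Local Notation C := R[i].
Implicit Types (a b : series C).

Lemma normc_ge0 (z : C) : 0 <= Normc.normc z.
Proof. by case: z => x y; apply: sqrtr_ge0. Qed.

Lemma convergentP a : convergent a <->
  exists M r : R, [/\ 0 <= M, 0 <= r & forall i j, Normc.normc (a i j) <= M * r ^+ (i + j)].
Proof.
have eN (z : C) (y : R) : (`|z| <= y%:C) = (Normc.normc z <= y).
  by rewrite -lecR.
split=> -[M [r]]; last by case=> _ _ le; exists M, r => i j; rewrite eN.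
move=> le; exists `|M|, `|r|; split=> // i j.
have := le i j; rewrite eN => /le_trans; apply.
by rewrite -normrX -normrM ler_norm.
Qed.

(** Each of the (i + 1)(j + 1) terms is at most M M' (r + r')^(i + j), and their number is at most
    2^(i + j); hence the ratio 2 (r + r'). *)
Lemma convergent_mul a b : convergent a -> convergent b -> convergent (series_mul a b).
Proof.
move=> /convergentP[M [r [M0 r0 le_a]]] /convergentP[M' [r' [M'0 r'0 le_b]]].
apply/convergentP; exists (M * M'), (2%:R * (r + r')); split=> [||i j].
- exact: mulr_ge0.
- by rewrite mulr_ge0 ?addr_ge0.
have tri I (s : seq I) (F : I -> C) :
    Normc.normc (\sum_(k <- s) F k) <= \sum_(k <- s) Normc.normc (F k).
  apply: (big_ind2 (fun (x : C) (y : R) => Normc.normc x <= y)) => [|x y x' y' le le'|//].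
    by rewrite Normc.normc0.
  by apply: (le_trans (le_normcD _ _)); apply: lerD.
have term k l : (k <= i)%N -> (l <= j)%N ->
    Normc.normc (a k l * b (i - k)%N (j - l)%N) <= M * M' * (r + r') ^+ (i + j).
  move=> ki lj; rewrite Normc.normcM.
  have -> : M * M' * (r + r') ^+ (i + j) = (M * (r + r') ^+ (k + l)) * (M' * (r + r') ^+ (i - k + (j - l))).
    by rewrite mulrACA -exprD; congr (_ * _ ^+ _); lia.
  apply: ler_pM; try exact: normc_ge0.
    apply: (le_trans (le_a _ _)); apply: ler_wpM2l => //; apply: lerXn2r; rewrite ?nnegrE ?addr_ge0 //.
    by rewrite lerDl.
  apply: (le_trans (le_b _ _)); apply: ler_wpM2l => //; apply: lerXn2r; rewrite ?nnegrE ?addr_ge0 //.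
  by rewrite lerDr.
apply: (@le_trans _ _ (\sum_(k < i.+1) \sum_(l < j.+1) M * M' * (r + r') ^+ (i + j))).
  rewrite /series_mul; apply: (le_trans (tri _ _ _)); apply: ler_sum => k _; apply: (le_trans (tri _ _ _)); apply: ler_sum => l _.
  by apply: term; rewrite -ltnS.
rewrite !sumr_const !card_ord -mulrnA -[X in X <= _]mulr_natr -[X in X <= _]mulrA; apply: ler_wpM2l; first exact: mulr_ge0.
rewrite exprMn mulrC; apply: ler_wpM2r; first by rewrite exprn_ge0 ?addr_ge0.
rewrite -natrX ler_nat mulnC expnD.
by apply: leq_mul; rewrite ltn_expl.
Qed.

Lemma convergent_poly (F : {mpoly C[2]}) : convergent (series_of_poly F).
Proof.
apply/convergentP; exists (\sum_(m <- msupp F) Normc.normc F@_m), 1; split=> // [|i j].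
  by apply: sumr_ge0 => m _; apply: normc_ge0.
rewrite expr1n mulr1 /series_of_poly; set m := (_ + _)%MM.
have [mF|/memN_msupp_eq0->] := boolP (m \in msupp F).
  rewrite (big_rem m) //= lerDl; apply: sumr_ge0 => k _; apply: normc_ge0.
rewrite Normc.normc0; apply: sumr_ge0 => k _; apply: normc_ge0.
Qed.

(** The binomial series of [sqrt (1 + c x)]. *)
Fixpoint sqrt_coef (c : C) n : C :=
  if n is k.+1 then c * (2%:R^-1 - k%:R) / k.+1%:R * sqrt_coef c k else 1.

Definition sqrt_series (c : C) : series C := fun i j => if j == 0%N then sqrt_coef c i else 0.

(** The recurrence says that the series S satisfies (1 + c x) S' = (c / 2) S. The coefficients t of
    S^2 then satisfy (m + 1) t_(m+1) = c (1 - m) t_m, which vanishes from m = 1 on. *)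
Lemma sqrt_coef_sq c n : \sum_(k < n.+1) sqrt_coef c k * sqrt_coef c (n - k) =
  (n == 0%N)%:R + c * (n == 1%N)%:R.
Proof.
pose s := sqrt_coef c; pose t n := \sum_(k < n.+1) s k * s (n - k)%N.
have sS k : k.+1%:R * s k.+1 = c * (2%:R^-1 - k%:R) * s k.
  by rewrite /s /= mulrA [_%:R * _]mulrC divfK // pnatr_eq0.
pose q n := \sum_(k < n.+1) k%:R * s k * s (n - k)%N.
(* The symmetry between k and m - k: the weights of a term and of its mirror image add up to m. *)
have qE m : m%:R * t m = 2%:R * q m.
  have eq' : q m = \sum_(k < m.+1) (m - k)%:R * s k * s (m - k)%N.
    rewrite /q (reindex_inj rev_ord_inj) /=; apply: eq_bigr => k _.
    by rewrite subSS subKn ?leq_ord //; ring.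
  rewrite mulrDl mul1r {2}eq' /q /t mulr_sumr -big_split /=; apply: eq_bigr => k _.
  by rewrite -!mulrA -mulrDl -natrD subnKC // -ltnS.
have tS m : m.+1%:R * t m.+1 = c * (1 - m%:R) * t m.
  rewrite qE /q big_ord_recl /= mul0r mul0r add0r.
  have -> : \sum_(k < m.+1) (bump 0 k)%:R * s (bump 0 k) * s (m.+1 - bump 0 k)%N
      = c * (2%:R^-1 * t m - q m).
    rewrite /t /q mulr_sumr -sumrB mulr_sumr; apply: eq_bigr => k _.
    by rewrite /bump /= add1n subSS sS; ring.
  have n2 : (2%:R : C) != 0 by rewrite pnatr_eq0.
  rewrite mulrCA mulrBr mulrA mulfV // mul1r -qE; ring.
have t0 : t 0%N = 1 by rewrite /t big_ord_recl big_ord0 /s /= mulr1 addr0.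
have t1 : t 1%N = c by have := tS 0%N; rewrite t0 subr0 !mulr1 mul1r.
have t2 m : t m.+2 = 0.
  elim: m => [|m IH].
    have := tS 1%N; rewrite subrr mulr0 mul0r => /eqP.
    by rewrite mulf_eq0 pnatr_eq0 => /eqP.
  have := tS m.+2; rewrite IH mulr0 => /eqP.
  by rewrite mulf_eq0 pnatr_eq0 => /eqP.
change (t n = (n == 0%N)%:R + c * (n == 1%N)%:R).
by case: n => [|[|n]]; rewrite ?t0 ?t1 ?t2 /= ?mulr0 ?mulr1 ?addr0 ?add0r.
Qed.

Lemma sqrt_series_sq c i j : series_mul (sqrt_series c) (sqrt_series c) i j =
  series_of_poly (1 + c%:MP * 'X_0 : {mpoly C[2]}) i j.
Proof.
rewrite /series_mul /sqrt_series.
have -> : series_of_poly (1 + c%:MP * 'X_0 : {mpoly C[2]}) i j = (j == 0%N)%:R * ((i == 0%N)%:R + c * (i == 1%N)%:R).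
  rewrite /series_of_poly mcoeffD mcoeff1 mcoeffCM mcoeffX -/(mon2 i j).
  have -> : (mon2 i j == 0%MM) = (i == 0%N) && (j == 0%N).
    apply/eqP/andP => [e|[/eqP -> /eqP ->]]; last by apply/mnmP; apply: ord2P; rewrite mon2E mnm0E.
    by have := congr1 (fun m : 'X_{1..2} => (m 0, m 1)) e; rewrite !mon2E !mnm0E => -[-> ->].
  have -> : (U_(0%R)%MM == mon2 i j) = (i == 1%N) && (j == 0%N).
    apply/eqP/andP => [e|[/eqP -> /eqP ->]]; last by apply/mnmP; apply: ord2P; rewrite mon2E mnm1E.
    by have := congr1 (fun m : 'X_{1..2} => (m 0, m 1)) e; rewrite !mon2E !mnm1E => -[<- <-].
  by case: (i == 0%N); case: (j == 0%N); case: (i == 1%N); rewrite /= ?mulr0 ?mul0r ?mul1r ?mulr1 ?addr0 ?add0r.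
have [->|nzj] := eqVneq j 0%N.
  rewrite mul1r -sqrt_coef_sq; apply: eq_bigr => k _.
  by rewrite big_ord_recl big_ord0 /= addr0.
rewrite mul0r big1 // => k _; rewrite big1 // => l _.
have [l0|_] := eqVneq (l : nat) 0%N; last by rewrite mul0r.
by rewrite l0 subn0 (negPf nzj) mulr0.
Qed.

(** Consecutive coefficients have ratio at most |c|, since |1/2 - k| <= k + 1. *)
Lemma convergent_sqrt c : convergent (sqrt_series c).
Proof.
apply/convergentP; exists 1, (Normc.normc c); split=> // [|i j]; first exact: normc_ge0.
rewrite mul1r /sqrt_series; case: eqP => [->|_]; last by rewrite Normc.normc0 exprn_ge0 ?normc_ge0.
rewrite addn0; elim: i => [|i IH]; first by rewrite expr0 [sqrt_coef c 0]/(1) Normc.normc1.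
rewrite /= exprS !Normc.normcM -!mulrA; apply: ler_pM => //; rewrite ?mulr_ge0 ?normc_ge0 //.
rewrite mulrA -[leRHS]mul1r; apply: ler_pM; rewrite ?mulr_ge0 ?normc_ge0 // -Normc.normcM.
suff : `|(2%:R^-1 - i%:R) / i.+1%:R : C| <= 1%:C by rewrite -lecR.
rewrite normrM normfV normr_nat.
rewrite ler_pdivrMr ?ltr0n // mul1r.
apply: (le_trans (ler_normB _ _)); rewrite !normr_nat normfV normr_nat.
have -> : i.+1%:R = i%:R + 1 :> C by rewrite natr1.
by rewrite [X in X <= _]addrC lerD2l invf_le1 ?ler1n.
Qed.

End Convergence.

(** * Local equations of the Weierstrass cubics and their jets *)

Section NormalFormLocal.
Variable K : numClosedFieldType.
Implicit Types (F G : {mpoly K[2]}).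

Lemma weierE (A : comNzRingType) (f : {rmorphism K -> A}) v (a b : K) :
  mmap f v (weier a b) = v i1 ^+ 2 * v i2 - v i0 ^+ 3 - f a * (v i0 * v i2 ^+ 2) - f b * v i2 ^+ 3.
Proof. by rewrite mmap_pol3 /cf3 !rmorphN !rmorph0 !rmorph1; ring. Qed.

Lemma weier_homog (a b : K) : weier a b \is 3.-homog.
Proof.
have hX (i : 'I_3) n : 'X_i ^+ n \is [in K[3], n.-homog].
  by rewrite -[X in X.-homog]mul1n; apply: dhomogMn; rewrite dhomogX /= mdeg1.
have hX1 (i : 'I_3) : 'X_i \is [in K[3], 1.-homog] by rewrite dhomogX /= mdeg1.
have h21 (p q : {mpoly K[3]}) : p \is 2.-homog -> q \is 1.-homog -> p * q \is 3.-homog by exact: dhomogM.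
have h12 (p q : {mpoly K[3]}) : p \is 1.-homog -> q \is 2.-homog -> p * q \is 3.-homog by exact: dhomogM.
have h11 (p q : {mpoly K[3]}) : p \is 1.-homog -> q \is 1.-homog -> p * q \is 2.-homog by exact: dhomogM.
rewrite /weier /pol3 /cf3 !mul_mpolyC.
by repeat (apply: rpredD); apply: rpredZ; first
  [exact: hX | apply: h21; [exact: hX | exact: hX1] | apply: h12; [exact: hX1 | exact: hX]
  | apply: h21; [apply: h11; exact: hX1 | exact: hX1]].
Qed.

Lemma dehomog_mat3 r0 r1 r2 (F : {mpoly K[3]}) : dehomog (subst (mat3 r0 r1 r2) F) =
  mmap (@mpolyC 2 K) (fun j => (r0 j)%:MP + (r1 j)%:MP * 'X_0 + (r2 j)%:MP * 'X_1) F.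
Proof.
rewrite /dehomog mmap_subst; apply: eq_mmap => j.
by rewrite sum3 !mxE /vec3 /= mulr1.
Qed.

Lemma series_of_polyXE F n : series_of_poly (F ^+ n) =2 series_exp (series_of_poly F) n.
Proof.
by move=> i j; apply: (@series_of_polyX _ F n (maxn i j).+1); rewrite ltnS ?leq_maxl ?leq_maxr.
Qed.

Lemma series_normal_form (E g U V : {mpoly K[2]}) n : E * g = U ^+ 2 + V ^+ n ->
  series_mul (series_of_poly E) (series_of_poly g) =2
  series_add (series_exp (series_of_poly U) 2) (series_exp (series_of_poly V) n).
Proof.
by move=> e i j; rewrite -series_of_polyM e series_of_polyD /series_add !series_of_polyXE.
Qed.

Notation s00 F := (series_of_poly F 0%N 0%N).
Notation s10 F := (series_of_poly F 1%N 0%N).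
Notation s01 F := (series_of_poly F 0%N 1%N).

Lemma jet2 (a b : series K) : (series_mul a b 0 0 = a 0 0 * b 0 0) *
  (series_mul a b 1 0 = a 0 0 * b 1 0 + a 1 0 * b 0 0) *
  (series_mul a b 0 1 = a 0 0 * b 0 1 + a 0 1 * b 0 0) *
  (series_mul a b 2 0 = a 0 0 * b 2 0 + a 1 0 * b 1 0 + a 2 0 * b 0 0) *
  (series_mul a b 0 2 = a 0 0 * b 0 2 + a 0 1 * b 0 1 + a 0 2 * b 0 0) *
  (series_mul a b 1 1 = a 0 0 * b 1 1 + a 0 1 * b 1 0 + a 1 0 * b 0 1 + a 1 1 * b 0 0).
Proof.
by rewrite /series_mul; do !split; rewrite !big_ord_recl !big_ord0 ?addr0 //=; ring.
Qed.

Lemma jetM F G : (s00 (F * G) = s00 F * s00 G) *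
  (s10 (F * G) = s00 F * s10 G + s10 F * s00 G) * (s01 (F * G) = s00 F * s01 G + s01 F * s00 G).
Proof. by rewrite !(series_of_polyM F G) !jet2. Qed.

Lemma jetD F G i j : series_of_poly (F + G) i j = series_of_poly F i j + series_of_poly G i j.
Proof. exact: series_of_polyD. Qed.

Lemma jetN F i j : series_of_poly (- F) i j = - series_of_poly F i j.
Proof. by rewrite /series_of_poly mcoeffN. Qed.

Lemma jetC (c : K) : (s00 (c%:MP : {mpoly K[2]}) = c) * (s10 (c%:MP : {mpoly K[2]}) = 0) * (s01 (c%:MP : {mpoly K[2]}) = 0).
Proof.
split; first split.
- by rewrite -(@ev2_at0 _ 0 0) ?horner0 // /ev2 mmapC hornerC.
- by rewrite -[LHS]mulr1n -series_of_mderiv0 mderivC /series_of_poly mcoeff0.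
- by rewrite -[LHS]mulr1n -series_of_mderiv1 mderivC /series_of_poly mcoeff0.
Qed.

Lemma jet1 : (s00 (1 : {mpoly K[2]}) = 1) * (s10 (1 : {mpoly K[2]}) = 0) * (s01 (1 : {mpoly K[2]}) = 0).
Proof. by rewrite -mpolyC1 !jetC. Qed.

Lemma jetX : (s00 ('X_0 : {mpoly K[2]}) = 0) * (s10 ('X_0 : {mpoly K[2]}) = 1) * (s01 ('X_0 : {mpoly K[2]}) = 0) *
  (s00 ('X_1 : {mpoly K[2]}) = 0) * (s10 ('X_1 : {mpoly K[2]}) = 0) * (s01 ('X_1 : {mpoly K[2]}) = 1).
Proof.
have d0 F : s10 F = s00 F^`M(0) by rewrite series_of_mderiv0.
have d1 F : s01 F = s00 F^`M(1) by rewrite series_of_mderiv1.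
have x0 i : s00 ('X_i : {mpoly K[2]}) = 0.
  by rewrite -(@ev2_at0 _ 0 0) ?horner0 // /ev2 mmapXU; move: i; apply: ord2P; rewrite /vec2 /= horner0.
by do !split; rewrite ?x0 // ?d0 ?d1 mderivXU jetC.
Qed.

Definition jetE := (jetD, jetN, jetM, jetC, jet1, jetX).

(** With [om z = F0 + x^3] one has [(om z)^3 = F0 G + x^9], so that
    [om^6 - d^2 G^2] times [F0^2 - d^2 z^6] is [u^2 - d^2 x^18]. *)
Lemma A17_local (a b d k : K) : k ^+ 18 = - d ^+ 2 -> d != 0 ->
  let g := dehomog (subst (mat3 (vec3 0 1 0) (vec3 1 0 0) (vec3 0 0 1)) (weier a (b + d) * weier a (b - d))) in
  exists E U : {mpoly K[2]}, let V := k%:MP * 'X_0 in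
  [/\ E * g = U ^+ 2 + V ^+ 18, s00 E != 0, s00 U = 0 /\ s00 V = 0 &
      s10 U * s01 V - s01 U * s10 V != 0].
Proof.
move=> k18 nzd g.
have nzk : k != 0.
  by apply: contraNneq nzd => k0; rewrite -sqrf_eq0 -oppr_eq0 -k18 k0 expr0n.
pose x : {mpoly K[2]} := 'X_0; pose z : {mpoly K[2]} := 'X_1.
pose F0 := z - x * x * x - a%:MP * (x * (z * z)) - b%:MP * (z * z * z).
pose om := 1 - a%:MP * (x * z) - b%:MP * (z * z).
pose G := F0 * F0 + 3%:R%:MP * (F0 * (x * x * x)) + 3%:R%:MP * (x * x * x * (x * x * x)).
pose d2 : {mpoly K[2]} := (d * d)%:MP.
have jz3 : (s00 (z * z * z) = 0) * (s10 (z * z * z) = 0) * (s01 (z * z * z) = 0).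
  by rewrite /z; split; rewrite !jetE; do ?split; ring.
have jx3 : (s00 (x * x * x) = 0) * (s10 (x * x * x) = 0) * (s01 (x * x * x) = 0).
  by rewrite /x; split; rewrite !jetE; do ?split; ring.
have jF : (s00 F0 = 0) * (s10 F0 = 0) * (s01 F0 = 1).
  by rewrite /F0 !(jz3, jx3, jetE); do !split; ring.
have jom3 : (s00 (om * om * om) = 1) * (s10 (om * om * om) = 0) * (s01 (om * om * om) = 0).
  have jom : (s00 om = 1) * (s10 om = 0) * (s01 om = 0) by rewrite /om /x /z !jetE; do !split; ring.
  by rewrite !(jom, jetM); do !split; ring.
have jG : (s00 G = 0) * (s10 G = 0) * (s01 G = 0).
  by rewrite /G !(jx3, jF, jetE); do !split; ring.
have jE := (jz3, jom3, jF, jG, jetE).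
exists (om * om * om * (om * om * om) - d2 * (G * G)), (om * om * om * F0 - d2 * (G * (z * z * z))) => V.
have eg : g = F0 * F0 - d2 * (z * z * z * (z * z * z)).
  rewrite /g dehomog_mat3 (rmorphM (mmap _ _)) /= !weierE /vec3 /= /F0 /d2.
  rewrite !(mpolyC0, mpolyC1, mpolyCD, mpolyCN, mpolyCM) /x /z.
  by move: 'X_0 'X_1 (a%:MP) (b%:MP) (d%:MP) => X Z a' b' d'; ring.
split.
- rewrite eg /V exprMn -(rmorphXn (@mpolyC 2 K)) /= k18 /d2 /G /om /F0 /x /z.
  rewrite !exprS !expr0 !mulr1 !(mpolyCN, mpolyCM, mpolyC_nat).
  by move: 'X_0 'X_1 (a%:MP) (b%:MP) (d%:MP) => X Z a' b' d'; ring.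
- by rewrite /V !jE !(mul0r, mulr0, subr0, addr0, mulr1, oppr0) oner_neq0.
- by rewrite /V !jE !(mul0r, mulr0, subr0, addr0, mulr1, oppr0).
- rewrite /V !jE !(mul0r, mulr0, subr0, addr0, add0r, mulr1, mul1r, oppr0, sub0r).
  by rewrite oppr_eq0.
Qed.

Lemma weier_node_local (r b : K) A : dehomog (subst (mat3 (vec3 r 0 1) (vec3 1 0 0) (vec3 0 1 0)) (weier (- (3%:R * r ^+ 2)) b * A))
  = ('X_1 ^+ 2 - 'X_0 ^+ 3 - (3%:R * r)%:MP * 'X_0 ^+ 2 + (2%:R * r ^+ 3 - b)%:MP)
    * dehomog (subst (mat3 (vec3 r 0 1) (vec3 1 0 0) (vec3 0 1 0)) A).
Proof.
rewrite [in LHS]/dehomog (rmorphM (subst _)) (rmorphM (mmap _ _)) /=; congr (_ * _).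
rewrite -/(dehomog _) dehomog_mat3 weierE /vec3 /=.
rewrite !exprS !expr0 !mulr1 !(mpolyC0, mpolyC1, mpolyCB, mpolyCN, mpolyCM, mpolyC_nat).
by move: 'X_0 'X_1 (r%:MP) (b%:MP) => X Z r' b'; ring.
Qed.

End NormalFormLocal.

Section WeierstrassPoints.
Variable K : numClosedFieldType.

Definition row3 (x y z : K) : 'rV[K]_3 := \row_j vec3 x y z j.

Lemma meval_row3 x y z F : F.@[(row3 x y z) 0] = F.@[vec3 x y z].
Proof. by apply: meval_eq => j; rewrite mxE. Qed.

Lemma meval_weier v (a b : K) : (weier a b).@[v] =
  v i1 ^+ 2 * v i2 - v i0 ^+ 3 - a * (v i0 * v i2 ^+ 2) - b * v i2 ^+ 3.
Proof. exact: weierE. Qed.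

Lemma meval_weier_deriv0 v (a b : K) :
  (weier a b)^`M(i0).@[v] = - 3%:R * v i0 ^+ 2 - a * v i2 ^+ 2.
Proof. by rewrite /weier mderiv_pol3 /meval mmap_pol2 /cf2 /=; ring. Qed.

Lemma meval_weier_deriv1 v (a b : K) : (weier a b)^`M(i1).@[v] = 2%:R * v i1 * v i2.
Proof. by rewrite /weier mderiv_pol3 /meval mmap_pol2 /cf2 /=; ring. Qed.

Lemma meval_weier_deriv2 v (a b : K) :
  (weier a b)^`M(i2).@[v] = v i1 ^+ 2 - 2%:R * a * v i0 * v i2 - 3%:R * b * v i2 ^+ 2.
Proof. by rewrite /weier mderiv_pol3 /meval mmap_pol2 /cf2 /=; ring. Qed.

Definition meval_weierE := (meval_weier, meval_weier_deriv0, meval_weier_deriv1, meval_weier_deriv2).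

Lemma row3_neq0 x y z : [|| x != 0, y != 0 | z != 0] -> row3 x y z != 0.
Proof.
apply: contraTneq => e; have e' j : row3 x y z 0 j = 0 by rewrite e mxE.
by have := e' i0; have := e' i1; have := e' i2; rewrite !mxE /vec3 /= => -> -> ->; rewrite eqxx.
Qed.

Lemma row_mat3 (r1 r2 : 'I_3 -> K) x y z : row 0 (mat3 (vec3 x y z) r1 r2) = row3 x y z.
Proof. by apply/rowP => j; rewrite !mxE i0E. Qed.

Definition node_frame (r : K) := mat3 (vec3 r 0 1) (vec3 1 0 0) (vec3 0 1 0).

Lemma node_frame_unit r : node_frame r \in unitmx.
Proof.
have [] := mulmx1_unit (A := node_frame r) (B := mat3 (vec3 0 1 0) (vec3 0 0 1) (vec3 1 (- r) 0)) _; last by [].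
apply/matrixP => i j; rewrite !mxE sum3 !mxE; move: i j.
by apply: ord3P; apply: ord3P; rewrite /vec3 /=; ring.
Qed.

Definition flex_frame : 'M[K]_3 := mat3 (vec3 0 1 0) (vec3 1 0 0) (vec3 0 0 1).

Lemma flex_frame_unit : flex_frame \in unitmx.
Proof.
have [] := mulmx1_unit (A := flex_frame) (B := flex_frame) _; last by [].
apply/matrixP => i j; rewrite !mxE sum3 !mxE; move: i j.
by apply: ord3P; apply: ord3P; rewrite /vec3 /=; ring.
Qed.

(** Here [h] is the local equation of the other cubic. Taking it as the unit e and also as a factor
    of both coordinates turns h times the local equation into a sum of squares without a square root
    of [h]. *)
Lemma node_jets (h : {mpoly K[2]}) k (a : series K) : let u := series_of_poly (h * 'X_1) in
  let v := series_mul (series_of_poly (k%:MP * (h * 'X_0))) a in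
  [/\ u 0%N 0%N = 0 /\ v 0%N 0%N = 0 &
   u 1%N 0%N * v 0%N 1%N - u 0%N 1%N * v 1%N 0%N =
     - k * series_of_poly h 0%N 0%N ^+ 2 * a 0%N 0%N].
Proof.
by move=> u v; rewrite /u /v !jet2 !jetE; split; [split; ring | ring].
Qed.

(** The exponents come from h^5 h (y^2 - x^3) = (h^3 y)^2 + (- h^2 x)^3. *)
Lemma cusp_jets (h : {mpoly K[2]}) :
  let u := series_of_poly (h * h * h * 'X_1) in let v := series_of_poly (- (h * h * 'X_0)) in
  let e := series_of_poly (h * h * h * h * h) in
  [/\ u 0%N 0%N = 0 /\ v 0%N 0%N = 0,
   u 1%N 0%N * v 0%N 1%N - u 0%N 1%N * v 1%N 0%N = series_of_poly h 0%N 0%N ^+ 5 &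
   e 0%N 0%N = series_of_poly h 0%N 0%N ^+ 5].
Proof.
by move=> u v e; rewrite /u /v /e !jetE; split; [split; ring | ring | ring].
Qed.

End WeierstrassPoints.

(** * The types A 17, A 1 and A 2 on products of Weierstrass cubics *)

Section Types.
Variable R : realType.
Local Notation C := R[i].
Implicit Types (f B : {mpoly C[3]}) (P : 'rV[C]_3).

Lemma singular_pointM (A B : {mpoly C[3]}) P : P != 0 -> on_curve A P -> on_curve B P ->
  singular_point (A * B) P.
Proof.
rewrite /singular_point /on_curve => nzP AP BP; split=> // [|i]; rewrite ?mderivM ?mevalD !mevalM AP BP; ring.
Qed.

Lemma singular_pointMl (A B : {mpoly C[3]}) P : singular_point A P -> singular_point (A * B) P.
Proof.
rewrite /singular_point /on_curve => -[nzP AP dA]; split=> // [|i].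
  by rewrite mevalM AP mul0r.
by rewrite mderivM mevalD !mevalM AP dA; ring.
Qed.

Lemma singular_pointMr (A B : {mpoly C[3]}) P : B.@[P 0] != 0 ->
  singular_point (A * B) P -> singular_point A P.
Proof.
rewrite /singular_point /on_curve => nzB [nzP AP dA].
have {}AP : A.@[P 0] = 0 by move/eqP: AP; rewrite mevalM mulf_eq0 (negPf nzB) orbF => /eqP.
split=> // i; have := dA i; rewrite mderivM mevalD !mevalM AP mul0r addr0 => /eqP.
by rewrite mulf_eq0 (negPf nzB) orbF => /eqP.
Qed.

Lemma weier_A17 (a b1 b2 : C) : b1 != b2 ->
  has_singularity_type (weier a b1 * weier a b2) (row3 0 1 0) (A 17).
Proof.
move=> nb; have n2 : (2%:R : C) != 0 by rewrite pnatr_eq0.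
pose d := (b1 - b2) / 2%:R; pose b := (b1 + b2) / 2%:R.
have nzd : d != 0 by rewrite mulf_neq0 ?subr_eq0 ?invr_eq0.
have e1 : b1 = b + d by rewrite /b /d; field.
have e2 : b2 = b - d by rewrite /b /d; field.
pose k := 18.-root (- d ^+ 2); have k18 : k ^+ 18 = - d ^+ 2 by rewrite rootCK.
have [E [U [eq nzE [u0 v0] jac]]] := A17_local a b k18 nzd.
split=> //.
  apply: singular_pointM; rewrite /on_curve ?meval_row3 ?meval_weierE /vec3 /=; try ring.
  by apply: row3_neq0; rewrite oner_neq0 orbT.
exists (flex_frame _),
  (series_of_poly U), (series_of_poly (k%:MP * 'X_0)), (series_of_poly E).
split.
- by split; [exact: flex_frame_unit | exact: row_mat3].
- by split; [split; exact: convergent_poly | split | ].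
- by split; [exact: convergent_poly | ].
- move=> i j; rewrite local_equation_dehomog e1 e2.
  exact: (series_normal_form eq).
Qed.

Lemma weier_singular (r : C) : singular_point (weier (- (3%:R * r ^+ 2)) (2%:R * r ^+ 3)) (row3 r 0 1).
Proof.
split; first by apply: row3_neq0; rewrite oner_neq0 !orbT.
  by rewrite /on_curve meval_row3 meval_weierE /vec3 /=; ring.
by apply: ord3P; rewrite meval_row3 meval_weierE /vec3 /=; ring.
Qed.

Lemma dehomog_at0 r B :
  series_of_poly (dehomog (subst (node_frame r) B)) 0 0 = B.@[(row3 r 0 1) 0].
Proof.
rewrite -(@ev2_at0 _ 0 0) ?horner0 // ev2_dehomog evp_at0 /meval mmap_subst; apply: eq_mmap => j.
by rewrite sum3 !mxE /vec3 /= hornerC horner0 !mulr0 mulr1 !addr0.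
Qed.

(** At its node the cubic is y^2 - 3 r x^2 - x^3, that is, y^2 + (k x)^2 (1 + c x) with k^2 = - 3 r
    and c = 1 / (3 r). The second coordinate therefore contains the square root of 1 + c x. *)
Lemma weier_node (r : C) B : r != 0 -> B.@[(row3 r 0 1) 0] != 0 ->
  has_singularity_type (weier (- (3%:R * r ^+ 2)) (2%:R * r ^+ 3) * B) (row3 r 0 1) (A 1).
Proof.
move=> nzr nzB; split=> //.
  exact: singular_pointMl (weier_singular r).
pose h := dehomog (subst (node_frame r) B).
have h0 : series_of_poly h 0 0 != 0 by rewrite dehomog_at0.
pose k := sqrtC (- (3%:R * r)); have k2 : k ^+ 2 = - (3%:R * r) by rewrite sqrtCK.
have nz3r : 3%:R * r != 0 by rewrite mulf_neq0 // pnatr_eq0.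
have nzk : k != 0 by rewrite sqrtC_eq0 oppr_eq0.
pose c := (3%:R * r)^-1.
pose V := k%:MP * (h * 'X_0) : {mpoly C[2]}.
exists (node_frame r), (series_of_poly (h * 'X_1)),
  (series_mul (series_of_poly V) (sqrt_series c)), (series_of_poly h).
have [uv0 jac] := node_jets h k (sqrt_series c).
split.
- by split; [exact: node_frame_unit | exact: row_mat3].
- split; [split | exact: uv0 |].
  + exact: convergent_poly.
  + by apply: convergent_mul; [exact: convergent_poly | exact: convergent_sqrt].
  + rewrite jac; apply: mulf_neq0; last exact: oner_neq0.
    by apply: mulf_neq0; [rewrite oppr_eq0 | exact: expf_neq0].
- by split; [exact: convergent_poly | exact: h0].
- have eg : h * dehomog (subst (node_frame r) (weier (- (3%:R * r ^+ 2)) (2%:R * r ^+ 3) * B))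
      = (h * 'X_1) ^+ 2 + V ^+ 2 * (1 + c%:MP * 'X_0).
    rewrite weier_node_local -/(node_frame r) -/h subrr mpolyC0 addr0.
    have -> : V ^+ 2 * (1 + c%:MP * 'X_0) = (- (3%:R * r)%:MP) * (h * 'X_0) ^+ 2 - (h * 'X_0) ^+ 2 * 'X_0.
      rewrite /V exprMn -(rmorphXn (@mpolyC 2 C)) /= k2 mpolyCN.
      have : (3%:R * r)%:MP * c%:MP = 1 :> {mpoly C[2]} by rewrite -mpolyCM mulfV.
      move: ((3%:R * r)%:MP) (c%:MP) => q s /eqP; rewrite -subr_eq0 => /eqP qs.
      apply/eqP; rewrite -subr_eq0; apply/eqP.
      by rewrite -[RHS](mulr0 (- (h * 'X_0) ^+ 2 * 'X_0)) -[X in _ = _ * X]qs; ring.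
    by clearbody h; move: 'X_0 'X_1 ((3%:R * r)%:MP) => X Y q; ring.
  move=> i j; rewrite local_equation_dehomog -series_of_polyM eg series_of_polyD /series_add.
  congr (_ + _); first by rewrite series_of_polyXE.
  (* The square root is not a polynomial, so each coefficient is compared after a truncation beyond
     its indices. *)
  pose N := (maxn i j).+1; pose T := trunc N (sqrt_series c).
  have lti : (i < N)%N by rewrite ltnS leq_maxl.
  have ltj : (j < N)%N by rewrite ltnS leq_maxr.
  have aT : agree N (series_of_poly T) (sqrt_series c) by exact: truncE.
  have aVT : agree N (series_of_poly (V * T)) (series_mul (series_of_poly V) (sqrt_series c)).
    by move=> k' l ltk ltl; rewrite series_of_polyM; apply: (agree_mul (N := N)).
  have -> : series_exp (series_mul (series_of_poly V) (sqrt_series c)) 2 i j = series_of_poly ((V * T) ^+ 2) i j.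
    by rewrite series_of_polyXE; symmetry; apply: (agree_exp (N := N)).
  rewrite [X in _ = series_of_poly X _ _](_ : _ = V ^+ 2 * T ^+ 2); last exact: exprMn.
  rewrite (series_of_polyM (V ^+ 2)) (series_of_polyM (V ^+ 2) (T ^+ 2)).
  apply: (agree_mul (N := N)) => // k' l ltk ltl.
  rewrite -sqrt_series_sq expr2 series_of_polyM; symmetry; exact: (agree_mul (N := N)).
Qed.

Lemma weier_cusp B : B.@[(row3 0 0 1) 0] != 0 ->
  has_singularity_type (weier 0 0 * B) (row3 0 0 1) (A 2).
Proof.
move=> nzB.
have e0 : weier 0 0 = weier (- (3%:R * 0 ^+ 2)) (2%:R * 0 ^+ 3) :> {mpoly C[3]}.
  by rewrite !expr0n /= !mulr0 oppr0.
split=> //.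
  by rewrite e0; apply: singular_pointMl (weier_singular 0).
pose h := dehomog (subst (node_frame 0) B).
have h0 : series_of_poly h 0 0 != 0 by rewrite dehomog_at0.
have [uv0 jac e00] := cusp_jets h.
exists (node_frame 0), (series_of_poly (h * h * h * 'X_1)),
  (series_of_poly (- (h * h * 'X_0))), (series_of_poly (h * h * h * h * h)).
split.
- by split; [exact: node_frame_unit | exact: row_mat3].
- split; [by split; exact: convergent_poly | exact: uv0 | rewrite jac; exact: expf_neq0].
- by split; [exact: convergent_poly | rewrite e00; exact: expf_neq0].
- move=> i j; rewrite local_equation_dehomog; apply: series_normal_form.
  rewrite e0 weier_node_local -/(node_frame 0) -/h subrr !mulr0 mpolyC0.
  by clearbody h; move: 'X_0 'X_1 => X Y; ring.
Qed.

End Types.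

(** * Nodes versus cusps *)

Section Hessian.
Variable K : numClosedFieldType.
Implicit Types (F : {mpoly K[3]}) (P : 'rV[K]_3) (N : 'M[K]_3) (a b e g u v : series K).

Definition hess F P : 'M[K]_3 := \matrix_(i, j) (F^`M(j)^`M(i)).@[P 0].

Lemma hess_subst N F P : hess (subst N F) P = N *m hess F (P *m N) *m N^T.
Proof.
have eD G i : ((subst N G)^`M(i)).@[P 0] = \sum_(k < 3) N i k * (G^`M(k)).@[(P *m N) 0].
  rewrite mderiv_subst rmorph_sum; apply: eq_bigr => k _.
  by rewrite rmorphM /= mevalC meval_subst.
apply/matrixP => i j; rewrite [LHS]mxE [RHS]mxE.
have -> : (subst N F)^`M(j) = subst N (\sum_(l < 3) (N j l)%:MP * F^`M(l)).
  rewrite mderiv_subst rmorph_sum; apply: eq_bigr => l _.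
  by rewrite rmorphM /= [subst N _%:MP]comp_mpolyC.
have eS k : ((\sum_(l < 3) (N j l)%:MP * F^`M(l))^`M(k)).@[(P *m N) 0] =
    \sum_(l < 3) N j l * hess F (P *m N) k l.
  rewrite (raddf_sum (mderiv k)) rmorph_sum; apply: eq_bigr => l _.
  by rewrite /= mderiv_mulC mevalM mevalC mxE.
rewrite eD; under eq_bigr => k _ do rewrite eS mulr_sumr.
rewrite exchange_big; apply: eq_bigr => l _; rewrite !mxE mulr_suml.
by apply: eq_bigr => k _; rewrite mulrCA mulrC.
Qed.

Lemma homog_substZ d F (c : K) : F \is d.-homog -> subst c%:M F = c ^+ d *: F.
Proof.
move=> hF; rewrite substE [in LHS]/mmap [in RHS](mpolyE F) scaler_sumr big_seq [RHS]big_seq.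
apply: eq_bigr => m mF; rewrite -(dhomog_mf hF mF) /= -!mul_mpolyC [RHS]mulrCA; congr (_ * _).
rewrite mdegE -prodrXr rmorph_prod [in RHS]mpolyXE_id -big_split /=; apply: eq_bigr => i _.
rewrite rmorphXn /= -exprMn; congr (_ ^+ _).
by move: i; apply: ord3P; rewrite !mxE /= ?mulr1n ?mulr0n !mpolyC0 ?mul0r ?addr0 ?add0r.
Qed.

Lemma hess_scale d F P (c : K) : c != 0 -> F \is d.-homog ->
  hess F (c *: P) = (c ^+ d / c ^+ 2) *: hess F P.
Proof.
move=> nzc hF; have := hess_subst c%:M F P.
rewrite (homog_substZ _ hF) tr_scalar_mx mul_scalar_mx mul_mx_scalar mul_mx_scalar scalerA => e.
have -> : (c ^+ d / c ^+ 2) *: hess F P = (c ^+ 2)^-1 *: hess (c ^+ d *: F) P.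
  by apply/matrixP => i j; rewrite !mxE !mderivZ mevalZ; ring.
by rewrite e scalerA -expr2 mulVf ?expf_neq0 // scale1r.
Qed.

Lemma series_mul1 a i j : series_mul a (series_one K) i j = a i j.
Proof.
rewrite /series_mul big_ord_recr big_ord_recr /= !subnn mulr1 !big1 ?add0r // => [k _|k _].
  by rewrite /series_one !subn_eq0 [(j <= _)%N]leqNgt ltn_ord andbF mulr0.
by rewrite big1 // => l _; rewrite /series_one subn_eq0 leqNgt ltn_ord mulr0.
Qed.

(** The factor w records that v^(n + 2) reaches the terms of degree two only for n = 0, that is, for
    a node. *)
Lemma A_jet2 n e g u v : e 0 0 != 0 -> u 0 0 = 0 -> v 0 0 = 0 ->
  series_mul e g =2 normal_form (A n.+1) u v ->
  let w := (n == 0%N)%:R : K in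
  [/\ e 0 0 * g 2 0 = u 1 0 ^+ 2 + w * v 1 0 ^+ 2,
      e 0 0 * g 0 2 = u 0 1 ^+ 2 + w * v 0 1 ^+ 2 &
      e 0 0 * g 1 1 = 2%:R * (u 1 0 * u 0 1) + 2%:R * w * (v 1 0 * v 0 1)].
Proof.
move=> nze u0 v0 eqn w.
have sq a : series_exp a 2 = series_mul a (series_mul a (series_one K)) by [].
have vn : forall i j, (i + j <= 2)%N -> series_exp v n.+2 i j = w * series_mul v v i j.
  rewrite /w; case: n {eqn w} => [|n] i j le2.
    by rewrite mul1r /series_exp /=; apply: eq_bigr => k _; apply: eq_bigr => l _; rewrite series_mul1.
  rewrite mul0r; have z a : series_mul v (series_mul v (series_mul v a)) i j = 0.
    by case: i j le2 => [|[|[|i]]] [|[|[|j]]] //= _; rewrite !jet2 !v0; ring.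
  exact: z.
have un i j : series_exp u 2 i j = series_mul u u i j.
  by apply: eq_bigr => k _; apply: eq_bigr => l _; rewrite series_mul1.
have eqn2 i j : (i + j <= 2)%N -> series_mul e g i j = series_mul u u i j + w * series_mul v v i j.
  by move=> le2; rewrite -un -(vn _ _ le2) eqn.
have := eqn2 0 0 isT; rewrite !jet2 u0 v0 !mulr0 addr0 => /eqP; rewrite mulf_eq0 (negPf nze) => /eqP g0.
have := eqn2 1 0 isT; rewrite !jet2 u0 v0 g0 !(mulr0, mul0r, addr0) => /eqP; rewrite mulf_eq0 (negPf nze) => /eqP g10.
have := eqn2 0 1 isT; rewrite !jet2 u0 v0 g0 !(mulr0, mul0r, addr0) => /eqP; rewrite mulf_eq0 (negPf nze) => /eqP g01.
split.
- by have := eqn2 2 0 isT; rewrite !jet2 u0 v0 g0 ?g10 ?g01 !(mulr0, mul0r, addr0, add0r) !expr2.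
- by have := eqn2 0 2 isT; rewrite !jet2 u0 v0 g0 ?g10 ?g01 !(mulr0, mul0r, addr0, add0r) !expr2.
- have := eqn2 1 1 isT; rewrite !jet2 u0 v0 g0 ?g10 ?g01 !(mulr0, mul0r, addr0, add0r) => ->; ring.
Qed.

Definition e0v : 'rV[K]_3 := delta_mx 0 i0.

Lemma e0v_row (M : 'M[K]_3) : e0v *m M = row 0 M.
Proof. by rewrite /e0v -i0E -rowE. Qed.

Lemma dehomog_at_e0 F : series_of_poly (dehomog F) 0 0 = F.@[e0v 0].
Proof.
rewrite -(@ev2_at0 _ 0 0) ?horner0 // ev2_dehomog evp_at0; apply: meval_eq.
by apply: ord3P; rewrite /vec3 !mxE /= ?hornerC ?horner0.
Qed.

Lemma hess_local F : let g := series_of_poly (dehomog F) in let H := hess F e0v in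
  [/\ H i1 i1 = 2%:R * g 2 0, H i2 i2 = 2%:R * g 0 2, H i1 i2 = g 1 1 & H i2 i1 = g 1 1].
Proof.
move=> g H; have eH (i j : 'I_3) : H i j = (F^`M(j)^`M(i)).@[e0v 0] by rewrite mxE.
have e12 : H i1 i2 = g 1 1.
  by rewrite eH -dehomog_at_e0 -mderiv_dehomog0 -mderiv_dehomog1 series_of_mderiv0 series_of_mderiv1.
split=> //.
- by rewrite eH -dehomog_at_e0 -!mderiv_dehomog0 !series_of_mderiv0 mulr1n mulr_natl.
- by rewrite eH -dehomog_at_e0 -!mderiv_dehomog1 !series_of_mderiv1 mulr1n mulr_natl.
- by rewrite -e12 !eH mderiv_comm.
Qed.

(** Differentiating Euler's identity at (1 : 0 : 0), where all first derivatives vanish, leaves the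
    second derivatives involving the first coordinate. *)
Lemma hess_euler d F : F \is d.-homog -> (forall i, (F^`M(i)).@[e0v 0] = 0) ->
  forall i, hess F e0v i i0 = 0 /\ hess F e0v i0 i = 0.
Proof.
move=> hF dF.
have e1 i : hess F e0v i i0 = 0.
  have := congr1 (fun G => (G^`M(i)).@[e0v 0]) (euler_identity hF).
  rewrite /= -scaler_nat mulr_algl mderivZ mevalZ dF mulr0 sum3 !mderivD !mderivM !mderivXU.
  rewrite !mevalD !mevalM !mevalC !dF !mulr0 !add0r !mevalXU /e0v !mxE /=.
  by rewrite !mul1r !mul0r !addr0.
by move=> i; split; rewrite // -(e1 i) !mxE mderiv_comm.
Qed.

End Hessian.

Section NodeCusp.
Variable R : realType.
Local Notation C := R[i].
Implicit Types (f : {mpoly C[3]}) (P : 'rV[C]_3).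

(** The Hessian has rank two at a node and rank one at a cusp. *)
Lemma A_hess d n f P : f \is d.-homog -> has_singularity_type f P (A n.+1) ->
  exists M e u v, let G := hess (subst M f) (e0v C) in let w := (n == 0%N)%:R : C in
  [/\ M \in unitmx, row 0 M = P, (forall i, G i i0 = 0 /\ G i0 i = 0),
      [/\ e != 0 :> C & u 1%N 0%N * v 0%N 1%N - u 0%N 1%N * v 1%N 0%N != 0 :> C] &
      [/\ e * G i1 i1 = 2%:R * (u 1%N 0%N ^+ 2 + w * v 1%N 0%N ^+ 2),
          e * G i2 i2 = 2%:R * (u 0%N 1%N ^+ 2 + w * v 0%N 1%N ^+ 2),
          e * G i1 i2 = 2%:R * (u 1%N 0%N * u 0%N 1%N + w * (v 1%N 0%N * v 0%N 1%N)) &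
          G i2 i1 = G i1 i2]].
Proof.
move=> hf [_ sP [M [u [v [e [[uM eM] [_ [u0 v0] jac] [_ nze] eqn]]]]]].
exists M, (e 0%N 0%N), u, v => G w.
have {}eqn : series_mul e (series_of_poly (dehomog (subst M f))) =2 normal_form (A n.+1) u v.
  by move=> i j; rewrite -local_equation_dehomog eqn.
have [e20 e02 e11] := A_jet2 nze u0 v0 eqn.
have [g11 g22 g12 g21] := hess_local (subst M f).
have [_ _ dG] : singular_point (subst M f) (e0v C).
  by apply/singular_point_subst => //; rewrite e0v_row eM.
split=> //; first exact: (hess_euler (subst_homog M hf)).
split.
- by rewrite /G g11 mulrCA e20.
- by rewrite /G g22 mulrCA e02.
- by rewrite /G g12 e11 -mulrA mulrDr.
- by rewrite /G g12 g21.
Qed.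

(** A change of frame acts on the Hessian by congruence and a change of homogeneous coordinates by a
    nonzero scalar, so its rank depends only on the point. At a cusp it is a multiple of
    [col *m col^T], whose minors of order two vanish. *)
Lemma A1_A2_distinct d f P P' : f \is d.-homog ->
  has_singularity_type f P (A 1) -> has_singularity_type f P' (A 2) -> ~ same_point P P'.
Proof.
move=> hf s1 s2 [c nzc eP].
have [M [e [u [v /= [uM eM _ [nze jac] [h11 h22 h12 h21]]]]]] := A_hess hf s1.
have [M' [e' [u' [v' /= [uM' eM' hz' [nze' _] [h11' h22' h12' h21']]]]]] := A_hess hf s2.
set G := hess (subst M f) _ in h11 h22 h12 h21.
set G' := hess (subst M' f) _ in h11' h22' h12' h21' hz'.
pose col : 'cV[C]_3 := \col_i vec3 0 (u' 1%N 0%N) (u' 0%N 1%N) i.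
pose t := 2%:R / e'.
have te x y : e' * x = 2%:R * y -> x = t * y.
  by move=> exy; apply: (mulfI nze'); rewrite exy /t mulrA mulrCA mulfV // mulr1.
have eG' : G' = t *: (col *m col^T).
  clearbody G'; rewrite !(mul0r, addr0) in h11' h22' h12'.
  have {}h11' := te _ _ h11'; have {}h22' := te _ _ h22'; have {}h12' := te _ _ h12'.
  apply/matrixP => i j; rewrite !mxE big_ord1 !mxE; move: i j.
  apply: ord3P => j; first by rewrite (hz' j).2 /vec3 /= mul0r mulr0.
    move: j; apply: ord3P; rewrite ?(hz' i1).1 ?h11' ?h12' /vec3 /=; ring.
  move: j; apply: ord3P; rewrite ?(hz' i2).1 ?h22' ?h21' ?h12' /vec3 /=; ring.
pose N := M *m invmx M'.
have eG : exists k, G = k *: (N *m col *m (N *m col)^T).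
  have -> : G = M *m hess f P *m M^T by rewrite /G hess_subst e0v_row eM.
  have -> : hess f P = (c ^+ d / c ^+ 2) *: hess f P' by rewrite eP (hess_scale _ nzc hf).
  have -> : hess f P' = invmx M' *m G' *m (invmx M')^T.
    rewrite /G' hess_subst e0v_row eM' -!mulmxA -trmx_mul mulVmx // trmx1 mulmx1.
    by rewrite mulmxA mulVmx // mul1mx.
  exists (c ^+ d / c ^+ 2 * t).
  by rewrite eG' -!(scalemxAr, scalemxAl) scalerA /N !trmx_mul !mulmxA.
have [k {}eG] := eG.
have minor : G i1 i1 * G i2 i2 = G i1 i2 ^+ 2.
  by rewrite eG; move: (N *m col) => y; rewrite !mxE !big_ord1 !mxE; ring.
have : (e * G i1 i1) * (e * G i2 i2) - (e * G i1 i2) ^+ 2 = 0.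
  by rewrite exprMn -minor; ring.
rewrite h11 h22 h12 => /eqP.
(* Lagrange's identity: up to nonzero factors the minor at a node is the square of the Jacobian. *)
rewrite (_ : _ - _ = (2%:R * (u 1%N 0%N * v 0%N 1%N - u 0%N 1%N * v 1%N 0%N)) ^+ 2); last by ring.
by rewrite sqrf_eq0 mulf_eq0 pnatr_eq0 (negPf jac).
Qed.

End NodeCusp.

Lemma opp_neq (K : numFieldType) (x : K) : x != 0 -> - x != x.
Proof. by move=> nzx; rewrite -subr_eq0 -opprD oppr_eq0 -mulr2n -mulr_natl mulf_neq0 ?pnatr_eq0. Qed.

Lemma cubeN (K : comNzRingType) (c r : K) : c * (- r) ^+ 3 = - (c * r ^+ 3).
Proof. by ring. Qed.

(** The two equations differ by (b2 - b1) z^3, so the cubics meet only on the line z = 0, their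
    common flex tangent. *)
Lemma weier_common (K : numClosedFieldType) v (a b1 b2 : K) : b1 != b2 ->
  (weier a b1).@[v] = 0 -> (weier a b2).@[v] = 0 -> v i0 = 0 /\ v i2 = 0.
Proof.
move=> nb; rewrite !meval_weier => eA eB.
have z0 : v i2 = 0.
  have : (b2 - b1) * v i2 ^+ 3 = 0 by rewrite -[RHS](subrr 0) -{1}eA -eB; ring.
  by move/eqP; rewrite mulf_eq0 subr_eq0 eq_sym (negPf nb) expf_eq0 /= => /eqP.
split=> //; move/eqP: eA; rewrite z0 !expr0n /= !(mulr0, subr0, sub0r) oppr_eq0 expf_eq0 /=; exact: eqP.
Qed.

(** * Singular points of a product of two Weierstrass cubics *)

Section WeierstrassSingularities.
Variable R : realType.
Local Notation C := R[i].
Implicit Types (f g : {mpoly C[3]}) (P X : 'rV[C]_3) (a b r : C).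

Lemma rV3_eqP P x y z : P 0 i0 = x -> P 0 i1 = y -> P 0 i2 = z -> P = row3 x y z.
Proof. by move=> e0 e1 e2; apply/rowP; apply: ord3P; rewrite mxE. Qed.

Lemma scale_row3 (c x y z : C) : c *: row3 x y z = row3 (c * x) (c * y) (c * z).
Proof. by apply/rowP; apply: ord3P; rewrite !mxE. Qed.

Lemma same_point_sym P X : same_point P X -> same_point X P.
Proof. by case=> c nzc ->; exists c^-1; rewrite ?invr_eq0 // scalerA mulVf ?scale1r. Qed.

Lemma same_point_trans P X Y : same_point P X -> same_point X Y -> same_point P Y.
Proof. by case=> c nzc -> [d nzd ->]; exists (c * d); rewrite ?mulf_neq0 // scalerA. Qed.

Lemma singular_same d f P X : f \is d.-homog -> same_point P X -> singular_point f X -> singular_point f P.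
Proof.
move=> hf [c nzc ->] [nzX fX dX]; rewrite -mul_mx_scalar.
have uc : (c%:M : 'M[C]_3) \in unitmx by rewrite unitmxE det_scalar unitfE expf_neq0.
apply/(singular_point_subst f X uc); rewrite (homog_substZ c hf); split=> // [|i].
  by rewrite /on_curve mevalZ fX mulr0.
by rewrite mderivZ mevalZ dX mulr0.
Qed.

Lemma weier_singularP a b X : singular_point (weier a b) X ->
  exists r, [/\ a = - (3%:R * r ^+ 2), b = 2%:R * r ^+ 3 & same_point X (row3 r 0 1)].
Proof.
have n2 : (2%:R : C) != 0 by rewrite pnatr_eq0.
have n3 : (3%:R : C) != 0 by rewrite pnatr_eq0.
case=> nzX _ dX; have := dX i0; have := dX i1; have := dX i2; rewrite !meval_weierE.
set x := X 0 i0; set y := X 0 i1; set z := X 0 i2 => e2 e1 e0.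
have nzz : z != 0.
  apply: contra_neq nzX => z0; rewrite z0 in e0 e1 e2.
  have x0 : x = 0.
    by move/eqP: e0; rewrite expr0n /= mulr0 subr0 mulNr oppr_eq0 mulf_eq0 (negPf n3) sqrf_eq0 => /eqP.
  have y0 : y = 0.
    by move/eqP: e2; rewrite expr0n /= !mulr0 !subr0 sqrf_eq0 => /eqP.
  by rewrite (rV3_eqP x0 y0 z0); apply/rowP; apply: ord3P; rewrite !mxE.
have y0 : y = 0.
  by move/eqP: e1; rewrite !mulf_eq0 (negPf n2) (negPf nzz) orbF => /eqP.
pose r := x / z; have ex : x = r * z by rewrite divfK.
exists r; rewrite y0 ex in e0 e1 e2.
have ea : a = - (3%:R * r ^+ 2).
  apply: (mulIf (expf_neq0 2 nzz)); apply/eqP; rewrite -subr_eq0 -oppr_eq0; apply/eqP.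
  by rewrite -[RHS]e0; ring.
split=> //.
  apply: (mulfI n3); apply: (mulIf (expf_neq0 2 nzz)); apply/eqP; rewrite -subr_eq0 -oppr_eq0; apply/eqP.
  by rewrite -[RHS]e2 ea; ring.
by exists z; rewrite // scale_row3 mulr0 mulr1 mulrC; apply: rV3_eqP.
Qed.

(** Where one factor does not vanish, the point is singular on the other; where both vanish, it is
    the common flex by [weier_common]. *)
Lemma weier_prod_singularP a b1 b2 X : b1 != b2 -> X != 0 ->
  singular_point (weier a b1 * weier a b2) X <->
  same_point X (row3 0 1 0) \/
  exists r, [/\ a = - (3%:R * r ^+ 2), b1 = 2%:R * r ^+ 3 \/ b2 = 2%:R * r ^+ 3 & same_point X (row3 r 0 1)].
Proof.
move=> nb nzX; have hf := dhomogM (weier_homog a b1) (weier_homog a b2).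
split=> [sX|[sX|[r [ea eb sX]]]]; first 1 last.
- by apply: (singular_same hf sX); have [] := weier_A17 a nb.
- apply: (singular_same hf sX); rewrite {hf} ea; case: eb => ->; last rewrite (mulrC (weier _ _)).
    exact: singular_pointMl (weier_singular r).
  exact: singular_pointMl (weier_singular r).
have [eA|nzA] := eqVneq ((weier a b1).@[X 0]) 0; last first.
  by right; rewrite (mulrC (weier _ _)) in sX; have [r [ea eb sr]] := weier_singularP (singular_pointMr nzA sX); exists r; split; auto.
have [eB|nzB] := eqVneq ((weier a b2).@[X 0]) 0; last first.
  by right; have [r [ea eb sr]] := weier_singularP (singular_pointMr nzB sX); exists r; split; auto.
left; have [x0 z0] := weier_common nb eA eB.
exists (X 0 i1); last by rewrite scale_row3 mulr0 mulr1; apply: rV3_eqP.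
by apply: contra_neq nzX => y0; rewrite (rV3_eqP x0 y0 z0); apply/rowP; apply: ord3P; rewrite !mxE.
Qed.

Lemma weier_neq0 a b : weier a b != 0 :> {mpoly C[3]}.
Proof.
apply: contra_eq_neq (meval_weier (vec3 1 0 0) a b) => ->; rewrite meval0 /vec3 /= eq_sym.
rewrite (_ : _ - _ - _ - _ = - 1); last by ring.
by rewrite oppr_eq0 oner_neq0.
Qed.

Lemma weier_sextic a b1 b2 : sextic (weier a b1 * weier a b2 : {mpoly C[3]}).
Proof.
split; first by rewrite mulf_neq0 // weier_neq0.
exact: dhomogM (weier_homog a b1) (weier_homog a b2).
Qed.

Lemma weier_reducible a b1 b2 : reducible (weier a b1 * weier a b2 : {mpoly C[3]}).
Proof. by exists 3, 3, (weier a b1), (weier a b2); split; rewrite ?weier_homog. Qed.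

End WeierstrassSingularities.

(** With b1 and b2 written as b + d and b - d the product is a difference of squares, the square of
    [weier a b] minus d^2 z^6, and - d^2 has a cube root. *)
Lemma weier_torus_id (K : numClosedFieldType) (a b1 b2 : K) : exists p : {mpoly K[3]}, exists q : {mpoly K[3]},
  [/\ p \is 2.-homog, q \is 3.-homog & weier a b1 * weier a b2 = p ^+ 3 + q ^+ 2].
Proof.
have n2 : (2%:R : K) != 0 by rewrite pnatr_eq0.
pose d := (b1 - b2) / 2%:R; pose b := (b1 + b2) / 2%:R.
have e1 : b1 = b + d by rewrite /b /d; field.
have e2 : b2 = b - d by rewrite /b /d; field.
pose k := 3.-root (- d ^+ 2); have k3 : k ^+ 3 = - d ^+ 2 by rewrite rootCK.
exists (k%:MP * 'X_i2 ^+ 2), (weier a b); split; last 1 first.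
- rewrite exprMn -(rmorphXn (@mpolyC 3 K)) /= k3 e1 e2 /weier /pol3 /cf3.
  rewrite !(mpolyC0, mpolyC1, mpolyCD, mpolyCN) !(rmorphXn (@mpolyC 3 K)) /= .
  by move: 'X_i0 'X_i1 'X_i2 (a%:MP) (b%:MP) (d%:MP) => x y z a' b' d'; ring.
- have h : 'X_i2 ^+ 2 \is [in K[3], (1 * 2).-homog] by apply: dhomogMn; rewrite dhomogX /= mdeg1.
  by rewrite mul_mpolyC; apply: rpredZ; exact: h.
- exact: weier_homog.
Qed.

(** * The four sets of singularities *)

Section WeierstrassSets.
Variable R : realType.
Local Notation C := R[i].
Implicit Types (f g : {mpoly C[3]}) (P X : 'rV[C]_3) (a b r : C).

(** By [inner_A17] the flex is the only inner point for every torus structure, so the inner list is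
    settled once and only the singular points of the individual cubics have to be listed. *)
Lemma weier_has_set a b1 b2 ts (pt : 'I_(size ts) -> 'rV[C]_3) : b1 != b2 ->
  (forall i j, same_point (pt i) (pt j) -> i = j) ->
  (forall r, a = - (3%:R * r ^+ 2) -> b1 = 2%:R * r ^+ 3 \/ b2 = 2%:R * r ^+ 3 ->
     exists i, pt i = row3 r 0 1) ->
  (forall i, exists2 r, pt i = row3 r 0 1 &
     a = - (3%:R * r ^+ 2) /\ (b1 = 2%:R * r ^+ 3 \/ b2 = 2%:R * r ^+ 3)) ->
  (forall i, has_singularity_type (weier a b1 * weier a b2) (pt i) (tnth (in_tuple ts) i)) ->
  has_set_of_singularities (weier a b1 * weier a b2) [:: A 17] ts.
Proof.
move=> nb injpt allpt ptE ty; have sf := weier_sextic a b1 b2; have rf := weier_reducible a b1 b2.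
have t17 := weier_A17 a nb; have hf := sf.2.
split.
  have [p [q [hp hq e]]] := weier_torus_id a b1 b2; exists p, q; split=> //.
  by exists 1; rewrite ?oner_neq0 // scale1r.
move=> p q tpq; have inE X := inner_A17 sf rf tpq t17 (X := X).
split.
  exists (fun _ => row3 0 1 0); split=> [i j _|X|i].
  - by rewrite !ord1.
  - split=> [[sX iX]|[_ sX]]; first by exists ord0; apply/inE => //; case: sX.
    have sX' : singular_point (weier a b1 * weier a b2) X by apply: (singular_same hf sX); case: t17.
    by split=> //; apply/inE => //; case: sX'.
  - by rewrite (ord1 i).
exists pt; split=> // X; split=> [[sX niX]|[i sX]].
  have nzX : X != 0 by case: sX.
  case: ((weier_prod_singularP a nb nzX).1 sX) => [sX'|[r [ea eb sr]]]; first by case: niX; apply/inE.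
  by have [i ei] := allpt r ea eb; exists i; rewrite ei.
have sX' : singular_point (weier a b1 * weier a b2) X by apply: (singular_same hf sX); case: (ty i).
split=> // /inE; case: (sX') => nzX _ _ /(_ nzX) s17.
have [r er _] := ptE i; rewrite er in sX.
have [c nzc] := same_point_trans (same_point_sym sX) s17.
by rewrite scale_row3 => /rowP/(_ i2) /eqP; rewrite !mxE /= mulr0 oner_eq0.
Qed.

Lemma weier_point_type r b2 : b2 != 2%:R * r ^+ 3 ->
  has_singularity_type (weier (- (3%:R * r ^+ 2)) (2%:R * r ^+ 3) * weier (- (3%:R * r ^+ 2)) b2)
    (row3 r 0 1) (A (if r == 0 then 2 else 1)).
Proof.
move=> nb; have nzB : (weier (- (3%:R * r ^+ 2)) b2).@[(row3 r 0 1) 0] != 0.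
  rewrite meval_row3 meval_weierE /vec3 /=.
  rewrite (_ : _ - _ - _ - _ = 2%:R * r ^+ 3 - b2); last by ring.
  by rewrite subr_eq0 eq_sym.
have [e|nzr] := eqVneq r 0; last exact: weier_node.
move: nzB; rewrite e !expr0n /= !mulr0 oppr0; exact: weier_cusp.
Qed.

Lemma cusp_set b : b != 0 -> has_set_of_singularities (weier 0 0 * weier 0 b) [:: A 17] [:: A 2].
Proof.
move=> nzb; have e0 : 0 = - (3%:R * 0 ^+ 2) :> C by rewrite expr0n /= mulr0 oppr0.
have e0' : 0 = 2%:R * 0 ^+ 3 :> C by rewrite expr0n /= mulr0.
have nz3 : (3%:R : C) != 0 by rewrite pnatr_eq0.
apply: (@weier_has_set _ _ _ _ (fun _ => row3 0 0 1)); first by rewrite eq_sym.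
- by move=> i j _; rewrite !ord1.
- move=> r /esym/eqP; rewrite oppr_eq0 mulf_eq0 (negPf nz3) sqrf_eq0 => /eqP -> _.
  by exists ord0.
- by move=> i; exists 0; split; auto.
- move=> i; rewrite (ord1 i); have := @weier_point_type 0 b; rewrite -e0 -e0' eqxx; exact.
Qed.

Lemma row3_same (r s : C) : same_point (row3 r 0 1) (row3 s 0 1) -> r = s.
Proof.
case=> c _; rewrite scale_row3 => /rowP e; have := e i0; have := e i2; rewrite !mxE /vec3 /= mulr1 => <-.
by rewrite mul1r.
Qed.

Lemma one_node_set r b : r != 0 -> b != 2%:R * r ^+ 3 -> b != - (2%:R * r ^+ 3) ->
  has_set_of_singularities (weier (- (3%:R * r ^+ 2)) (2%:R * r ^+ 3) * weier (- (3%:R * r ^+ 2)) b)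
    [:: A 17] [:: A 1].
Proof.
move=> nzr nb nb'; have n3 : (3%:R : C) != 0 by rewrite pnatr_eq0.
have n2 : (2%:R : C) != 0 by rewrite pnatr_eq0.
apply: (@weier_has_set _ _ _ _ (fun _ => row3 r 0 1)); first by rewrite eq_sym.
- by move=> i j _; rewrite !ord1.
- move=> s /oppr_inj /(mulfI n3) /eqP; rewrite eqf_sqr => /orP[/eqP->|/eqP er].
    by move=> _; exists ord0.
  (* The coefficient a determines the node only up to sign; the opposite node would require a cubic
     with b = - 2 r^3, and neither factor is that cubic. *)
  have -> : s = - r by rewrite er opprK.
  rewrite cubeN; case=> e; last by rewrite e eqxx in nb'.
  by have := opp_neq (x := 2%:R * r ^+ 3); rewrite -e eqxx mulf_neq0 ?expf_neq0 // => /(_ isT).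
- by move=> i; exists r; split; auto.
- by move=> i; rewrite (ord1 i) /=; have := weier_point_type nb; rewrite (negPf nzr).
Qed.

Lemma two_node_set r : r != 0 ->
  has_set_of_singularities (weier (- (3%:R * r ^+ 2)) (2%:R * r ^+ 3)
     * weier (- (3%:R * r ^+ 2)) (- (2%:R * r ^+ 3))) [:: A 17] [:: A 1; A 1].
Proof.
move=> nzr; have n3 : (3%:R : C) != 0 by rewrite pnatr_eq0.
have n2 : (2%:R : C) != 0 by rewrite pnatr_eq0.
have nzb : 2%:R * r ^+ 3 != 0 by rewrite mulf_neq0 ?expf_neq0.
have nN := @opp_neq C.
have rN : (- r) ^+ 2 = r ^+ 2 by rewrite sqrrN.
have rN3 : 2%:R * (- r) ^+ 3 = - (2%:R * r ^+ 3) by exact: cubeN.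
apply: (@weier_has_set _ _ _ [:: A 1; A 1] (fun i : 'I_2 => row3 (if i == ord0 then r else - r) 0 1)).
- by rewrite eq_sym nN.
- move=> i j /row3_same; case: eqVneq => [->|ni]; case: eqVneq => [->|nj] //.
  + by move=> /esym /eqP; rewrite (negPf (nN _ nzr)).
  + by move=> /eqP; rewrite (negPf (nN _ nzr)).
  + by case: i ni j nj => -[|[|//]] ? // _ [[|[|//]]] ? // _ _; apply: val_inj.
- move=> s /oppr_inj /(mulfI n3) /eqP; rewrite eqf_sqr => /orP[/eqP->|/eqP es] _.
    by exists ord0.
  by exists (@Ordinal 2 1 isT); rewrite es opprK.
- move=> i; exists (if i == ord0 then r else - r) => //.
  by case: ifP => _; rewrite ?rN ?rN3; auto.
- case=> -[|[|//]] lti.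
    rewrite [tnth _ _](_ : _ = A 1) //=; have := weier_point_type (nN _ nzb); rewrite (negPf nzr); exact.
  rewrite [tnth _ _](_ : _ = A 1) //= mulrC.
  have := @weier_point_type (- r) (2%:R * r ^+ 3); rewrite rN rN3 oppr_eq0 (negPf nzr).
  by apply; rewrite eq_sym nN.
Qed.

Lemma smooth_set a b1 b2 : b1 != b2 ->
  (forall r, a = - (3%:R * r ^+ 2) -> b1 != 2%:R * r ^+ 3 /\ b2 != 2%:R * r ^+ 3) ->
  has_set_of_singularities (weier a b1 * weier a b2) [:: A 17] [::].
Proof.
move=> nb nr; apply: (@weier_has_set _ _ _ [::] (fun i : 'I_0 => row3 0 0 1)) => //; try by case.
by move=> r /nr[n1 n2] [/eqP|/eqP]; rewrite ?(negPf n1) ?(negPf n2).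
Qed.

End WeierstrassSets.

(** * Strata *)

Section WeierstrassParameters.
Variable K : numClosedFieldType.
Implicit Types (a b r : K).

Lemma weier_disc a b : 4%:R * a ^+ 3 + 27%:R * b ^+ 2 = 0 ->
  exists r, a = - (3%:R * r ^+ 2) /\ b = 2%:R * r ^+ 3.
Proof.
move=> e; have n2 : (2%:R : K) != 0 by rewrite pnatr_eq0.
have n27 : (27%:R : K) != 0 by rewrite pnatr_eq0.
have [a0|nza] := eqVneq a 0.
  exists 0; move/eqP: e; rewrite a0 !expr0n /= !mulr0 oppr0 add0r mulf_eq0 (negPf n27) sqrf_eq0.
  by move=> /eqP ->.
have eb : 27%:R * b ^+ 2 = - (4%:R * a ^+ 3) by apply/eqP; rewrite -subr_eq0 opprK addrC e.
(* The double root of x^3 + a x + b. *)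
exists (- (3%:R * b) / (2%:R * a)); split.
- apply: (mulfI (expf_neq0 2 nza)).
  rewrite [RHS](_ : _ = - (27%:R * b ^+ 2) / 4%:R); last by field; rewrite ?nza ?n2.
  by rewrite eb; field.
- rewrite [RHS](_ : _ = b * - (27%:R * b ^+ 2) / (4%:R * a ^+ 3)); last by field; rewrite ?nza ?n2.
  by rewrite eb; field.
Qed.

Lemma weier_disc0 r : 4%:R * (- (3%:R * r ^+ 2)) ^+ 3 + 27%:R * (2%:R * r ^+ 3) ^+ 2 = 0.
Proof. by ring. Qed.

Definition nodal_a : {mpoly K[3]} := - (3%:R * 'X_i0 ^+ 2).
Definition nodal_b : {mpoly K[3]} := 2%:R * 'X_i0 ^+ 3.
Definition disc_poly i : {mpoly K[3]} := 4%:R * 'X_i0 ^+ 3 + 27%:R * 'X_i ^+ 2.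

Lemma nodal_aE s : nodal_a.@[s] = - (3%:R * s i0 ^+ 2).
Proof. by rewrite mevalN mevalM rmorphXn rmorph_nat /= mevalXU. Qed.

Lemma nodal_bE s : nodal_b.@[s] = 2%:R * s i0 ^+ 3.
Proof. by rewrite mevalM rmorphXn rmorph_nat /= mevalXU. Qed.

Lemma disc_polyE i s : (disc_poly i).@[s] = 4%:R * s i0 ^+ 3 + 27%:R * s i ^+ 2.
Proof. by rewrite /disc_poly !exprS !expr0 !mulr1 mevalD !mevalM !rmorph_nat /= !mevalXU. Qed.

Lemma one_discE s : ('X_i0 * (('X_i1 - nodal_b) * ('X_i1 + nodal_b))).@[s] =
  s i0 * ((s i1 - 2%:R * s i0 ^+ 3) * (s i1 + 2%:R * s i0 ^+ 3)).
Proof. by rewrite !mevalM mevalB mevalD nodal_bE !mevalXU. Qed.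

Lemma smooth_discE s : (('X_i1 - 'X_i2) * (disc_poly i1 * disc_poly i2)).@[s] =
  (s i1 - s i2) * ((4%:R * s i0 ^+ 3 + 27%:R * s i1 ^+ 2) * (4%:R * s i0 ^+ 3 + 27%:R * s i2 ^+ 2)).
Proof. by rewrite !mevalM mevalB !disc_polyE !mevalXU. Qed.

(** The four families get one shape, the polynomial image of the complement of a hypersurface in
    affine 3-space, so that connectedness is proved once for all of them. *)
Definition weier_param (qa q1 q2 qd : {mpoly K[3]}) F := exists s,
  qd.@[s] != 0 /\ F = weier qa.@[s] q1.@[s] * weier qa.@[s] q2.@[s].

Definition cusp_param := weier_param 0 0 'X_i0 'X_i0.

Definition two_node_param := weier_param nodal_a nodal_b (- nodal_b) 'X_i0.

Definition one_node_param := weier_param nodal_a nodal_b 'X_i1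
  ('X_i0 * (('X_i1 - nodal_b) * ('X_i1 + nodal_b))).

Definition smooth_param := weier_param 'X_i0 'X_i1 'X_i2
  (('X_i1 - 'X_i2) * (disc_poly i1 * disc_poly i2)).

Lemma cusp_paramP F : cusp_param F <-> exists b, b != 0 /\ F = weier 0 0 * weier 0 b.
Proof.
split=> [[s []]|[b [nzb ->]]].
  by rewrite mevalXU meval0 => nz ->; exists (s i0).
by exists (vec3 b 0 0); rewrite mevalXU meval0.
Qed.

Lemma two_node_paramP F : two_node_param F <-> exists r, r != 0 /\
  F = weier (- (3%:R * r ^+ 2)) (2%:R * r ^+ 3) * weier (- (3%:R * r ^+ 2)) (- (2%:R * r ^+ 3)).
Proof.
split=> [[s []]|[r [nzr ->]]].
  by rewrite mevalXU mevalN nodal_aE nodal_bE => nz ->; exists (s i0).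
by exists (vec3 r 0 0); rewrite mevalXU mevalN nodal_aE nodal_bE.
Qed.

Lemma one_node_paramP F : one_node_param F <-> exists r b,
  [/\ r != 0, b != 2%:R * r ^+ 3, b != - (2%:R * r ^+ 3) &
   F = weier (- (3%:R * r ^+ 2)) (2%:R * r ^+ 3) * weier (- (3%:R * r ^+ 2)) b].
Proof.
split=> [[s []]|[r [b [nzr n1 n2 ->]]]].
  rewrite one_discE mevalXU nodal_aE nodal_bE !mulf_eq0 !negb_or subr_eq0 addr_eq0 => /and3P[nz n1 n2] ->.
  by exists (s i0), (s i1).
exists (vec3 r b 0); rewrite one_discE mevalXU nodal_aE nodal_bE; split=> //.
by rewrite !mulf_eq0 !negb_or subr_eq0 addr_eq0 nzr n1.
Qed.

Lemma smooth_paramP F : smooth_param F <-> exists a b1 b2,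
  [/\ b1 != b2, 4%:R * a ^+ 3 + 27%:R * b1 ^+ 2 != 0, 4%:R * a ^+ 3 + 27%:R * b2 ^+ 2 != 0 &
   F = weier a b1 * weier a b2].
Proof.
split=> [[s []]|[a [b1 [b2 [nb n1 n2 ->]]]]].
  rewrite smooth_discE !mevalXU 2!mulf_eq0 !negb_or subr_eq0 => /and3P[nb n1 n2] ->.
  by exists (s i0), (s i1), (s i2).
by exists (vec3 a b1 b2); rewrite smooth_discE !mevalXU !mulf_neq0 // subr_eq0.
Qed.

Lemma weier_params a b1 b2 : b1 != b2 -> let F := weier a b1 * weier a b2 in
  [\/ cusp_param F, two_node_param F, one_node_param F | smooth_param F].
Proof.
(* Up to exchanging the factors, the first cubic is singular as soon as one of them is. *)
wlog d1 : b1 b2 / (4%:R * a ^+ 3 + 27%:R * b1 ^+ 2 = 0 \/ (4%:R * a ^+ 3 + 27%:R * b2 ^+ 2) != 0).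
  move=> wl nb F.
  have [d2|d2] := eqVneq (4%:R * a ^+ 3 + 27%:R * b2 ^+ 2) 0; last by apply: wl; auto.
  have nb' : b2 != b1 by rewrite eq_sym.
  by have := wl b2 b1 (or_introl d2) nb'; rewrite /= [weier a b2 * _]mulrC.
move=> nb F.
have [d1'|d1'] := eqVneq (4%:R * a ^+ 3 + 27%:R * b1 ^+ 2) 0; last first.
  constructor 4; apply/smooth_paramP; exists a, b1, b2; split=> //.
  by case: d1 => // d1; rewrite d1 eqxx in d1'.
have [r [ea eb]] := weier_disc d1'.
rewrite /F ea eb; rewrite eb in nb.
have [r0|nzr] := eqVneq r 0.
  constructor 1; apply/cusp_paramP; exists b2.
  by move: nb; rewrite r0 !expr0n /= !mulr0 oppr0 eq_sym.
have [e2|n2] := eqVneq b2 (- (2%:R * r ^+ 3)).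
  by constructor 2; apply/two_node_paramP; exists r; rewrite e2.
by constructor 3; apply/one_node_paramP; exists r, b2; split; rewrite // eq_sym.
Qed.

End WeierstrassParameters.

(** * Identification of the strata with the four families *)

Section Strata.
Variable R : realType.
Local Notation C := R[i].
Implicit Types (f F : {mpoly C[3]}) (P X : 'rV[C]_3) (a b r : C).

Lemma singularities_in_size f (S : 'rV[C]_3 -> Prop) ts ts' :
  singularities_in f S ts -> singularities_in f S ts' -> (size ts <= size ts')%N.
Proof.
move=> [pt [injpt allpt ty]] [pt' [_ allpt' _]].
have ex i : exists j, same_point (pt i) (pt' j).
  apply/allpt'; apply/allpt; exists i; exists 1; rewrite ?oner_neq0 //.
  by rewrite scale1r.
have [s es] := fin_all_exists ex.
rewrite -(card_ord (size ts)) -(card_ord (size ts')); apply: (leq_card s) => i j eij.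
by apply: injpt; apply: same_point_trans (es i) _; rewrite eij; apply: same_point_sym.
Qed.

(** Used to show that the strata are disjoint: the sizes separate them except for two lists of
    length one, where both types are carried by the same point. *)
Lemma has_set_out f inn inn' out out' : has_set_of_singularities f inn out ->
  has_set_of_singularities f inn' out' -> size out = size out' /\
  forall t t', out = [:: t] -> out' = [:: t'] ->
    exists P P', [/\ has_singularity_type f P t, has_singularity_type f P' t' & same_point P P'].
Proof.
move=> [[p [q tf]] hs] [_ hs']; have [_ so] := hs _ _ tf; have [_ so'] := hs' _ _ tf.
split; first by apply/eqP; rewrite eqn_leq (singularities_in_size so so') (singularities_in_size so' so).
move=> t t' et et'; rewrite {}et in so; rewrite {}et' in so'.
case: so so' => [pt [_ allpt ty]] [pt' [_ allpt' ty']].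
exists (pt ord0), (pt' ord0); split; [exact: ty | exact: ty' |].
have [|j ej] := (allpt' (pt ord0)).1; last by rewrite (ord1 j) in ej.
by apply/allpt; exists ord0; exists 1; rewrite ?oner_neq0 ?scale1r.
Qed.

Definition family (param : {mpoly C[3]} -> Prop) f := exists (N : 'M[C]_3) F,
  [/\ N \in unitmx, param F & f = subst N F].

Lemma torus_A17_families f P : sextic f -> reducible f -> torus_type f -> has_singularity_type f P (A 17) ->
  [\/ family (@cusp_param C) f, family (@two_node_param C) f,
     family (@one_node_param C) f | family (@smooth_param C) f].
Proof.
move=> sf rf tf sP; have [N [a [b1 [b2 [uN nb ->]]]]] := weier_normal_form sf rf tf sP.
case: (weier_params a nb) => pF; [constructor 1 | constructor 2 | constructor 3 | constructor 4];
  by exists N, (weier a b1 * weier a b2).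
Qed.

Lemma weier_stratum N a b1 b2 out : N \in unitmx ->
  has_set_of_singularities (weier a b1 * weier a b2) [:: A 17] out ->
  stratum [:: A 17] out (subst N (weier a b1 * weier a b2)).
Proof.
by move=> uN hF; apply: (stratum_subst uN); split=> //; [exact: weier_sextic | exact: weier_reducible].
Qed.

Lemma cusp_stratum f : family (@cusp_param C) f -> stratum [:: A 17] [:: A 2] f.
Proof.
move=> [N [F [uN /cusp_paramP[b [nzb ->]] ->]]].
exact: weier_stratum uN (cusp_set nzb).
Qed.

Lemma two_node_stratum f : family (@two_node_param C) f -> stratum [:: A 17] [:: A 1; A 1] f.
Proof.
move=> [N [F [uN /two_node_paramP[r [nzr ->]] ->]]].
exact: weier_stratum uN (two_node_set nzr).
Qed.

Lemma one_node_stratum f : family (@one_node_param C) f -> stratum [:: A 17] [:: A 1] f.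
Proof.
move=> [N [F [uN /one_node_paramP[r [b [nzr n1 n2 ->]]] ->]]].
exact: weier_stratum uN (one_node_set nzr n1 n2).
Qed.

Lemma smooth_stratum f : family (@smooth_param C) f -> stratum [:: A 17] [::] f.
Proof.
move=> [N [F [uN /smooth_paramP[a [b1 [b2 [nb n1 n2 ->]]]] ->]]].
apply: weier_stratum uN (smooth_set nb _) => r ea.
by split; [apply: contra_neq n1 | apply: contra_neq n2] => ->; rewrite ea weier_disc0.
Qed.

Lemma stratum_family out f : stratum [:: A 17] out f ->
  [\/ family (@cusp_param C) f, family (@two_node_param C) f,
     family (@one_node_param C) f | family (@smooth_param C) f].
Proof.
move=> [sf rf hs]; have [[p [q tf]] hs'] := hs; have [[pt [_ _ ty]] _] := hs' _ _ tf.
by apply: (torus_A17_families sf rf hs.1 (ty ord0)).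
Qed.

Lemma stratum_out out out' f : stratum [:: A 17] out f -> stratum [:: A 17] out' f -> size out = size out'.
Proof. by move=> [_ _ hs] [_ _ hs']; case: (has_set_out hs hs'). Qed.

Lemma A1_A2_strata f : stratum [:: A 17] [:: A 1] f -> stratum [:: A 17] [:: A 2] f -> False.
Proof.
move=> [[_ hf] _ hs] [_ _ hs']; have [_ /(_ _ _ erefl erefl)[P [P' [s1 s2]]]] := has_set_out hs hs'.
exact: A1_A2_distinct hf s1 s2.
Qed.

Lemma cusp_stratumP f : stratum [:: A 17] [:: A 2] f <-> family (@cusp_param C) f.
Proof.
split=> [sf|]; last exact: cusp_stratum.
case: (stratum_family sf) => [h|/two_node_stratum sf'|/one_node_stratum sf'|/smooth_stratum sf'].
- exact: h.
- by have := stratum_out sf sf'.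
- by case: (A1_A2_strata sf' sf).
- by have := stratum_out sf sf'.
Qed.

Lemma two_node_stratumP f : stratum [:: A 17] [:: A 1; A 1] f <-> family (@two_node_param C) f.
Proof.
split=> [sf|]; last exact: two_node_stratum.
case: (stratum_family sf) => [/cusp_stratum sf'|h|/one_node_stratum sf'|/smooth_stratum sf'].
- by have := stratum_out sf sf'.
- exact: h.
- by have := stratum_out sf sf'.
- by have := stratum_out sf sf'.
Qed.

Lemma one_node_stratumP f : stratum [:: A 17] [:: A 1] f <-> family (@one_node_param C) f.
Proof.
split=> [sf|]; last exact: one_node_stratum.
case: (stratum_family sf) => [/cusp_stratum sf'|/two_node_stratum sf'|h|/smooth_stratum sf'].
- by case: (A1_A2_strata sf sf').
- by have := stratum_out sf sf'.
- exact: h.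
- by have := stratum_out sf sf'.
Qed.

Lemma smooth_stratumP f : stratum [:: A 17] [::] f <-> family (@smooth_param C) f.
Proof.
split=> [sf|]; last exact: smooth_stratum.
case: (stratum_family sf) => [/cusp_stratum sf'|/two_node_stratum sf'|/one_node_stratum sf'|h].
- by have := stratum_out sf sf'.
- by have := stratum_out sf sf'.
- by have := stratum_out sf sf'.
- exact: h.
Qed.

End Strata.

(** * Connectedness *)

Section PolynomialFamilies.
Variable K : numClosedFieldType.
Implicit Types (x y w : K) (N : 'M[K]_3) (qa q qd : {mpoly K[3]}).

Definition line x y : {poly K} := x%:P + (y - x)%:P * 'X.

Lemma line0 x y : (line x y).[0] = x.
Proof. by rewrite hornerD hornerM !hornerC hornerX mulr0 addr0. Qed.

Lemma line1 x y : (line x y).[1] = y.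
Proof. by rewrite hornerD hornerM !hornerC hornerX mulr1 addrC subrK. Qed.

Lemma map_mpoly_subst (A B : comNzRingType) (f : {rmorphism A -> B}) (N : 'M[A]_3) F :
  map_mpoly f (subst N F) = subst (map_mx f N) (map_mpoly f F).
Proof.
elim/mpoly_ring_ind: F => [c|i|F G eF eG|F G eF eG].
- by rewrite map_mpolyC /subst !comp_mpolyC map_mpolyC.
- rewrite map_mpolyX /subst !comp_mpolyXU -!tnth_nth !tnth_mktuple rmorph_sum.
  by apply: eq_bigr => k _; rewrite rmorphM /= map_mpolyC map_mpolyX mxE.
- by rewrite (rmorphD (subst N)) !(rmorphD (map_mpoly f)) (rmorphD (subst _)) /= eF eG.
- by rewrite (rmorphM (subst N)) !(rmorphM (map_mpoly f)) (rmorphM (subst _)) /= eF eG.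
Qed.

Lemma map_mpoly_weier (A : comNzRingType) (f : {rmorphism A -> K}) (a b : A) :
  map_mpoly f (pol3 (-1) 0 0 0 0 (- a) 0 1 0 (- b)) = weier (f a) (f b).
Proof.
have [fN f0 f1] : [/\ forall x : A, f (- x) = - f x, f 0 = 0 & f 1 = 1].
  by split; [exact: rmorphN | exact: rmorph0 | exact: rmorph1].
rewrite /weier -f0 -f1 -!fN /pol3 /cf3 !exprS !expr0 !mulr1 !(rmorphD, rmorphM) /=.
by rewrite !map_mpolyC !map_mpolyX.
Qed.

Lemma horner_mmap (s : 'I_3 -> {poly K}) (q : {mpoly K[3]}) w :
  (mmap (@polyC K) s q).[w] = q.@[fun i => (s i).[w]].
Proof.
elim/mpoly_ring_ind: q => [c|i|F G eF eG|F G eF eG].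
- by rewrite mmapC hornerC mevalC.
- by rewrite mmapXU mevalXU.
- by rewrite rmorphD /= hornerD mevalD eF eG.
- by rewrite (rmorphM (mmap _ _)) /= hornerM mevalM eF eG.
Qed.

(** Matrices and parameters are interpolated linearly with a polynomial variable, so [G] is a form
    over [{poly K}]. [D] is the determinant times the equation of the excluded hypersurface along
    the line, so its roots are the only values at which the line may leave the family. *)
Lemma weier_line qa q1 q2 qd N0 N1 (s0 s1 : 'I_3 -> K) :
  let W s := weier qa.@[s] q1.@[s] * weier qa.@[s] q2.@[s] in
  exists (G : {mpoly {poly K}[3]}) (D : {poly K}),
  [/\ D.[0] = \det N0 * qd.@[s0] /\ D.[1] = \det N1 * qd.@[s1],
      map_mpoly (horner_eval 0) G = subst N0 (W s0), map_mpoly (horner_eval 1) G = subst N1 (W s1) &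
      forall w, D.[w] != 0 -> exists N F,
        [/\ N \in unitmx, weier_param qa q1 q2 qd F & map_mpoly (horner_eval w) G = subst N F]].
Proof.
move=> W; pose s i := line (s0 i) (s1 i); pose N : 'M[{poly K}]_3 := \matrix_(i, j) line (N0 i j) (N1 i j).
pose ev q := mmap (@polyC K) s q.
pose W' b := pol3 (-1) 0 0 0 0 (- ev qa) 0 1 0 (- ev b).
pose sw w i := (s i).[w]; pose Nw w := map_mx (horner_eval w) N.
have mapW w : map_mpoly (horner_eval w) (subst N (W' q1 * W' q2)) = subst (Nw w) (W (sw w)).
  have evE q : horner_eval w (ev q) = q.@[sw w] by exact: horner_mmap.
  have eW q : map_mpoly (horner_eval w) (W' q) = weier qa.@[sw w] q.@[sw w].
    by rewrite -!evE; exact: (map_mpoly_weier (horner_eval w)).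
  rewrite map_mpoly_subst (rmorphM (map_mpoly (horner_eval w))).
  by congr (subst _ (_ * _)); exact: eW.
have detw w : (\det N * ev qd).[w] = \det (Nw w) * qd.@[sw w].
  by rewrite hornerM horner_mmap -[(\det N).[w]]/(horner_eval w (\det N)) -det_map_mx.
have eN0 : Nw 0 = N0 by apply/matrixP => i j; rewrite !mxE /horner_eval line0.
have eN1 : Nw 1 = N1 by apply/matrixP => i j; rewrite !mxE /horner_eval line1.
have es0 q : q.@[sw 0] = q.@[s0] by apply: meval_eq => i; rewrite /sw line0.
have es1 q : q.@[sw 1] = q.@[s1] by apply: meval_eq => i; rewrite /sw line1.
exists (subst N (W' q1 * W' q2)), (\det N * ev qd); split.
- by rewrite !detw eN0 eN1 es0 es1.
- by rewrite mapW eN0 /W !es0.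
- by rewrite mapW eN1 /W !es1.
- move=> w; rewrite detw mulf_eq0 negb_or => /andP[nd nq].
  exists (Nw w), (W (sw w)); split=> //; first by rewrite unitmxE unitfE.
  by exists (sw w).
Qed.

End PolynomialFamilies.

(** * Paths in the complement of a hypersurface *)

Section Paths.
Import numFieldNormedType.Exports.
Local Open Scope complex_scope.
Variable R : realType.
Local Notation C := R[i].
Implicit Types (P D : {poly C}) (t : R).

Lemma Re_horner P : exists Q : {poly R}, forall t, complex.Re P.[t%:C] = Q.[t].
Proof.
elim/poly_ind: P => [|P c [Q eQ]]; first by exists 0 => t; rewrite !horner0.
exists (Q * 'X + (complex.Re c)%:P) => t; rewrite !hornerMXaddC -eQ.
by case: (P.[_]) c => a b [c d] /=; ring.
Qed.

Lemma Im_horner P : exists Q : {poly R}, forall t, complex.Im P.[t%:C] = Q.[t].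
Proof.
elim/poly_ind: P => [|P c [Q eQ]]; first by exists 0 => t; rewrite !horner0.
exists (Q * 'X + (complex.Im c)%:P) => t; rewrite !hornerMXaddC -eQ.
by case: (P.[_]) c => a b [c d] /=; ring.
Qed.

(** Of the parabolas [t + i c t (1 - t)], with [c] real, at most one passes
    through a given root. *)
Lemma path_avoiding_roots D : D.[0] != 0 -> D.[1] != 0 -> exists z : {poly C},
  [/\ z.[0] = 0, z.[1] = 1 & forall t, 0 <= t <= 1 -> D.[z.[t%:C]] != 0].
Proof.
move=> D0 D1; have [rs eD] := closed_field_poly_normal D.
(* On the parabola with parameter c this quotient is |c| for every t different from 0 and 1. *)
pose slope (w : C) := `|complex.Im w / (complex.Re w * (1 - complex.Re w))|.
(* Strictly above the slope of every root, so no root lies on the chosen parabola. *)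
pose c : R := 1 + \sum_(w <- rs) slope w.
pose z : {poly C} := 'X + (Complex 0 c)%:P * ('X * (1 - 'X)).
have ez (x : C) : z.[x] = x + Complex 0 c * (x * (1 - x)).
  by rewrite !(hornerD, hornerM, hornerN, hornerX, hornerC).
exists z; split; rewrite ?ez ?subrr ?mul0r ?mulr0 ?addr0 // => t /andP[t0 t1].
have nz : D != 0 by apply: contraNneq D0 => ->; rewrite horner0.
have [->|nt0] := eqVneq t 0; first by rewrite ez mul0r mulr0 addr0.
have [->|nt1] := eqVneq t 1; first by rewrite ez subrr !mulr0 addr0.
apply/negP; rewrite {1}eD hornerZ mulf_eq0 lead_coef_eq0 (negPf nz) /=.
rewrite -[_ == 0]/(root _ _) root_prod_XsubC => wrs.
have : slope z.[t%:C] <= \sum_(w <- rs) slope w.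
  by rewrite (big_rem _ wrs) /= lerDl sumr_ge0 // => w _; apply: normr_ge0.
have -> : slope z.[t%:C] = `|c|.
  have -> : z.[t%:C] = Complex t (c * (t * (1 - t))).
    by rewrite ez; apply/eqP; rewrite eq_complex /=; apply/andP; split; apply/eqP; ring.
  by rewrite /slope /= mulfK // mulf_neq0 // subr_eq0 eq_sym.
by move=> le1; have := ler_norm c; rewrite /c; lra.
Qed.

(** The parabola replaces the real segment of the line by a path on which [D] has no zero. The
    coefficients of the forms on it have real and imaginary parts that are polynomials in t, hence
    continuous. *)
Lemma family_connected (qa q1 q2 qd : {mpoly C[3]}) f0 f1 :
  family (weier_param qa q1 q2 qd) f0 -> family (weier_param qa q1 q2 qd) f1 ->
  deformation (family (weier_param qa q1 q2 qd)) f0 f1.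
Proof.
move=> [N0 [F0 [uN0 [s0 [nz0 ->]] ->]]] [N1 [F1 [uN1 [s1 [nz1 ->]] ->]]].
have [G [D [[eD0 eD1] eG0 eG1 fam]]] := weier_line qa q1 q2 qd N0 N1 s0 s1.
have nd (N : 'M[C]_3) : N \in unitmx -> \det N != 0 by rewrite unitmxE unitfE.
have [||z [z0 z1 Dz]] := @path_avoiding_roots D.
- by rewrite eD0 mulf_neq0 // nd.
- by rewrite eD1 mulf_neq0 // nd.
exists (fun t => map_mpoly (horner_eval z.[t%:C]) G); split.
- move=> m; have eP t : (map_mpoly (horner_eval z.[t%:C]) G)@_m = (G@_m \Po z).[t%:C].
    by rewrite mcoeff_map_mpoly /horner_eval horner_comp.
  have [Q eQ] := Re_horner (G@_m \Po z); have [Q' eQ'] := Im_horner (G@_m \Po z).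
  split; apply: continuous_subspaceT.
    rewrite (_ : (fun t => _) = horner Q); first exact: derive.continuous_horner.
    by apply: funext => t; rewrite eP eQ.
  rewrite (_ : (fun t => _) = horner Q'); first exact: derive.continuous_horner.
  by apply: funext => t; rewrite eP eQ'.
- have e : z.[0%:C] = 0 := z0; cbv beta; rewrite e; exact: eG0.
- have e : z.[1%:C] = 1 := z1; cbv beta; rewrite e; exact: eG1.
- by move=> t t01; apply: (fam _ (Dz t t01)).
Qed.

End Paths.

(** A member of the smooth family: the cubics y^2 z = x^3 + z^3 and y^2 z = x^3 - z^3. The value is
    2 times 27^2. *)
Lemma smooth_disc_neq0 (K : numClosedFieldType) :
  (('X_i1 - 'X_i2) * (disc_poly K i1 * disc_poly K i2)).@[vec3 0 1 (-1)] != 0.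
Proof.
rewrite smooth_discE /vec3 /= [X in X != 0](_ : _ = 1458%:R); last by ring.
by rewrite pnatr_eq0.
Qed.

Lemma single_family (R : realType) (qa q1 q2 qd : {mpoly R[i][3]}) (S : {mpoly R[i][3]} -> Prop) s :
  (forall f, S f <-> family (weier_param qa q1 q2 qd) f) -> qd.@[s] != 0 ->
  single_deformation_family S.
Proof.
move=> SE nz; split.
  exists (subst 1%:M (weier qa.@[s] q1.@[s] * weier qa.@[s] q2.@[s])).
  apply/SE; exists 1%:M, (weier qa.@[s] q1.@[s] * weier qa.@[s] q2.@[s]).
  by split; [exact: unitmx1 | exists s | ].
move=> f0 f1 /SE F0 /SE F1; have [gamma [cg g0 g1 Fg]] := family_connected F0 F1.
by exists gamma; split=> // t /Fg /SE.
Qed.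

Theorem theorem1p1p2 (R : realType) :
  (forall B : {mpoly R[i][3]},
     sextic B -> reducible B -> torus_type B ->
     (exists P : 'rV[R[i]]_3, has_singularity_type B P (A 17)) ->
     [\/ has_set_of_singularities B [:: A 17] [:: A 2],
         has_set_of_singularities B [:: A 17] [:: A 1; A 1],
         has_set_of_singularities B [:: A 17] [:: A 1] |
         has_set_of_singularities B [:: A 17] [::]]) /\
  [/\ single_deformation_family (@stratum R [:: A 17] [:: A 2]),
      single_deformation_family (@stratum R [:: A 17] [:: A 1; A 1]),
      single_deformation_family (@stratum R [:: A 17] [:: A 1]) &
      single_deformation_family (@stratum R [:: A 17] [::])].
Proof.
split=> [B sB rB tB [P sP]|].
  case: (torus_A17_families sB rB tB sP) => [/cusp_stratum|/two_node_stratum|/one_node_stratum|/smooth_stratum] [_ _ hs].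
  - by constructor 1.
  - by constructor 2.
  - by constructor 3.
  - by constructor 4.
split.
- apply: (single_family (s := vec3 1 0 0) (@cusp_stratumP R)).
  by rewrite mevalXU oner_neq0.
- apply: (single_family (s := vec3 1 0 0) (@two_node_stratumP R)).
  by rewrite mevalXU oner_neq0.
(* The member with r = 1 and b = 0: a nodal cubic and the smooth cubic y^2 z = x^3 - 3 x z^2. *)
- apply: (single_family (s := vec3 1 0 0) (@one_node_stratumP R)).
  rewrite one_discE /vec3 /= expr1n !mulr1 mul1r sub0r add0r.
  by rewrite mulf_neq0 ?oppr_eq0 ?pnatr_eq0.
- apply: (single_family (s := vec3 0 1 (-1)) (@smooth_stratumP R)).
  exact: smooth_disc_neq0.
Qed.
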